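(* Assume that $g$ satisfies A1, A2, A1* and A3w, and that $u\in C^2(\Omega)\cap C^0(\bar\Omega)$ is locally $g$-convex in the bounded domain $\Omega\subset\mathbb{R}^n$ and $u(\Omega)\subset\subset J(\Omega,Tu(\Omega))$, with $Tu(\Omega)$ sub $g^*$-convex with respect to $u$. Then if $\Omega$ is $g$-convex with respect to $(y,z)$ for all $y\in Tu(\Omega)$, $z\in g^*(\cdot,y,u)(\Omega)$, it follows that $u$ is $g$-convex in $\Omega$.
   Context: Generating functions. $\Gamma\subset\mathbb{R}^n\times\mathbb{R}^n\times\mathbb{R}$ is a domain with points $(x,y,z)$ such that the sets $I(x,y)=\{z:(x,y,z)\in\Gamma\}$ are open intervals (possibly empty); $\Gamma_x=\{(y,z):(x,y,z)\in\Gamma\}$, $\Gamma_{y,z}=\{x:(x,y,z)\in\Gamma\}$. A generating function is $g\in C^2(\Gamma)$ with $g_z\neq0$; throughout it is normalised so that $g_z<0$. Subscripts denote partial derivatives. Conditions: A1: for each $x$, the map $(g_x,g)(x,\cdot,\cdot)$ is one-to-one on $\Gamma_x$. A2: $\det E\ne0$ in $\Gamma$, where $E=g_{x,y}-(g_z)^{-1}g_{x,z}\otimes g_y$. A1*: for all $(y,z)$, the map $Q(\cdot,y,z)=-\frac{g_y}{g_z}(\cdot,y,z)$ is one-to-one on $\Gamma_{y,z}$. Let $J(x,y)=g(x,y,I(x,y))$, $\Gamma^*=\{(x,y,u):u\in J(x,y)\}$. The dual generating function $g^*$ on $\Gamma^*$ is defined by $g(x,y,g^*(x,y,u))=u$,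 and $P(x,y,u)=g_x(x,y,g^*(x,y,u))$. Let $\mathcal{U}=\{(x,u,p): u=g(x,y,z),\ p=g_x(x,y,z)\text{ for some }(x,y,z)\in\Gamma\}$. Under A1, A2 there are $C^1$ maps $Y,Z$ on $\mathcal{U}$ with $g_x(x,Y,Z)=p$, $g(x,Y,Z)=u$. Put $A(x,u,p)=g_{xx}(x,Y(x,u,p),Z(x,u,p))$, assumed twice differentiable. A3w: $(D_{p_kp_l}A_{ij})\xi_i\xi_j\eta_k\eta_l\ge0$ on $\mathcal{U}$ for all $\xi,\eta\in\mathbb{R}^n$ with $\xi\cdot\eta=0$. Convexity. $I(\Omega,y_0)=\bigcap_{x\in\Omega}I(x,y_0)$, and $J(S,S')=\bigcap_{(x,y)\in S\times S'}J(x,y)$ for sets $S,S'$ (with $J(x_0,S')=J(\{x_0\},S')$). A function $u\in C^0(\Omega)$ is $g$-convex in $\Omega$ if for each $x_0\in\Omega$ there are $y_0\in\mathbb{R}^n$, $z_0\in I(\Omega,y_0)$ with $u(x_0)=g(x_0,y_0,z_0)$ and $u\ge g(\cdot,y_0,z_0)$ in $\Omega$. A function $u\in C^2(\Omega)$ is locally $g$-convex in $\Omega$ if $(x,u(x),Du(x))\in\mathcal{U}$ and $D^2u(x)\ge A(x,u(x),Du(x))$ for all $x\in\Omega$; then $Tu=Y(\cdot,u,Du)$. $\Omega$ is $g$-convex with respect to $(y_0,z_0)$, $z_0\in I(\Omega,y_0)$, if $Q(\cdot,y_0,z_0)(\Omega)$ is convex. A set $S^*\subset\mathbb{R}^n$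 is sub $g^*$-convex with respect to $(x_0,u_0)$, $u_0\in J(x_0,S^* )$, if the convex hull of $P(x_0,\cdot,u_0)(S^* )$ is contained in $P(x_0,\cdot,u_0)(\{y:(x_0,y,u_0)\in\Gamma^*\})$; it is sub $g^*$-convex with respect to a function $u$ on $\Omega$ if this holds with respect to $(x,u(x))$ for every $x\in\Omega$. $g^*(\cdot,y,u)(\Omega)=\{g^*(x,y,u(x)):x\in\Omega\}$. *)

(* Defs.v *)
From mathcomp Require Import all_boot all_order all_algebra.
From mathcomp Require Import all_classical all_reals all_analysis.

Set Implicit Arguments.
Unset Strict Implicit.
Unset Printing Implicit Defensive.

Import Order.TTheory GRing.Theory Num.Theory.
Import numFieldNormedType.Exports.

Local Open Scope classical_set_scope.
Local Open Scope ring_scope.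

(* Functions of several real variables are total; regularity is imposed only
   at the points of the relevant (open) domain, so values outside it never
   matter. *)
Section Calculus.
Context {R : realType}.

Definition is_domain (T : topologicalType) (D : set T) : Prop :=
  open D /\ connected D.

Definition C0_on (V W : normedModType R) (D : set V) (f : V -> W) : Prop :=
  forall x, D x -> {for x, continuous f}.

Definition C1_on (V W : normedModType R) (D : set V) (f : V -> W) : Prop :=
  forall x, D x ->
    differentiable f x /\ forall v, {for x, continuous ('D_v f)}.

Definition C2_on (V W : normedModType R) (D : set V) (f : V -> W) : Prop :=
  C1_on D f /\ forall v, C1_on D ('D_v f).

(* On a finite-dimensional space, Df is differentiable iff every 'D_v f is. *)
Definition twice_differentiable_on (V W : normedModType R)
    (D : set V) (f : V -> W) : Prop :=
  forall x, D x ->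
    differentiable f x /\ forall v, differentiable ('D_v f) x.

Definition grad (n : nat) (f : 'rV[R]_n -> R) (x : 'rV[R]_n) : 'rV[R]_n :=
  \row_i 'D_(delta_mx 0 i) f x.

Definition hess (n : nat) (f : 'rV[R]_n -> R) (x : 'rV[R]_n) : 'M[R]_n :=
  \matrix_(i, j) 'D_(delta_mx 0 j) ('D_(delta_mx 0 i) f) x.

Definition dot (n : nat) (a b : 'rV[R]_n) : R := \sum_i a 0 i * b 0 i.

(* A <= B as quadratic forms. *)
Definition mx_le (n : nat) (A B : 'M[R]_n) : Prop :=
  forall xi : 'rV[R]_n, dot (xi *m A) xi <= dot (xi *m B) xi.

Definition conv_hull (n : nat) (S : set 'rV[R]_n) : set 'rV[R]_n :=
  smallest (@convex_set R 'rV[R]_n) S.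

(* A need not be open: B below is typically an intersection of open
   intervals, which is not required to be open either. *)
Definition compactly_contained (T : topologicalType) (A B : set T) : Prop :=
  compact (closure A) /\ closure A `<=` B.

End Calculus.

Section GeneratingFunctions.
Context {R : realType} {n : nat}.
Local Notation V := 'rV[R]_n.
Implicit Types (G : set (V * V * R)) (g : V -> V -> R -> R).

Definition g_x g (x y : V) (z : R) : V := grad (fun x' => g x' y z) x.
Definition g_y g (x y : V) (z : R) : V := grad (fun y' => g x y' z) y.
Definition g_z g (x y : V) (z : R) : R := derive1 (g x y) z.
Definition g_xx g (x y : V) (z : R) : 'M[R]_n := hess (fun x' => g x' y z) x.
Definition g_xy g (x y : V) (z : R) : 'M[R]_n :=
  \matrix_(i, j) 'D_(delta_mx 0 j) (fun y' => g_x g x y' z 0 i) y.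
Definition g_xz g (x y : V) (z : R) : V :=
  \row_i derive1 (fun z' => g_x g x y z' 0 i) z.

Definition I_pt G (x y : V) : set R := [set z | G (x, y, z)].

Definition generating_function G g : Prop :=
  [/\ is_domain G,
      forall x y, open (I_pt G x y) /\ is_interval (I_pt G x y),
      C2_on G (fun w : V * V * R => g w.1.1 w.1.2 w.2)
    & forall x y z, G (x, y, z) -> g_z g x y z < 0].

Definition E_mx g (x y : V) (z : R) : 'M[R]_n :=
  g_xy g x y z - (g_z g x y z)^-1 *: ((g_xz g x y z)^T *m g_y g x y z).

Definition Q g (x y : V) (z : R) : V := - ((g_z g x y z)^-1 *: g_y g x y z).

Definition A1 G g : Prop :=
  forall x, set_inj [set yz : V * R | G (x, yz.1, yz.2)]
                    (fun yz => (g_x g x yz.1 yz.2, g x yz.1 yz.2)).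

Definition A2 G g : Prop :=
  forall x y z, G (x, y, z) -> \det (E_mx g x y z) != 0.

Definition A1star G g : Prop :=
  forall y z, set_inj [set x : V | G (x, y, z)] (fun x => Q g x y z).

Definition J_pt G g (x y : V) : set R := g x y @` I_pt G x y.

Definition Gstar G g : set (V * V * R) :=
  [set w | J_pt G g w.1.1 w.1.2 w.2].

(* The solution z is unique on Gstar, because g_z < 0 on the interval
   I_pt G x y; outside Gstar the value is 0. *)
Definition gstar G g (x y : V) (u : R) : R :=
  xget 0 [set z | I_pt G x y z /\ g x y z = u].

Definition P G g (x y : V) (u : R) : V := g_x g x y (gstar G g x y u).

Definition U_set G g : set (V * R * V) :=
  [set w | exists y z, [/\ G (w.1.1, y, z),
                           w.1.2 = g w.1.1 y z & w.2 = g_x g w.1.1 y z]].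

(* The solution (y, z) is unique on U_set by A1. *)
Definition YZ G g (x : V) (u : R) (p : V) : V * R :=
  xget (0, 0) [set yz | [/\ G (x, yz.1, yz.2),
                            g_x g x yz.1 yz.2 = p & g x yz.1 yz.2 = u]].
Definition Y G g (x : V) (u : R) (p : V) : V := (YZ G g x u p).1.
Definition Z G g (x : V) (u : R) (p : V) : R := (YZ G g x u p).2.

Definition A_mx G g (x : V) (u : R) (p : V) : 'M[R]_n :=
  g_xx g x (Y G g x u p) (Z G g x u p).

Definition A_twice_differentiable G g : Prop :=
  twice_differentiable_on (U_set G g)
    (fun w : V * R * V => A_mx G g w.1.1 w.1.2 w.2).

Definition D_pp_A G g (k l i j : 'I_n) (x : V) (u : R) (p : V) : R :=
  'D_(delta_mx 0 k) ('D_(delta_mx 0 l) (fun q => A_mx G g x u q i j)) p.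

Definition A3w G g : Prop :=
  forall x u p, U_set G g (x, u, p) ->
  forall xi eta : V, dot xi eta = 0 ->
    0 <= \sum_i \sum_j \sum_k \sum_l
           D_pp_A G g k l i j x u p
             * xi 0 i * xi 0 j * eta 0 k * eta 0 l.

Definition I_set G (Om : set V) (y0 : V) : set R :=
  \bigcap_(x in Om) I_pt G x y0.

Definition J_set G g (S S' : set V) : set R :=
  \bigcap_(xy in S `*` S') J_pt G g xy.1 xy.2.

Definition g_convex G g (Om : set V) (u : V -> R) : Prop :=
  C0_on Om u /\
  forall x0, Om x0 -> exists y0 z0,
    [/\ I_set G Om y0 z0, u x0 = g x0 y0 z0
      & forall x, Om x -> g x y0 z0 <= u x].

Definition locally_g_convex G g (Om : set V) (u : V -> R) : Prop :=
  C2_on Om u /\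
  forall x, Om x ->
    U_set G g (x, u x, grad u x) /\
    mx_le (A_mx G g x (u x) (grad u x)) (hess u x).

Definition T_map G g (u : V -> R) (x : V) : V := Y G g x (u x) (grad u x).

Definition domain_g_convex G g (Om : set V) (y0 : V) (z0 : R) : Prop :=
  I_set G Om y0 z0 /\
  convex_set ((fun x => Q g x y0 z0) @` Om : set (convex_lmodType V)).

Definition sub_gstar_convex_at G g (S : set V) (x0 : V) (u0 : R) : Prop :=
  J_set G g [set x0] S u0 /\
  conv_hull ((fun y => P G g x0 y u0) @` S) `<=`
    (fun y => P G g x0 y u0) @` [set y | Gstar G g (x0, y, u0)].

Definition sub_gstar_convex G g (Om S : set V) (u : V -> R) : Prop :=
  forall x, Om x -> sub_gstar_convex_at G g S x (u x).

Definition gstar_image G g (Om : set V) (y : V) (u : V -> R) : set R :=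
  [set gstar G g x y (u x) | x in Om].

End GeneratingFunctions.

(* Main.v *)
(* Fix x0 in Om, y0 = Tu(x0), and let w(x) = g*(x, y0, u(x)), so that u >= g(., y0, m) at x
   iff w(x) <= m; x0 is a critical point of w and the claim is that it is a global maximum.
   Along a g-segment of level m (a segment in the coordinates Q(., y0, m)) the difference
   h = u - g(., y0, m) satisfies h'' >= -K(|h'| + |h|) near each of its zeros, by A3w and the
   sub g*-convexity. Hence if h <= 0 on the segment and h = h' = 0 at one point, then h
   vanishes on the rest of the segment. Call x good at level m if w >= m on the segment of
   level m from x0 to x. If m < w(x0), w(x), the strong maximum principle makes the
   inequality strict, so that goodness is an open as well as a closed condition in (x, m).
   By connectedness every x is good at some low level; if w(x) > w(x0), raising the level to
   w(x0) keeps x good, and the maximum principle started at the critical point x0 yields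
   w(x) = w(x0), a contradiction. *)

Require Import Defs.
From mathcomp Require Import all_boot all_order all_algebra.
From mathcomp Require Import all_classical all_reals all_analysis.
From mathcomp Require Import ring lra.

Import Order.TTheory GRing.Theory Num.Theory.
Import numFieldNormedType.Exports.

Local Open Scope classical_set_scope.
Local Open Scope ring_scope.

Set Implicit Arguments.
Unset Strict Implicit.
Unset Printing Implicit Defensive.

(** * Calculus on normed spaces *)

Section Calculus.
Context {R : realType}.

(** The data are barely regular. As [g] is only C2, the third derivatives of [g] that [h''] formally
    contains are not given; they are recovered from [g_xx = A(x, g, g_x)], where [A] is
    differentiable, and from the symmetry of mixed derivatives. As the second derivatives of [A]
    exist without being bounded, A3w is used through mean value theorems, and [K] involves no second
    derivative of [A]. The inequality is local because [A] is controlled only where the segment of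
    gradients from [g_x] to [Du] stays in [U_set]: sub g*-convexity gives this at contact points
    [u = g(., y0, m)], and openness of [U_set] spreads it to a neighbourhood. The inverse of
    [Q(., y0, m)] must also be followed as [m] varies. Injectivity and the invertibility of [E]
    provide this by minimising a distance, without an inverse function theorem. Convexity of the
    image of [Om] under [Q(., y0, m)] is known only for [m] in the range of [w], so every level used
    has to stay in that interval. *)

Lemma is_deriveP (V W : normedModType R) (f : V -> W) x v df :
  is_derive x v f df <->
  h^-1 *: (f (h *: v + x) - f x) @[h --> 0^'] --> df.
Proof.
split=> [[cf <-]|cf]; first exact: cf.
by apply: DeriveDef; [apply/cvg_ex; exists df|exact: cvg_lim cf].
Qed.

Lemma is_derive_comp (V W : normedModType R) (F : V -> W) (c : R -> V) t xi :
  differentiable F (c t) -> is_derive t 1 c xi ->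
  is_derive t 1 (F \o c) ('D_xi F (c t)).
Proof.
move=> dF dc; have /derivable1_diffP dc' := @ex_derive _ _ _ _ _ _ _ dc.
apply: DeriveDef; first exact/derivable1_diffP/differentiable_comp.
rewrite deriveE; last exact/differentiable_comp.
rewrite diff_comp //= -[in LHS]deriveE // -[in RHS](@derive_val _ _ _ _ _ _ _ dc).
by rewrite -deriveE // deriveE //.
Qed.

Section Pointwise.
Variables (V W : normedModType R) (x v : V).

Lemma is_derive_add (f g : V -> W) df dg : is_derive x v f df -> is_derive x v g dg ->
  is_derive x v (fun y => f y + g y) (df + dg).
Proof. by move=> df' dg'; exact: is_deriveD. Qed.

Lemma is_derive_opp (f : V -> W) df : is_derive x v f df ->
  is_derive x v (fun y => - f y) (- df).
Proof. by move=> df'; exact: is_deriveN. Qed.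

Lemma is_derive_sub (f g : V -> W) df dg : is_derive x v f df -> is_derive x v g dg ->
  is_derive x v (fun y => f y - g y) (df - dg).
Proof. by move=> df' dg'; exact: is_deriveB. Qed.

Lemma is_derive_mul (f g : V -> R) df dg : is_derive x v f df -> is_derive x v g dg ->
  is_derive x v (fun y => f y * g y) (f x * dg + g x * df).
Proof. by move=> df' dg'; exact: is_deriveM. Qed.

Lemma is_derive_cmul (f : V -> R) df c : is_derive x v f df ->
  is_derive x v (fun y => c * f y) (c * df).
Proof. by move=> df'; exact: is_deriveZ. Qed.

Lemma is_derive_bigsum m (f : 'I_m -> V -> W) (df : 'I_m -> W) :
  (forall i, is_derive x v (f i) (df i)) ->
  is_derive x v (fun y => \sum_i f i y) (\sum_i df i).
Proof.
by move=> dfi; have := @is_derive_sum _ _ _ _ f x v df dfi; rewrite fct_sumE.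
Qed.

End Pointwise.

Lemma is_derive_linear (k s : R) : is_derive s (1 : R) (fun y : R => k * y) k.
Proof.
by rewrite -[X in is_derive _ _ _ X](mulr1 k); apply: is_derive_cmul.
Qed.

Lemma is_derive_line (V : normedModType R) (w v : V) (t : R) :
  is_derive t 1 (fun s : R => w + s *: v) v.
Proof.
apply/is_deriveP; apply: cvg_near_cst; near=> h.
rewrite [_%:A]mulr1 opprD addrACA subrr add0r -scalerBl addrK scalerA mulVf ?scale1r//.
by near: h; exact: nbhs_dnbhs_neq.
Unshelve. all: by end_near. Qed.

Lemma is_derive_along (V W : normedModType R) (F : V -> W) (w v : V) (t : R) :
  differentiable F (w + t *: v) ->
  is_derive t 1 (fun s : R => F (w + s *: v)) ('D_v F (w + t *: v)).
Proof. by move=> dF; exact: (is_derive_comp dF (is_derive_line w v t)). Qed.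

Lemma is_derive_continuous (V : normedModType R) (f : R -> V) (t : R) df :
  is_derive t (1 : R) f df -> {for t, continuous f}.
Proof.
by move=> [df' _]; apply: differentiable_continuous; exact/derivable1_diffP.
Qed.

Lemma MVT_unit (phi dphi : R -> R) :
  (forall t : R, 0 <= t <= 1 -> is_derive t 1 phi (dphi t)) ->
  exists2 t : R, 0 <= t <= 1 & phi 1 - phi 0 = dphi t.
Proof.
move=> dphiP; have [t|x|t t01 ->] := @MVT R phi dphi 0 1 ltr01.
- by rewrite in_itv /= => /andP[t0 t1]; apply: dphiP; rewrite !ltW.
- apply: continuous_in_subspaceT => {}x; rewrite inE /= in_itv/= => x01.
  exact: is_derive_continuous (dphiP x x01).
exists t; last by rewrite subr0 mulr1.
by move: t01; rewrite in_itv /= => /andP[t0 t1]; rewrite !ltW.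
Qed.

Lemma mean_value (V : normedModType R) (F : V -> R) (w v : V) :
  (forall t : R, 0 <= t <= 1 -> differentiable F (w + t *: v)) ->
  exists2 t : R, 0 <= t <= 1 & F (w + v) - F w = 'D_v F (w + t *: v).
Proof.
move=> dF; have [t t01|t t01] := @MVT_unit (fun t => F (w + t *: v))
  (fun t => 'D_v F (w + t *: v)).
  exact: is_derive_along (dF t t01).
by rewrite scale1r scale0r addr0 => e; exists t.
Qed.

(** The intermediate point is located only by its distance to [a], which spares the distinction
    between [a < b] and [b < a]. *)
Lemma MVT_between (phi dphi : R -> R) (a b : R) :
  (forall x, `|x - a| <= `|b - a| -> is_derive x 1 phi (dphi x)) ->
  exists2 x, `|x - a| <= `|b - a| & phi b - phi a = dphi x * (b - a).
Proof.
move=> dphiP.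
have bnd t : 0 <= t <= 1 -> `|a + t *: (b - a) - a| <= `|b - a|.
  move=> /andP[t0 t1]; rewrite addrAC subrr add0r normrZ ger0_norm//.
  by rewrite ler_piMl.
have [t t01|t t01] := @mean_value R^o phi a (b - a).
  by apply/derivable1_diffP; apply: ex_derive; exact: dphiP (bnd t t01).
rewrite addrCA subrr addr0 => ->; exists (a + t *: (b - a)); first exact: bnd.
have d := dphiP _ (bnd t t01).
have /derivable1_diffP df := @ex_derive _ _ _ _ _ _ _ d.
have -> : 'D_(b - a) phi (a + t *: (b - a)) = (b - a) *: 'D_1 phi (a + t *: (b - a)).
  by rewrite !deriveE // -linearZ /= [(b - a) *: _]mulr1.
by rewrite (@derive_val _ _ _ _ _ _ _ d) [_ *: _]mulrC.
Qed.

Lemma mean_value_bound (phi dphi : R -> R) (a r M : R) :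
  (forall x, `|x - a| < r -> is_derive x 1 phi (dphi x)) ->
  (forall x, `|x - a| < r -> `|dphi x| <= M) ->
  forall b, `|b - a| < r -> `|phi b - phi a| <= M * `|b - a|.
Proof.
move=> dphiP bd b bar.
have [x xab|x xab ->] := @MVT_between phi dphi a b.
  exact/dphiP/(le_lt_trans xab).
by rewrite normrM ler_wpM2r// bd// (le_lt_trans xab).
Qed.

(* Peano's form of the symmetry of mixed partial derivatives: only one of the
   two mixed derivatives is assumed to exist. *)
Lemma derive_mixed (f fs fse : R -> R -> R) (fe : R -> R) (t : R) :
  (\forall p \near (t, 0 : R), is_derive (p.1 : R) 1 (f^~ p.2) (fs p.1 p.2)) ->
  (\forall p \near (t, 0 : R), is_derive (p.2 : R) 1 (fs p.1) (fse p.1 p.2)) ->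
  {for (t, 0 : R), continuous (fun p : R * R => fse p.1 p.2)} ->
  (\forall s \near t, is_derive (0 : R) 1 (f s) (fe s)) ->
  is_derive t 1 fe (fse t 0).
Proof.
move=> dfs dfse cfse dfe; set L := fse t 0.
apply/is_deriveP; apply/cvgrPdist_le => e e0.
have [r r0 rP] : exists2 r, 0 < r & forall s x : R, `|s - t| < r -> `|x| < r ->
   [/\ is_derive s 1 (f^~ x) (fs s x), is_derive x 1 (fs s) (fse s x)
     & `|fse s x - L| <= e].
  move/cvgrPdist_le : cfse => /(_ e e0) cfse.
  have [r/= r0 rP] := (nbhs_ballP (t, 0 : R) _).1 (filterI (filterI dfs dfse) cfse).
  exists r => // s x st xr.
  have /rP[[/= ? ?]] : ball (t, 0 : R) r (s, x).
    by split; rewrite /ball/= distrC// subr0.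
  by rewrite distrC.
near=> h; rewrite [_%:A]mulr1.
have h0 : h != 0 by near: h; exact: nbhs_dnbhs_neq.
have hr : `|h| < r by near: h; exact: dnbhs0_lt.
(* The second difference over the rectangle with sides [h] and [x] is compared with [L * x * h] by a
   mean value estimate in [s], whose derivative bound is itself a mean value estimate in [x]. *)
have key (x : R) : `|x| < r ->
    `|(f (h + t) x - f (h + t) 0) - (f t x - f t 0) - L * x * h| <= e * `|x| * `|h|.
  move=> xr.
  pose phi s := f s x - f s 0 - (L * x) * s.
  have dphi (s : R) : `|s - t| < r -> is_derive s 1 phi (fs s x - fs s 0 - (L * x)).
    move=> st; have [d1 _ _] := rP _ _ st xr.
    have [d2 _ _] := rP s 0 st ltac:(by rewrite normr0).
    exact: is_derive_sub (is_derive_sub d1 d2) (is_derive_linear _ _).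
  have bphi (s : R) : `|s - t| < r -> `|fs s x - fs s 0 - (L * x)| <= e * `|x|.
    move=> st; pose chi y := fs s y - L * y.
    have dchi (y : R) : `|y - 0| < r -> is_derive y 1 chi (fse s y - L).
      rewrite subr0 => yr; have [_ d1 _] := rP s y st yr.
      exact: is_derive_sub d1 (is_derive_linear _ _).
    have bchi (y : R) : `|y - 0| < r -> `|fse s y - L| <= e.
      by rewrite subr0 => yr; have [] := rP s y st yr.
    have := mean_value_bound dchi bchi (b := x); rewrite subr0 => /(_ xr).
    by rewrite /chi mulr0 subr0 addrAC.
  have := mean_value_bound dphi bphi (b := h + t); rewrite addrK => /(_ hr).
  rewrite /phi.
  by congr (`|_| <= _); ring.
have dh : is_derive (0 : R) 1 (f (h + t)) (fe (h + t)).
  near: h; apply: (cvg_within (F := nbhs (0:R)) ) => /=.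
  have : h + t @[h --> (0 : R)] --> t.
    rewrite -[X in _ --> X]add0r; apply: cvgD; [exact: cvg_id|exact: cvg_cst].
  by move=> /(_ _ dfe).
have d0 : is_derive (0 : R) 1 (f t) (fe t) by exact: nbhs_singleton dfe.
suff : `|fe (h + t) - fe t - L * h| <= e * `|h|.
  rewrite -[h^-1 *: _]/(h^-1 * _) => H.
  rewrite -(@ler_pM2r _ `|h|) ?normr_gt0// -normrM mulrBl mulrAC mulVf// mul1r.
  by rewrite distrC.
(* Divided by [x], the second difference tends to the increment of [fe] as [x] tends to 0, and the
   bound passes to the limit. *)
have cv : x^-1 *: (f (h + t) (x *: 1 + 0) - f (h + t) 0) - x^-1 *: (f t (x *: 1 + 0) - f t 0) - L * h
    @[x --> 0^'] --> fe (h + t) - fe t - L * h.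
  by apply: cvgB; [apply: cvgB; exact/is_deriveP|exact: cvg_cst].
have cvn := cvg_norm (FF := dnbhs_filter _) cv.
rewrite -(cvg_lim _ cvn) //; apply: limr_le; first by apply/cvg_ex; eexists; exact: cvn.
near=> x; rewrite [_%:A]mulr1 addr0.
have x0 : x != 0 by near: x; exact: nbhs_dnbhs_neq.
have xr : `|x| < r by near: x; exact: dnbhs0_lt.
rewrite -(@ler_pM2r _ `|x|) ?normr_gt0// -normrM [leRHS]mulrAC.
apply: le_trans (key _ xr); rewrite le_eqVlt; apply/orP; left; apply/eqP; congr (`|_|).
rewrite -![_ *: _]/(_ * _); field; exact: x0.
Unshelve. all: by end_near. Qed.

(** Since [a] vanishes at [t], the difference quotient of the product is that of [a] times a value
    of [k], so continuity of [k] suffices. This allows velocities to occur as factors without being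
    differentiated. *)
Lemma is_derive_mul0 (a k : R -> R) (t a' : R) : is_derive t (1 : R) a a' ->
  a t = 0 -> {for t, continuous k} -> is_derive t (1 : R) (fun s => a s * k s) (a' * k t).
Proof.
move=> /is_deriveP da at0 ck; apply/is_deriveP.
have ht : h *: 1 + t @[h --> (0 : R)^'] --> t.
  rewrite -[X in _ --> X]add0r; apply: cvgD; last exact: cvg_cst.
  apply: (@cvg_trans _ (h @[h --> (0 : R)^'])).
    by apply: near_eq_cvg; near=> h; rewrite [_%:A]mulr1.
  by apply: cvg_within_filter; exact: cvg_id.
have kt : k (h *: 1 + t) @[h --> (0 : R)^'] --> k t by exact: cvg_comp ht ck.
rewrite (_ : (fun h => _) = fun h => (h^-1 *: (a (h *: 1 + t) - a t)) * k (h *: 1 + t)).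
  exact: cvgM da kt.
by apply/funext => h; rewrite at0 !subr0 mul0r subr0 -scalerAl.
Unshelve. all: by end_near. Qed.

(** Both sides are limits of the same difference quotients, so nothing is asked of [F]. It turns
    partial derivatives into directional derivatives on a product space. *)
Lemma derive_affine (U W1 W2 : normedModType R) (F : W1 -> W2) (iota : U -> W1) a v L :
  (forall h : R, iota (h *: v + a) = h *: L + iota a) ->
  'D_v (fun u => F (iota u)) a = 'D_L F (iota a).
Proof.
move=> iotaP; rewrite /derive; set g1 := fun h => h^-1 *: _; set g2 := fun h => h^-1 *: _.
by suff -> : g1 = g2 by []; apply/funext => h; rewrite /g1 /g2 /= iotaP.
Qed.

End Calculus.

Section MoreCalculus.
Context {R : realType}.

Section Direction.
Variables (V W : normedModType R) (F : V -> W) (w : V).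
Hypothesis dF : differentiable F w.

Lemma derive_dirD v v' : 'D_(v + v') F w = 'D_v F w + 'D_v' F w.
Proof. by rewrite !deriveE// linearD. Qed.

Lemma derive_dirZ c v : 'D_(c *: v) F w = c *: 'D_v F w.
Proof. by rewrite !deriveE// linearZ. Qed.

Lemma derive_dir_sum m (v : 'I_m -> V) :
  'D_(\sum_i v i) F w = \sum_i 'D_(v i) F w.
Proof. by rewrite deriveE// linear_sum; apply: eq_bigr => i _; rewrite deriveE. Qed.

End Direction.

(** [derive_mixed] is applied in the plane through [w] spanned by [v] and [v']. *)
Lemma C2_symmetric (W : normedModType R) (D : set W) (f : W -> R) v v' w :
  open D -> C2_on D f -> D w -> 'D_v ('D_v' f) w = 'D_v' ('D_v f) w.
Proof.
move=> oD [f1 f2] Dw.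
pose l (s x : R) := w + s *: v + x *: v'.
have lc : {for (0 : R, 0 : R), continuous (fun p : R * R => l p.1 p.2)}.
  apply: cvgD; [apply: cvgD; [exact: cvg_cst|]|]; apply: cvgZr_tmp.
    exact: cvg_fst.
  exact: cvg_snd.
have l0 : l 0 0 = w by rewrite /l !scale0r !addr0.
have nD : \forall p \near (0 : R, 0 : R), D (l p.1 p.2).
  by apply: lc; rewrite /= l0; exact: open_nbhs_nbhs.
have H : is_derive (0 : R) 1 (fun s : R => 'D_v' f (w + s *: v)) ('D_v' ('D_v f) (l 0 0)).
  apply: (@derive_mixed _ (fun s x => f (l s x)) (fun s x => 'D_v f (l s x))
    (fun s x => 'D_v' ('D_v f) (l s x))).
  - near=> p; rewrite /l /=.
    have /f1[df _] : D (l p.1 p.2) by near: p.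
    have e s : w + s *: v + p.2 *: v' = (w + p.2 *: v') + s *: v by rewrite addrAC.
    rewrite (_ : (fun _ => _) = (fun s : R => f ((w + p.2 *: v') + s *: v))); last first.
      by apply/funext => s; rewrite e.
    by rewrite /l e; apply: is_derive_along; rewrite -e.
  - near=> p.
    have /(f2 v)[df _] : D (l p.1 p.2) by near: p.
    exact: is_derive_along.
  - apply: (@continuous_comp _ _ _ (fun p : R * R => l p.1 p.2) ('D_v' ('D_v f))) => //=.
    by rewrite l0; have [_] := f2 v _ Dw; exact.
  - have nD' : \forall s \near (0 : R), D (l s 0).
      have c1 : {for (0 : R), continuous (fun s => l s 0)}.
        apply: cvgD; [apply: cvgD; [exact: cvg_cst|]|exact: cvg_cst].
        by apply: cvgZr_tmp; exact: cvg_id.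
      by apply: c1; rewrite /= l0; exact: open_nbhs_nbhs.
    near=> s.
    have /f1[df _] : D (l s 0) by near: s.
    rewrite -[X in 'D_v' f X]addr0 -(scale0r v'); exact: is_derive_along.
have [df _] := f2 v' _ Dw.
have H' : is_derive (0 : R) 1 (fun s : R => 'D_v' f (w + s *: v)) ('D_v ('D_v' f) w).
  have := @is_derive_along _ _ _ ('D_v' f) w v 0.
  by rewrite scale0r addr0 => H'; exact: (H' df).
by rewrite -(@derive_val _ _ _ _ _ _ _ H') (@derive_val _ _ _ _ _ _ _ H) l0.
Unshelve. all: by end_near. Qed.

(** To first order [f w - q] shrinks by the factor [1 - h], and the error is less than half of [h]
    times its norm. Only the triangle inequality enters, so the norm may be the non-smooth max norm
    of row vectors. *)
Lemma decrease_along (W W' : normedModType R) (f : W -> W') w v q :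
  is_derive w v f (- (f w - q)) -> f w != q ->
  \forall h \near (0 : R)^'+, `|f (h *: v + w) - q| < `|f w - q|.
Proof.
move=> /is_deriveP df fwq; set e := f w - q.
have e0 : 0 < `|e| by rewrite normr_gt0 subr_eq0.
have /cvgrPdist_lt/(_ (`|e| / 2)) := df.
rewrite divr_gt0// => /(_ isT) near0.
have nr : \forall h \near (0 : R)^'+,
    `|- e - h^-1 *: (f (h *: v + w) - f w)| < `|e| / 2.
  case: near0 => r /= r0 rP; exists r => // h hr h0; apply: rP => //.
  by rewrite gt_eqF.
near=> h.
have h0 : 0 < h by near: h; exact: nbhs_right_gt.
have h1 : h < 1 by near: h; exact: nbhs_right_lt.
have H : `|- e - h^-1 *: (f (h *: v + w) - f w)| < `|e| / 2 by near: h.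
set b := h^-1 *: _ in H; set a := - e - b in H.
have hb : f (h *: v + w) = h *: b + f w.
  by rewrite /b scalerA divff ?gt_eqF// scale1r subrK.
have -> : f (h *: v + w) - q = (1 - h) *: e - h *: a.
  rewrite hb -addrA -/e /a -opprD scalerN opprK (scalerDr h e b) (scalerBl 1 h e) scale1r.
  by rewrite [RHS]addrA subrK addrC.
apply: le_lt_trans (ler_normB _ _) _.
rewrite !normrZ !gtr0_norm ?subr_gt0//.
by nra.
Unshelve. all: by end_near. Qed.

End MoreCalculus.

(** * Local inversion without an inverse function theorem *)

Section LocalInversion.
Context {R : realType}.

(* An injective map with onto derivatives is locally onto, uniformly in a
   parameter: the minimiser of the distance to the target over a small compact
   neighbourhood is interior, hence a solution. *)
Lemma local_surj (P : topologicalType) (W W' : normedModType R)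
    (f : P -> W -> W') (p0 : P) (w0 : W) (K B : set W) :
  compact K -> open B -> B `<=` K -> B w0 ->
  (forall w, K w -> {for (p0, w), continuous (fun q => f q.1 q.2)}) ->
  (forall w, K w -> f p0 w = f p0 w0 -> w = w0) ->
  (\forall p \near p0, forall w, K w -> {for w, continuous (f p)}) ->
  (\forall p \near p0, forall w, B w -> forall e, exists v,
     is_derive w v (f p) e) ->
  \forall q \near (p0, f p0 w0), exists2 w, B w & f q.1 w = q.2.
Proof.
move=> cK oB BK Bw0 cf inj cfp dfp.
have cS : compact (K `&` ~` B).
  by apply: compact_closedI => //; exact: open_closedC.
(* By injectivity [f p0] keeps a distance from [f p0 w0] on the compact set of points of [K] outside
   [B]. For all nearby data [w0] is then closer to the target than any such point, which forces a
   minimiser over [K] into [B]. *)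
have far : \forall q \near (p0, f p0 w0),
    K `&` ~` B `<=` [set w | `|f q.1 w0 - q.2| < `|f q.1 w - q.2|].
  move/compact_near_coveringP : cS => /(_ _ (nbhs (p0, f p0 w0))
    (fun (q : P * W') w => `|f q.1 w0 - q.2| < `|f q.1 w - q.2|)); apply.
  move=> w [Kw nBw].
  have fw : 0 < `|f p0 w - f p0 w0|.
    by rewrite normr_gt0 subr_eq0; apply/eqP => /(inj _ Kw) ww0; apply: nBw; rewrite ww0.
  have c0 : `|f z.2.1 w0 - z.2.2| @[z --> (w, (p0, f p0 w0))] --> (0 : R).
    rewrite -(@normr0 _ W') -(subrr (f p0 w0)); apply: cvg_norm; apply: cvgB.
      apply: (@continuous_comp _ _ _ (fun z : W * (P * W') => (z.2.1, w0))
        (fun q => f q.1 q.2) (w, (p0, f p0 w0))).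
        apply: cvg_pair => //=; last exact: cvg_cst.
        by apply: cvg_comp; [exact: cvg_snd|exact: cvg_fst].
      exact/cf/BK.
    by apply: cvg_comp; [exact: cvg_snd|exact: cvg_snd].
  have c1 : `|f z.2.1 z.1 - z.2.2| @[z --> (w, (p0, f p0 w0))] --> `|f p0 w - f p0 w0|.
    apply: cvg_norm; apply: cvgB.
      apply: (@continuous_comp _ _ _ (fun z : W * (P * W') => (z.2.1, z.1))
        (fun q => f q.1 q.2) (w, (p0, f p0 w0))).
        apply: cvg_pair => //=; last exact: cvg_fst.
        by apply: cvg_comp; [exact: cvg_snd|exact: cvg_fst].
      exact: cf.
    by apply: cvg_comp; [exact: cvg_snd|exact: cvg_snd].
  set c := `|f p0 w - f p0 w0| in fw c1.
  have H0 : \forall z \near (w, (p0, f p0 w0)), `|f z.2.1 w0 - z.2.2| < c / 2.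
    by apply: (cvgr_lt _ c0); rewrite divr_gt0.
  have H1 : \forall z \near (w, (p0, f p0 w0)), c / 2 < `|f z.2.1 z.1 - z.2.2|.
    by apply: (cvgr_gt _ c1); rewrite ltr_pdivrMr// ltr_pMr// ltr1n.
  by apply: filterS2 H0 H1 => z /= z0 z1; exact: lt_trans z0 z1.
have c1 : q.1 @[q --> (p0, f p0 w0)] --> p0 by exact: cvg_fst.
have cfp' : \forall q \near (p0, f p0 w0), forall w, K w -> {for w, continuous (f q.1)}.
  exact: (c1 _ cfp).
have dfp' : \forall q \near (p0, f p0 w0), forall w, B w -> forall e, exists v,
     is_derive w v (f q.1) e.
  exact: (c1 _ dfp).
near=> q.
have qfar : K `&` ~` B `<=` [set w | `|f q.1 w0 - q.2| < `|f q.1 w - q.2|] by near: q.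
have qc : forall w, K w -> {for w, continuous (f q.1)} by near: q.
have qd : forall w, B w -> forall e, exists v, is_derive w v (f q.1) e by near: q.
have [|//||w] := @compact_EVT_min _ _ (fun w => `|f q.1 w - q.2|) K.
- by exists w0; exact: BK.
- apply: continuous_in_subspaceT => w /set_mem Kw.
  by apply: cvg_norm; apply: cvgB; [exact: qc|exact: cvg_cst].
move=> /set_mem Kw wmin.
have Bw : B w.
  apply: contrapT => nBw; have := qfar w (conj Kw nBw); rewrite /= ltNge.
  by rewrite wmin//; apply/mem_set/BK.
exists w => //; apply/eqP; apply: contraT => fwq.
(* If the minimiser missed the target, the onto derivative would supply a direction pointing
   straight at it, hence a smaller distance. *)
have [v dv] := qd w Bw (- (f q.1 w - q.2)).
have dec := decrease_along dv fwq.
have Bh : \forall h \near (0 : R)^'+, B (h *: v + w).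
  apply: cvg_within => /=.
  have ch : h *: v + w @[h --> (0 : R)] --> w.
    rewrite -[X in _ --> X]add0r; apply: cvgD; last exact: cvg_cst.
    by rewrite -(scale0r v); apply: cvgZr_tmp; exact: cvg_id.
  by apply: ch; exact: open_nbhs_nbhs.
near (0 : R)^'+ => h.
have : `|f q.1 (h *: v + w) - q.2| < `|f q.1 w - q.2| by near: h.
rewrite ltNge wmin//; apply/mem_set/BK; by near: h.
Unshelve. all: by end_near. Qed.

(** Applying [M] to the expansion of [f] at [c t] expresses the increment of [c] by that of [f \o c]
    up to an error small against the increment of [c] itself. Continuity of [c] lets this error be
    absorbed, which first shows that the increment is O(h) and then identifies the derivative. *)
Lemma is_derive_inverse (V W : normedModType R) (f : V -> W) (c : R -> V) (t : R)
    (e : W) (M : {linear W -> V}) :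
  differentiable f (c t) -> {for t, continuous c} ->
  is_derive t (1 : R) (f \o c) e -> continuous M ->
  (forall v, M ('d f (c t) v) = v) ->
  is_derive t (1 : R) c (M e).
Proof.
move=> df cc dfc cM MK.
have [k k0 Mk] := linear_lipschitz cM.
pose D h := c (h + t) - c t.
have cD : D h @[h --> (0 : R)] --> (0 : V).
  rewrite -(subrr (c t)); apply: cvgB; last exact: cvg_cst.
  have ht : h + t @[h --> (0 : R)] --> t.
    by rewrite -[X in _ --> X]add0r; apply: cvgD; [exact: cvg_id|exact: cvg_cst].
  exact: cvg_comp ht cc.
have /is_deriveP/cvgrPdist_lt dfc' := dfc.
have rem eps : 0 < eps -> \forall h \near (0 : R),
    `|f (c (h + t)) - f (c t) - 'd f (c t) (D h)| <= eps * `|D h|.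
  move=> eps0; have /eqaddoP/(_ eps eps0) H := diff_locally df.
  have {}H := cD _ H; near=> h.
  have : `|(f \o shift (c t)) (D h) - (f (c t) + 'd f (c t) (D h))| <= eps * `|D h|.
    by near: h.
  by rewrite /= /D subrK opprD addrA.
apply/is_deriveP/cvgrPdist_le => eps eps0.
(* The first entry gives [k * e1 <= 1/2], for the absorption; the second makes the remaining error
   at most [eps / 2] after division by [h]. *)
pose e1 := Num.min (2 * k)^-1 (eps / (k * (4 * k * (`|e| + 1)))).
have e1p : 0 < `|e| + 1 by rewrite ltr_wpDl.
have e10 : 0 < e1 by rewrite lt_min invr_gt0 mulr_gt0//= divr_gt0// !mulr_gt0.
(* The entry 1 bounds the increment of [f \o c] by [(|e| + 1) |h|]; the other one yields the second
   [eps / 2]. *)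
pose e2 := Num.min 1 (eps / (2 * k)).
have e20 : 0 < e2 by rewrite lt_min ltr01 divr_gt0// mulr_gt0.
near=> h.
have h0 : h != 0 by near: h; exact: nbhs_dnbhs_neq.
rewrite [_%:A]mulr1; change (`|M e - h^-1 *: D h| <= eps).
have r1 : `|f (c (h + t)) - f (c t) - 'd f (c t) (D h)| <= e1 * `|D h|.
  near: h; apply: cvg_within => /=; exact: rem.
have r2 : `|e - h^-1 *: (f (c (h + t)) - f (c t))| < e2.
  have : `|e - h^-1 *: ((f \o c) (h *: 1 + t) - (f \o c) t)| < e2.
    by near: h; exact: dfc' e2 e20.
  by rewrite [_%:A]mulr1.
set F := f (c (h + t)) - f (c t) in r1 r2.
have DE : D h = M F - M (F - 'd f (c t) (D h)) by rewrite [M (F - _)]linearB MK opprB addrC subrK.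
have hp : 0 < `|h| by rewrite normr_gt0.
have Fb : `|F| <= (`|e| + 1) * `|h|.
  rewrite -ler_pdivrMr// mulrC -normfV -normrZ.
  rewrite (_ : _ *: F = e - (e - h^-1 *: F)); last by rewrite opprB addrC subrK.
  apply: le_trans (ler_normB _ _) _; rewrite lerD2l.
  by apply/ltW/(lt_le_trans r2); rewrite ge_min lexx.
have Db : `|D h| <= 2 * k * ((`|e| + 1) * `|h|).
  have : `|D h| <= k * `|F| + k * (e1 * `|D h|).
    rewrite {1}DE; apply: le_trans (ler_normB _ _) _; apply: lerD.
      exact: Mk.
    by apply: le_trans (Mk _) _; rewrite ler_pM2l.
  have : k * (e1 * `|D h|) <= 2^-1 * `|D h|.
    rewrite mulrA ler_wpM2r//.
    have : e1 <= (2 * k)^-1 by rewrite ge_min lexx.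
    by rewrite -(ler_pM2l k0) invfM mulrCA divff ?gt_eqF// mulr1.
  have : k * `|F| <= k * ((`|e| + 1) * `|h|) by rewrite ler_pM2l.
  by lra.
clearbody F; move: (D h) r1 DE Db => d r1 DE Db.
rewrite (_ : M e - h^-1 *: d = M (e - h^-1 *: F) + h^-1 *: M (F - 'd f (c t) d)); last first.
  rewrite [M (e - _)]linearB linearZ /= -addrA; congr (_ + _).
  by rewrite {1}DE opprB scalerBr [M (h^-1 *: F)]linearZ addrC.
apply: le_trans (ler_normD _ _) _; rewrite (splitr eps); apply: lerD.
  apply: le_trans (Mk _) _; rewrite mulrC -ler_pdivlMr//.
  apply/ltW/(lt_le_trans r2).
  by rewrite -mulrA -invfM ge_min lexx orbT.
rewrite normrZ normfV ler_pdivrMl// mulrC.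
apply: le_trans (Mk _) _; apply: (@le_trans _ _ (k * (e1 * `|d|))).
  by rewrite ler_pM2l.
apply: (@le_trans _ _ (k * (e1 * (2 * k * ((`|e| + 1) * `|h|))))).
  by rewrite ler_pM2l// ler_pM2l.
have : e1 <= eps / (k * (4 * k * (`|e| + 1))) by rewrite ge_min lexx orbT.
rewrite ler_pdivlMr ?mulr_gt0// => H.
have : e1 * (k * (4 * k * (`|e| + 1))) * `|h| <= eps * `|h| by rewrite ler_pM2r.
by lra.
Unshelve. all: by end_near. Qed.

End LocalInversion.

(** * A one-dimensional second-order inequality with zero Cauchy data *)

Section SecondOrder.
Context {R : realType}.

(** The maximum may sit at the right end of the interval, so only difference quotients from the left
    are available. *)
Lemma derive_left_max (phi : R -> R) (a T d : R) : a < T ->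
  is_derive T (1 : R) phi d -> (forall t, a <= t <= T -> phi t <= phi T) -> 0 <= d.
Proof.
move=> aT /is_deriveP dphi phimax; rewrite leNgt; apply/negP => d0.
have [r r0 rP] : exists2 r, 0 < r & forall h, `|h| < r -> h != 0 ->
    h^-1 * (phi (h + T) - phi T) < 0.
  have : \forall h \near (0 : R)^', h^-1 *: (phi (h *: 1 + T) - phi T) < 0.
    exact: (cvgr_lt _ dphi).
  move=> [r /= r0 rP]; exists r => // h hr h0.
  have := rP h; rewrite /ball/= sub0r normrN => /(_ hr h0).
  by rewrite [_%:A]mulr1.
pose h := - Num.min (r / 2) (T - a).
have m0 : 0 < Num.min (r / 2) (T - a) by rewrite lt_min subr_gt0 aT divr_gt0.
have h0 : h < 0 by rewrite /h oppr_lt0.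
have hr : `|h| < r.
  rewrite normrN gtr0_norm// gt_min; apply/orP; left.
  by rewrite ltr_pdivrMr// ltr_pMr// ltr1n.
have ha : a - T <= h by rewrite lerNr opprB ge_min lexx orbT.
have hn0 : h != 0 by rewrite lt_eqF.
have := rP h hr hn0; rewrite nmulr_rlt0 ?invr_lt0// subr_gt0 ltNge phimax//.
by apply/andP; split; lra.
Qed.

(* Locally, [v'' <= K (|v'| + v)] forces a nonnegative [v] with zero Cauchy data
   to vanish: maximise [v' (1 - lam (t - t0))] with [lam] large. *)
Lemma second_order_zero (v v1 v2 : R -> R) (t0 r K : R) :
  0 < r -> 0 <= K -> 2 * (3 * K + 1) * r <= 1 ->
  (forall t, t0 <= t <= t0 + r -> is_derive t (1 : R) v (v1 t)) ->
  (forall t, t0 <= t <= t0 + r -> is_derive t (1 : R) v1 (v2 t)) ->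
  (forall t, t0 <= t <= t0 + r -> 0 <= v t) ->
  (forall t, t0 <= t <= t0 + r -> v2 t <= K * (`|v1 t| + v t)) ->
  v t0 = 0 -> v1 t0 = 0 ->
  forall t, t0 <= t <= t0 + r -> v t = 0.
Proof.
move=> r0 K0 rK dv dv1 v0 v2K vt0 v1t0.
have r1 : r <= 2^-1 by nra.
(* [lam] exceeds the [2 * K] left over at a positive maximum [T] of [phi], where [v] is at most
   [v1]; and [2 * lam * r <= 1] keeps the weight between 1/2 and 1. *)
set lam := 3 * K + 1 in rK *.
have lam0 : 0 < lam by rewrite /lam; lra.
have grow (M T : R) : (forall s, t0 <= s <= T -> v1 s <= M) -> 0 <= M ->
    t0 <= T <= t0 + r -> v T <= M * r.
  move=> v1M M0 /andP[T0 Tr]; have [c cT|x|c cT] := @MVT_segment R v v1 t0 T T0.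
  - by apply: dv; move: cT; rewrite in_itv/= => /andP[? ?]; apply/andP; split; lra.
  - apply: continuous_in_subspaceT => {}x; rewrite inE/= in_itv/= => /andP[? ?].
    by apply: is_derive_continuous (dv x _); apply/andP; split; lra.
  rewrite vt0 subr0 => ->; have := v1M c; move: cT; rewrite in_itv/= => cT /(_ cT) H.
  have : 0 <= T - t0 by lra.
  by nra.
pose phi t := v1 t * (1 + - lam * (t - t0)).
have dphi t : t0 <= t <= t0 + r ->
    is_derive t (1 : R) phi (v1 t * (- lam) + (1 + - lam * (t - t0)) * v2 t).
  move=> tr; apply: is_derive_mul; first exact: dv1.
  have d1 : is_derive t (1 : R) (fun s : R => s - t0) 1.
    rewrite -[X in is_derive _ _ _ X]subr0.
    exact: is_derive_sub.
  rewrite -[X in is_derive _ _ _ X]add0r; apply: is_derive_add.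
  by rewrite -[X in is_derive _ _ _ X]mulr1; exact: is_derive_cmul.
have [||T Tr Tmax] := @EVT_max R phi t0 (t0 + r); first by lra.
  apply: continuous_in_subspaceT => x; rewrite inE/= in_itv/= => xr.
  exact: is_derive_continuous (dphi x xr).
have Tr' : t0 <= T <= t0 + r by move: Tr; rewrite in_itv.
have wpos t : t0 <= t <= t0 + r -> 2^-1 <= 1 + - lam * (t - t0) <= 1.
  by move=> /andP[? ?]; apply/andP; split; nra.
have phiT : phi T <= 0.
  rewrite leNgt; apply/negP => phiT.
  have Tt0 : t0 < T.
    rewrite lt_neqAle; case/andP: (Tr') => -> _; rewrite andbT.
    by apply/eqP => e; move: phiT; rewrite -e /phi v1t0 mul0r ltxx.
  have wT := wpos T Tr'.
  have v1T : 0 < v1 T by move: phiT wT; rewrite /phi => ? /andP[? ?]; nra.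
  have phile : phi T <= v1 T by move: wT; rewrite /phi => /andP[? ?]; nra.
  (* The weight varies by a factor of at most 2, so maximality of [phi] at [T] controls [v1] on all
     of [[t0, T]]. Integrating, with [r <= 1/2], bounds [v T] by [v1 T]. *)
  have v1b s : t0 <= s <= T -> v1 s <= 2 * v1 T.
    move=> sT; have sr : t0 <= s <= t0 + r.
      by case/andP: sT => ? ?; case/andP: Tr' => ? ?; apply/andP; split; lra.
    have := Tmax s; rewrite in_itv/= => /(_ sr); have := wpos s sr.
    rewrite {1}/phi => /andP[w1 w2] H.
    have [//|] := leP (v1 s) (2 * v1 T); nra.
  have vT : v T <= 2 * v1 T * r by apply: grow => //; lra.
  have dT := dphi T Tr'.
  have := derive_left_max Tt0 dT.
  have H s : t0 <= s <= T -> phi s <= phi T.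
    move=> sT; apply: Tmax; rewrite in_itv/=.
    by case/andP: sT => ? ?; case/andP: Tr' => ? ?; apply/andP; split; lra.
  move=> /(_ H) D.
  have := v2K T Tr'; rewrite gtr0_norm// => v2T.
  have vT' : v T <= v1 T by nra.
  have v2T' : v2 T <= 2 * K * v1 T.
    apply: (le_trans v2T); rewrite [2 * K]mulrC -mulrA ler_wpM2l//; lra.
  move: wT => /andP[w1 w2].
  have : (1 + - lam * (T - t0)) * v2 T <= 2 * K * v1 T.
    have := v0 T Tr'; have [|] := leP 0 (v2 T); nra.
  by rewrite /lam in D *; nra.
have v1le t : t0 <= t <= t0 + r -> v1 t <= 0.
  move=> tr; have := Tmax t; rewrite in_itv/= => /(_ tr).
  have := wpos t tr; rewrite {1}/phi => /andP[? ?] ?.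
  by have [//|] := leP (v1 t) 0; nra.
move=> t tr; apply/eqP; rewrite eq_le v0// andbT.
rewrite -(mul0r r); apply: grow => // s st; apply: v1le.
by case/andP: st => ? ?; case/andP: tr => ? ?; apply/andP; split; lra.
Qed.

End SecondOrder.

(** * Continuity, products and segments *)

Section Topology.
Context {R : realType}.

Lemma continuous_pair (T U W : topologicalType) (f : T -> U) (h : T -> W) (w : T) :
  {for w, continuous f} -> {for w, continuous h} -> {for w, continuous (fun t => (f t, h t))}.
Proof. by move=> cf ch; exact: cvg_pair. Qed.

Lemma continuous_fst_comp (T U W : topologicalType) (f : T -> U * W) (w : T) :
  {for w, continuous f} -> {for w, continuous (fun t => (f t).1)}.
Proof. by move=> cf; exact: cvg_comp cf cvg_fst. Qed.

Lemma continuous_snd_comp (T U W : topologicalType) (f : T -> U * W) (w : T) :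
  {for w, continuous f} -> {for w, continuous (fun t => (f t).2)}.
Proof. by move=> cf; exact: cvg_comp cf cvg_snd. Qed.

Lemma continuous_near_eq (T U : topologicalType) (f h : T -> U) (w : T) :
  (\forall w' \near w, f w' = h w') -> {for w, continuous f} -> {for w, continuous h}.
Proof.
move=> fh cf; have e : f w = h w := nbhs_singleton fh.
suff : h x @[x --> w] --> h w by []; rewrite -e.
by apply: cvg_trans cf; exact: near_eq_cvg.
Qed.

Lemma near_fst (T T' : topologicalType) (P : set T) (q : T * T') :
  (\forall t \near q.1, P t) -> \forall p \near q, P p.1.
Proof.
move=> nP; have c1 : p.1 @[p --> q] --> q.1 by exact: cvg_fst.
exact: c1.
Qed.

Lemma continuous_comp_fst (T T' U : topologicalType) (f : T -> U) (w : T * T') :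
  {for w.1, continuous f} -> {for w, continuous (fun q : T * T' => f q.1)}.
Proof.
move=> cf; have c1 : q.1 @[q --> w] --> w.1 by exact: cvg_fst.
exact: cvg_comp c1 cf.
Qed.

Lemma continuous_comp_snd (T T' S : topologicalType) (f : T' -> S) (w : T * T') :
  {for w.2, continuous f} -> {for w, continuous (fun q : T * T' => f q.2)}.
Proof.
move=> cf; have c1 : q.2 @[q --> w] --> w.2 by exact: cvg_snd.
exact: cvg_comp c1 cf.
Qed.

Lemma open_setX (W1 W2 : topologicalType) (B1 : set W1) (B2 : set W2) :
  open B1 -> open B2 -> open (B1 `*` B2).
Proof.
move=> o1 o2; rewrite -[_ `*` _]/((fst @^-1` B1) `&` (snd @^-1` B2)).
by apply: openI; apply: open_comp => // w _; [exact: cvg_fst|exact: cvg_snd].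
Qed.

Lemma open_box (W1 W2 : normedModType R) (D : set (W1 * W2)) a b : open D -> D (a, b) ->
  exists2 r : R, 0 < r & closed_ball a r `*` closed_ball b r `<=` D.
Proof.
move=> oD Dab; have /open_nbhs_nbhs : open_nbhs (a, b) D by [].
move=> /nbhs_ballP[e /= e0 eD]; exists (e / 2); first by rewrite divr_gt0.
move=> [a' b'] [/=]; rewrite !closed_ballE ?divr_gt0// /closed_ball_ /= => aa' bb'.
apply: eD; split => /=; rewrite -ball_normE/=.
  by apply: le_lt_trans aa' _; rewrite ltr_pdivrMr// ltr_pMr// ltr1n.
by apply: le_lt_trans bb' _; rewrite ltr_pdivrMr// ltr_pMr// ltr1n.
Qed.

Lemma ball_left (t s e : R) : s <= t -> t - e < s -> ball t e s.
Proof. by move=> st te; rewrite /ball/= ger0_norm ?subr_ge0// ltrBlDr -ltrBlDl. Qed.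

Lemma ball_right (t d e : R) : 0 <= d -> d < e -> ball t e (t + d).
Proof. by move=> d0 de; rewrite /ball/= opprD addrA subrr add0r normrN ger0_norm. Qed.

Lemma continuous_lincomb (T : topologicalType) (W : normedModType R)
    (a b : T -> W) (k : T -> R) (t : T) :
  {for t, continuous a} -> {for t, continuous b} -> {for t, continuous k} ->
  {for t, continuous (fun q => a q + k q *: (b q - a q))}.
Proof.
move=> ca cb ck; apply: (@cvgD _ _ _ (nbhs t)); first exact: ca.
by apply: (@cvgZ _ _ _ (nbhs t)); [exact: ck|apply: (@cvgB _ _ _ (nbhs t))].
Qed.

Lemma convex_set_seg (W : lmodType R) (A : set W) a b (t : R) : convex_set (A : set (convex_lmodType W)) ->
  A a -> A b -> 0 <= t <= 1 -> A (a + t *: (b - a)).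
Proof.
move=> cA Aa Ab /andP[t0 t1].
have -> : a + t *: (b - a) = t *: b + (1 - t) *: a.
  by rewrite scalerBl scale1r scalerBr [RHS]addrCA.
by have := cA b a (Itv01 t0 t1); rewrite !inE => /(_ Ab Aa).
Qed.

End Topology.

(** * Matrices and quadratic forms *)

Section Matrices.
Context {R : realType}.

Lemma addmxE m p (A B : 'M[R]_(m, p)) i j : (A + B) i j = A i j + B i j.
Proof. by rewrite mxE. Qed.

Lemma scalemxE m p c (A : 'M[R]_(m, p)) i j : (c *: A) i j = c * A i j.
Proof. by rewrite mxE. Qed.

Lemma mulmxE m p q (A : 'M[R]_(m, p)) (B : 'M[R]_(p, q)) i j :
  (A *m B) i j = \sum_k A i k * B k j.
Proof. by rewrite mxE. Qed.

Lemma trmxE m p (A : 'M[R]_(m, p)) i j : A^T i j = A j i.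
Proof. by rewrite mxE. Qed.

Lemma submxE m q (A B : 'M[R]_(m, q)) i j : (A - B) i j = A i j - B i j.
Proof. by rewrite !mxE. Qed.

Lemma cvg_mx {T : Type} {F : set_system T} {FF : Filter F} m n (M : T -> 'M[R]_(m, n)) (L : 'M[R]_(m, n)) :
  (forall i j, M t i j @[t --> F] --> L i j) -> M t @[t --> F] --> L.
Proof.
move=> ML; apply/cvgrPdist_le => /= e e0; near=> t.
rewrite /Num.Def.normr/= mx_normrE (bigmax_le _ (ltW e0))//= => i _.
rewrite !mxE/=; move: i; near: t; apply: filter_forall => /= i.
exact: ((cvgrPdist_le _ _).1 (ML i.1 i.2)).
Unshelve. all: by end_near. Qed.

Lemma cvg_coord {T : Type} {F : set_system T} {FF : Filter F} m n (M : T -> 'M[R]_(m, n)) (L : 'M[R]_(m, n)) i j :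
  M t @[t --> F] --> L -> M t i j @[t --> F] --> L i j.
Proof. by move=> ML A LA; exact: ML _ (coord_continuous LA). Qed.

Lemma continuous_mx (T : topologicalType) m n (M : T -> 'M[R]_(m, n)) (w : T) :
  (forall i j, {for w, continuous (fun t => M t i j)}) -> {for w, continuous M}.
Proof. by move=> cM; apply: (@cvg_mx T (nbhs w)) => i j; exact: cM. Qed.

Lemma continuous_coord (T : topologicalType) m n (M : T -> 'M[R]_(m, n)) (w : T) i j :
  {for w, continuous M} -> {for w, continuous (fun t => M t i j)}.
Proof. by move=> cM; exact: (@cvg_coord T (nbhs w)). Qed.

Lemma mx_norm_coord m n (M : 'M[R]_(m, n)) i j : `|M i j| <= `|M|.
Proof.
rewrite [leRHS]/Num.Def.normr/= mx_normrE.
exact: (le_bigmax _ (fun ij : 'I_m * 'I_n => `|M ij.1 ij.2|) (i, j)).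
Qed.

Lemma cvg_bigsum {T : Type} {F : set_system T} {FF : Filter F} (I : Type) (r : seq I)
    (P : pred I) (f : I -> T -> R) (l : I -> R) :
  (forall i, f i t @[t --> F] --> l i) ->
  \sum_(i <- r | P i) f i t @[t --> F] --> \sum_(i <- r | P i) l i.
Proof.
move=> fl; elim: r => [|i r IH].
  by rewrite big_nil; under eq_fun do rewrite big_nil; exact: cvg_cst.
rewrite big_cons; under eq_fun do rewrite big_cons.
by case: (P i) => //; apply: cvgD.
Qed.

Lemma cvg_bigprod {T : Type} {F : set_system T} {FF : Filter F} (I : Type) (r : seq I)
    (P : pred I) (f : I -> T -> R) (l : I -> R) :
  (forall i, f i t @[t --> F] --> l i) ->
  \prod_(i <- r | P i) f i t @[t --> F] --> \prod_(i <- r | P i) l i.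
Proof.
move=> fl; elim: r => [|i r IH].
  by rewrite big_nil; under eq_fun do rewrite big_nil; exact: cvg_cst.
rewrite big_cons; under eq_fun do rewrite big_cons.
by case: (P i) => //; apply: cvgM.
Qed.

Lemma cvg_det {T : Type} {F : set_system T} {FF : Filter F} n (M : T -> 'M[R]_n) (L : 'M[R]_n) :
  M t @[t --> F] --> L -> \det (M t) @[t --> F] --> \det L.
Proof.
move=> ML; apply: cvg_bigsum => s; apply: cvgM; first exact: cvg_cst.
by apply: cvg_bigprod => i; exact: cvg_coord.
Qed.

(** Cramer's formula gives the limit; the determinant is eventually nonzero, so that the value of
    [invmx] on singular matrices does not matter. *)
Lemma cvg_invmx {T : Type} {F : set_system T} {FF : Filter F} n (M : T -> 'M[R]_n) (L : 'M[R]_n) :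
  \det L != 0 -> M t @[t --> F] --> L -> invmx (M t) @[t --> F] --> invmx L.
Proof.
move=> L0 ML; have dML := cvg_det (FF := FF) ML.
have -> : invmx L = (\det L)^-1 *: \adj L by rewrite /invmx unitmxE unitfE L0.
have adjM : (\det (M t))^-1 *: \adj (M t) @[t --> F] --> (\det L)^-1 *: \adj L.
  apply: cvgZ; first exact: cvgV L0 dML.
  apply: cvg_mx => i j; rewrite mxE; under eq_fun do rewrite mxE.
  apply: cvgM; first exact: cvg_cst.
  apply: cvg_det; apply: cvg_mx => k l; rewrite !mxE; under eq_fun do rewrite !mxE.
  exact: cvg_coord.
apply: cvg_trans adjM; apply: near_eq_cvg.
have : \forall t \near F, \det (M t) != 0.
  have := cvgr_neq0 _ dML L0; exact.
by apply: filterS => t Mt; rewrite /invmx unitmxE unitfE Mt.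
Qed.

Lemma cvg_mulmx {T : Type} {F : set_system T} {FF : Filter F} m n p
    (M : T -> 'M[R]_(m, n)) (N : T -> 'M[R]_(n, p)) (L : 'M[R]_(m, n)) (K : 'M[R]_(n, p)) :
  M t @[t --> F] --> L -> N t @[t --> F] --> K -> M t *m N t @[t --> F] --> L *m K.
Proof.
move=> ML NK; apply: cvg_mx => i j; rewrite mxE; under eq_fun do rewrite mxE.
by apply: cvg_bigsum => k; apply: cvgM; exact: cvg_coord.
Qed.

Lemma is_derive_row (V : normedModType R) n (f : 'I_n -> V -> R) (x v : V) df :
  (forall i, is_derive x v (f i) (df i)) ->
  is_derive x v (fun y => \row_i f i y) (\row_i df i).
Proof.
move=> dfi; apply/is_deriveP; apply: cvg_mx => i j; rewrite mxE.
under eq_fun do rewrite !mxE; exact/is_deriveP.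
Qed.

Lemma is_derive_coord (V : normedModType R) m n (f : V -> 'M[R]_(m, n)) (x v : V) df i j :
  is_derive x v f df -> is_derive x v (fun y => f y i j) (df i j).
Proof.
move=> /is_deriveP dfi; apply/is_deriveP.
rewrite (_ : (fun h => _) = fun h => (h^-1 *: (f (h *: v + x) - f x)) i j).
  exact: cvg_coord.
by apply/funext => h; rewrite !mxE.
Qed.

Lemma is_derive_pair (V W W' : normedModType R) (f : V -> W) (f' : V -> W') (x v : V) df df' :
  is_derive x v f df -> is_derive x v f' df' ->
  is_derive x v (fun y => (f y, f' y)) (df, df').
Proof.
move=> /is_deriveP d /is_deriveP d'; apply/is_deriveP; exact: cvg_pair d d'.
Qed.

Lemma compact_closed_ball_rV n (x : 'rV[R]_n) (r : R) : 0 < r -> compact (closed_ball x r).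
Proof.
move=> r0; apply: bounded_closed_compact; last exact: closed_ball_closed.
rewrite closed_ballE//; exists (`|x| + r); split; first exact: num_real.
move=> M /= xM y; rewrite /closed_ball_/= => xy.
rewrite -(subrK x y) addrC; apply: le_trans (ler_normD _ _) _.
by apply: le_trans (ltW xM); rewrite lerD2l distrC.
Qed.

Lemma mulmxr_continuous m n p (M : 'M[R]_(n, p)) :
  continuous (mulmxr M : 'M[R]_(m, n) -> 'M[R]_(m, p)).
Proof.
move=> x; apply: (@cvg_mulmx _ (nbhs x) _ _ _ _ id (fun=> M)).
  exact: cvg_id.
exact: cvg_cst.
Qed.

Lemma dot_sumE n (a b : 'rV[R]_n) : dot a b = \sum_i a 0 i * b 0 i.
Proof. by []. Qed.

Lemma dotC n (a b : 'rV[R]_n) : dot a b = dot b a.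
Proof. by apply: eq_bigr => i _; rewrite mulrC. Qed.

Lemma dotDl n (a b c : 'rV[R]_n) : dot (a + b) c = dot a c + dot b c.
Proof. by rewrite -big_split/=; apply: eq_bigr => i _; rewrite mxE mulrDl. Qed.

Lemma dotZl n k (a c : 'rV[R]_n) : dot (k *: a) c = k * dot a c.
Proof. by rewrite mulr_sumr; apply: eq_bigr => i _; rewrite mxE mulrA. Qed.

Lemma dotDr n (a b c : 'rV[R]_n) : dot c (a + b) = dot c a + dot c b.
Proof. by rewrite dotC dotDl !(dotC c). Qed.

Lemma dotZr n k (a c : 'rV[R]_n) : dot c (k *: a) = k * dot c a.
Proof. by rewrite dotC dotZl (dotC c). Qed.

Lemma dotNl n (a c : 'rV[R]_n) : dot (- a) c = - dot a c.
Proof. by rewrite -scaleN1r dotZl mulN1r. Qed.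

Lemma dot_mulmx n (a b : 'rV[R]_n) (M : 'M[R]_n) : dot (a *m M) b = dot a (b *m M^T).
Proof.
rewrite /dot; under eq_bigr => i _ do rewrite mxE mulr_suml.
rewrite exchange_big/=; apply: eq_bigr => i _; rewrite mxE mulr_sumr.
by apply: eq_bigr => j _; rewrite mxE; ring.
Qed.

Lemma cvg_dot {T : Type} {F : set_system T} {FF : Filter F} n (a b : T -> 'rV[R]_n) (k l : 'rV[R]_n) :
  a t @[t --> F] --> k -> b t @[t --> F] --> l -> dot (a t) (b t) @[t --> F] --> dot k l.
Proof.
by move=> ak bl; apply: cvg_bigsum => i; apply: cvgM; exact: cvg_coord.
Qed.

End Matrices.

Section QuadraticForm.
Context {R : realType} {n : nat}.
Local Notation V := 'rV[R]_n.

Definition bil (M : 'M[R]_n) (a b : V) : R := dot (a *m M) b.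

Lemma bilE M a b : bil M a b = \sum_j \sum_i a 0 i * M i j * b 0 j.
Proof. by apply: eq_bigr => j _; rewrite mxE mulr_suml. Qed.

Lemma bilDl M a a' b : bil M (a + a') b = bil M a b + bil M a' b.
Proof. by rewrite /bil mulmxDl dotDl. Qed.

Lemma bilDr M a b b' : bil M a (b + b') = bil M a b + bil M a b'.
Proof. by rewrite /bil dotDr. Qed.

Lemma bilZl M k a b : bil M (k *: a) b = k * bil M a b.
Proof. by rewrite /bil -scalemxAl dotZl. Qed.

Lemma bilZr M k a b : bil M a (k *: b) = k * bil M a b.
Proof. by rewrite /bil dotZr. Qed.

Lemma bilD M N a b : bil (M + N) a b = bil M a b + bil N a b.
Proof. by rewrite /bil mulmxDr dotDl. Qed.

Lemma bilN M a b : bil (- M) a b = - bil M a b.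
Proof. by rewrite /bil mulmxN dotNl. Qed.

Lemma bil_bound (M : 'M[R]_n) (a b : V) (m : R) : (forall i j, `|M i j| <= m) ->
  `|bil M a b| <= n%:R ^+ 2 * m * `|a| * `|b|.
Proof.
move=> Mm; rewrite bilE; apply: le_trans (ler_norm_sum _ _ _) _.
apply: (@le_trans _ _ (\sum_(j < n) \sum_(i < n) m * `|a| * `|b|)).
  apply: ler_sum => j _; apply: le_trans (ler_norm_sum _ _ _) _; apply: ler_sum => i _.
  rewrite !normrM (mulrC `|a 0 i|); apply: ler_pM => //; last exact: mx_norm_coord.
  by apply: ler_pM => //; exact: mx_norm_coord.
by rewrite !sumr_const card_ord -mulrnA -[leLHS]mulr_natl natrM expr2 !mulrA.
Qed.

Lemma is_derive_bil (W : normedModType R) (M : W -> 'M[R]_n) dM (x v : W) (a b : V) :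
  is_derive x v M dM -> is_derive x v (fun y => bil (M y) a b) (bil dM a b).
Proof.
move=> dM'; rewrite (_ : (fun y => _) = fun y => \sum_j \sum_i (a 0 i * b 0 j) * M y i j).
  rewrite (_ : bil dM a b = \sum_j \sum_i (a 0 i * b 0 j) * dM i j).
    apply: is_derive_bigsum => j; apply: is_derive_bigsum => i.
    by apply: is_derive_cmul; exact: is_derive_coord.
  by rewrite bilE; apply: eq_bigr => j _; apply: eq_bigr => i _; ring.
by apply/funext => y; rewrite bilE; apply: eq_bigr => j _; apply: eq_bigr => i _; ring.
Qed.

(** The norm of a row vector is its largest entry in modulus, so one square of the sum already
    suffices. *)
Lemma dot_sqr_ge (a : V) : `|a| ^+ 2 <= dot a a.
Proof.
have [->|a0] := eqVneq a 0.
  by rewrite normr0 expr0n /= dot_sumE big1// => i _; rewrite mxE mul0r.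
have : mx_norm a != 0 by apply: contra a0 => /eqP/mx_norm_eq0 ->.
move=> /mx_norm_neq0[[i j] /= e]; rewrite [X in X ^+ 2]/Num.Def.normr /= e ord1.
rewrite real_normK ?num_real// dot_sumE (bigD1 j)//= expr2 lerDl sumr_ge0// => k _.
by rewrite -expr2 sqr_ge0.
Qed.

Lemma dot_bound (a b : V) : `|dot a b| <= n%:R * `|a| * `|b|.
Proof.
apply: le_trans (ler_norm_sum _ _ _) _.
apply: (@le_trans _ _ (\sum_(j < n) `|a| * `|b|)).
  by apply: ler_sum => j _; rewrite normrM; apply: ler_pM => //; exact: mx_norm_coord.
by rewrite sumr_const card_ord -[leLHS]mulr_natl mulrA.
Qed.

(* Splitting [xi] along [eta] transfers a bound on [eta]'s orthogonal
   complement to all [xi], at the price of a multiple of [xi . eta]. *)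
Lemma bil_ortho_ge (D : 'M[R]_n) (k : R) (xi eta : V) : 0 <= k ->
  (forall i j, `|D i j| <= k * `|eta|) ->
  (forall zeta : V, dot zeta eta = 0 -> 0 <= bil D zeta zeta) ->
  - ((2 * n%:R ^+ 2 + n%:R ^+ 3) * k * `|xi| * `|dot xi eta|) <= bil D xi xi.
Proof.
move=> k0 Dk Dpos; have [eta0|eta0] := eqVneq eta 0.
  apply: le_trans (Dpos xi _); last first.
    by rewrite eta0 dot_sumE big1// => i _; rewrite mxE mulr0.
  by rewrite oppr_le0 !mulr_ge0// addr_ge0 ?mulr_ge0 ?exprn_ge0.
have e2 := dot_sqr_ge eta.
have ne : 0 < `|eta| by rewrite normr_gt0.
have ee : 0 < dot eta eta by apply: lt_le_trans e2; rewrite exprn_gt0.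
set c := dot xi eta / dot eta eta.
pose zeta := xi - c *: eta.
have zo : dot zeta eta = 0.
  by rewrite /zeta dotDl dotNl dotZl /c divfK ?gt_eqF// subrr.
have xiE : xi = zeta + c *: eta by rewrite subrK.
have split_ : bil D xi xi = bil D zeta zeta + c * (bil D eta xi + bil D xi eta - c * bil D eta eta).
  by rewrite {1 2 3 4}xiE !(bilDl, bilDr, bilZl, bilZr); ring.
have cb : `|c| * `|eta| ^+ 2 <= `|dot xi eta|.
  rewrite /c normrM normfV (gtr0_norm ee) mulrAC ler_pdivrMr//.
  by rewrite ler_wpM2l.
have db := dot_bound xi eta.
have b1 := bil_bound eta xi Dk; have b2 := bil_bound xi eta Dk; have b3 := bil_bound eta eta Dk.
have z0 := Dpos zeta zo.
set S := `|dot xi eta| in cb db *.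
set N := n%:R : R in b1 b2 b3 db *.
have N0 : 0 <= N by [].
have cn : `|c| * `|eta| <= N * `|xi|.
  rewrite -(ler_pM2r ne) -mulrA -expr2; apply: le_trans cb _.
  by rewrite -/S.
clearbody c S.
have t1 : `|c * bil D eta xi| <= N ^+ 2 * k * `|xi| * S.
  rewrite normrM; apply: (@le_trans _ _ (`|c| * (N ^+ 2 * (k * `|eta|) * `|eta| * `|xi|))).
    by rewrite ler_wpM2l.
  rewrite [leLHS](_ : _ = N ^+ 2 * k * `|xi| * (`|c| * `|eta| ^+ 2)); last by ring.
  by rewrite ler_wpM2l// !mulr_ge0// exprn_ge0.
have t2 : `|c * bil D xi eta| <= N ^+ 2 * k * `|xi| * S.
  rewrite normrM; apply: (@le_trans _ _ (`|c| * (N ^+ 2 * (k * `|eta|) * `|xi| * `|eta|))).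
    by rewrite ler_wpM2l.
  rewrite [leLHS](_ : _ = N ^+ 2 * k * `|xi| * (`|c| * `|eta| ^+ 2)); last by ring.
  by rewrite ler_wpM2l// !mulr_ge0// exprn_ge0.
(* In the term quadratic in [c], one factor [|c| |eta|] is paid with [N |xi|], whence the power 3;
   the other is estimated as in the two mixed terms. *)
have t3 : `|c * (c * bil D eta eta)| <= N ^+ 3 * k * `|xi| * S.
  rewrite !normrM; apply: (@le_trans _ _ (`|c| * (`|c| * (N ^+ 2 * (k * `|eta|) * `|eta| * `|eta|)))).
    by do 2 (apply: ler_wpM2l => //).
  rewrite [leLHS](_ : _ = N ^+ 2 * k * ((`|c| * `|eta|) * (`|c| * `|eta| ^+ 2))); last by ring.
  rewrite [leRHS](_ : _ = N ^+ 2 * k * (N * `|xi| * S)); last by ring.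
  rewrite ler_wpM2l ?mulr_ge0 ?exprn_ge0//.
  by apply: ler_pM => //; rewrite !mulr_ge0.
rewrite split_ mulrBr mulrDr.
move: t1 t2 t3; rewrite !ler_norml => /andP[t1 _] /andP[t2 _] /andP[_ t3].
rewrite (_ : (2 * N ^+ 2 + N ^+ 3) * k * `|xi| * S =
  N ^+ 2 * k * `|xi| * S + N ^+ 2 * k * `|xi| * S + N ^+ 3 * k * `|xi| * S); last by ring.
by lra.
Qed.

End QuadraticForm.

(** * Generating functions and the matrix A *)

Section Partials.
Context {R : realType} {n : nat}.
Local Notation V := 'rV[R]_n.
Variables (G : set (V * V * R)) (g : V -> V -> R -> R).

Lemma triple_eq (w w' : V * V * R) :
  w.1.1 = w'.1.1 -> w.1.2 = w'.1.2 -> w.2 = w'.2 -> w = w'.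
Proof. by case: w w' => [[x y] z] [[x' y'] z'] /= -> -> ->. Qed.

(** With [g] on the product space, all its partial derivatives are directional derivatives of a
    single C2 function along [dx] and [dyz]. *)
Definition gfun (w : V * V * R) : R := g w.1.1 w.1.2 w.2.
Definition dx (xi : V) : V * V * R := (xi, 0, 0).
Definition dyz (b : V) (c : R) : V * V * R := (0, b, c).

Lemma derive_x (W : normedModType R) (F : V * V * R -> W) x y z xi :
  'D_xi (fun x' => F (x', y, z)) x = 'D_(dx xi) F (x, y, z).
Proof.
apply: (@derive_affine _ _ _ _ F (fun x' => (x', y, z))) => h.
by apply: triple_eq => //=;
  rewrite scaler0 add0r.
Qed.

Lemma derive_y (W : normedModType R) (F : V * V * R -> W) x y z b :
  'D_b (fun y' => F (x, y', z)) y = 'D_(dyz b 0) F (x, y, z).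
Proof.
apply: (@derive_affine _ _ _ _ F (fun y' => (x, y', z))) => h.
by apply: triple_eq => //=;
  rewrite scaler0 add0r.
Qed.

Lemma derive_z (W : normedModType R) (F : V * V * R -> W) x y z :
  derive1 (fun z' => F (x, y, z')) z = 'D_(dyz 0 1) F (x, y, z).
Proof.
rewrite derive1E; apply: (@derive_affine _ _ _ _ F (fun z' => (x, y, z'))) => h.
by apply: triple_eq => //=;
  rewrite scaler0 add0r.
Qed.

Lemma g_x_coord x y z i : g_x g x y z 0 i = 'D_(dx (delta_mx 0 i)) gfun (x, y, z).
Proof. by rewrite mxE; exact: (derive_x gfun). Qed.

Lemma g_y_coord x y z i : g_y g x y z 0 i = 'D_(dyz (delta_mx 0 i) 0) gfun (x, y, z).
Proof. by rewrite mxE; exact: (derive_y gfun). Qed.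

Lemma g_z_coord x y z : g_z g x y z = 'D_(dyz 0 1) gfun (x, y, z).
Proof. exact: (derive_z gfun). Qed.

Lemma g_xx_coord x y z i j : g_xx g x y z i j =
  'D_(dx (delta_mx 0 j)) ('D_(dx (delta_mx 0 i)) gfun) (x, y, z).
Proof.
have E : 'D_(delta_mx 0 i) (fun x' => g x' y z) =
    fun x' => 'D_(dx (delta_mx 0 i)) gfun (x', y, z).
  by apply/funext => x'; exact: (derive_x gfun).
by rewrite mxE E; exact: (derive_x ('D_(dx (delta_mx 0 i)) gfun)).
Qed.

Lemma g_xy_coord x y z i j : g_xy g x y z i j =
  'D_(dyz (delta_mx 0 j) 0) ('D_(dx (delta_mx 0 i)) gfun) (x, y, z).
Proof.
have E : (fun y' => g_x g x y' z 0 i) =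
    fun y' => 'D_(dx (delta_mx 0 i)) gfun (x, y', z).
  by apply/funext => y'; exact: g_x_coord.
by rewrite mxE E; exact: (derive_y ('D_(dx (delta_mx 0 i)) gfun)).
Qed.

Lemma g_xz_coord x y z i : g_xz g x y z 0 i =
  'D_(dyz 0 1) ('D_(dx (delta_mx 0 i)) gfun) (x, y, z).
Proof.
have E : (fun z' => g_x g x y z' 0 i) =
    fun z' => 'D_(dx (delta_mx 0 i)) gfun (x, y, z').
  by apply/funext => z'; exact: g_x_coord.
by rewrite mxE E; exact: (derive_z ('D_(dx (delta_mx 0 i)) gfun)).
Qed.

Lemma rV_sum_delta (a : V) : a = \sum_i a 0 i *: delta_mx 0 i.
Proof. exact: row_sum_delta. Qed.

Lemma dx_sum xi : dx xi = \sum_i xi 0 i *: dx (delta_mx 0 i).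
Proof.
rewrite {1}[xi]rV_sum_delta.
elim/big_rec2 : _ => [|i w v _ <-]; first by [].
apply: triple_eq => //=;
  by rewrite scaler0 add0r.
Qed.

Lemma dyz_sum b c :
  dyz b c = \sum_i b 0 i *: dyz (delta_mx 0 i) 0 + c *: dyz 0 1.
Proof.
have -> : dyz b c = dyz b 0 + c *: dyz 0 1.
  apply: triple_eq => /=.
  - by rewrite scaler0 addr0.
  - by rewrite scaler0 addr0.
  - by rewrite add0r [_ *: _]mulr1.
congr (_ + _); rewrite {1}[b]rV_sum_delta.
elim/big_rec2 : _ => [|i w v _ <-]; first by [].
apply: triple_eq => //=;
  by rewrite scaler0 add0r.
Qed.

Lemma derive_dx_sum (F : V * V * R -> R) w xi : differentiable F w ->
  'D_(dx xi) F w = \sum_i xi 0 i * 'D_(dx (delta_mx 0 i)) F w.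
Proof.
move=> dF; rewrite dx_sum derive_dir_sum//; apply: eq_bigr => i _.
by rewrite derive_dirZ.
Qed.

Lemma derive_dyz_sum (F : V * V * R -> R) w b c : differentiable F w ->
  'D_(dyz b c) F w = \sum_i b 0 i * 'D_(dyz (delta_mx 0 i) 0) F w + c * 'D_(dyz 0 1) F w.
Proof.
move=> dF; rewrite dyz_sum derive_dirD// derive_dir_sum// derive_dirZ//; congr (_ + _).
by apply: eq_bigr => i _; rewrite derive_dirZ.
Qed.

Hypothesis g_gen : generating_function G g.

Lemma G_open : open G. Proof. by case: g_gen => -[]. Qed.

Lemma gfun_C2 : C2_on G gfun. Proof. by case: g_gen. Qed.

Lemma gfun_diff w : G w -> differentiable gfun w.
Proof. by case: gfun_C2 => C1 _ /C1[]. Qed.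

Lemma Dgfun_diff v w : G w -> differentiable ('D_v gfun) w.
Proof. by case: gfun_C2 => _ /(_ v) C1 /C1[]. Qed.

Lemma D2gfun_cont v v' w : G w -> {for w, continuous ('D_v' ('D_v gfun))}.
Proof. by case: gfun_C2 => _ /(_ v) C1 /C1[_ ]. Qed.

Lemma gfun_sym v v' w : G w -> 'D_v ('D_v' gfun) w = 'D_v' ('D_v gfun) w.
Proof. exact: C2_symmetric G_open gfun_C2. Qed.

Section AtPoint.
Variables (x y : V) (z : R).
Hypothesis Gw : G (x, y, z).

Lemma g_z_lt0 : g_z g x y z < 0.
Proof. by case: g_gen => _ _ _; exact. Qed.

Lemma g_z_neq0 : g_z g x y z != 0.
Proof. by rewrite lt_eqF// g_z_lt0. Qed.

Lemma Dx_gfun xi : 'D_(dx xi) gfun (x, y, z) = dot (g_x g x y z) xi.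
Proof.
rewrite derive_dx_sum; last exact: gfun_diff.
by apply: eq_bigr => i _; rewrite g_x_coord mulrC.
Qed.

Lemma Dyz_gfun b c : 'D_(dyz b c) gfun (x, y, z) = dot (g_y g x y z) b + c * g_z g x y z.
Proof.
rewrite derive_dyz_sum; last exact: gfun_diff.
rewrite g_z_coord; congr (_ + _).
by apply: eq_bigr => i _; rewrite g_y_coord mulrC.
Qed.

Lemma Dx_Dx_gfun xi i :
  'D_(dx xi) ('D_(dx (delta_mx 0 i)) gfun) (x, y, z) = (xi *m (g_xx g x y z)^T) 0 i.
Proof.
rewrite derive_dx_sum; last exact: Dgfun_diff.
by rewrite mulmxE; apply: eq_bigr => j _; rewrite trmxE g_xx_coord.
Qed.

Lemma Dyz_Dx_gfun b c i : 'D_(dyz b c) ('D_(dx (delta_mx 0 i)) gfun) (x, y, z) =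
  (b *m (g_xy g x y z)^T + c *: g_xz g x y z) 0 i.
Proof.
rewrite derive_dyz_sum; last exact: Dgfun_diff.
rewrite addmxE scalemxE g_xz_coord mulmxE; congr (_ + _).
by apply: eq_bigr => j _; rewrite trmxE g_xy_coord.
Qed.

Lemma Dx_Dy_gfun xi j : 'D_(dx xi) ('D_(dyz (delta_mx 0 j) 0) gfun) (x, y, z) =
  (xi *m g_xy g x y z) 0 j.
Proof.
rewrite derive_dx_sum; last exact: Dgfun_diff.
by rewrite mulmxE; apply: eq_bigr => i _; rewrite gfun_sym// g_xy_coord.
Qed.

Lemma Dx_Dz_gfun xi : 'D_(dx xi) ('D_(dyz 0 1) gfun) (x, y, z) =
  dot xi (g_xz g x y z).
Proof.
rewrite derive_dx_sum; last exact: Dgfun_diff.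
by apply: eq_bigr => i _; rewrite gfun_sym// g_xz_coord.
Qed.

(** [E] is the y-derivative of [g_x] along a level of [g]: when [y] moves by [b], moving [z] by
    [Q . b] keeps [g] fixed, because [g_y = - g_z Q]. *)
Lemma mulmx_E_trmx b : b *m (E_mx g x y z)^T =
  b *m (g_xy g x y z)^T + dot (Q g x y z) b *: g_xz g x y z.
Proof.
apply/rowP => i; rewrite addmxE scalemxE !mulmxE.
under eq_bigr => j _.
  rewrite trmxE /E_mx addmxE -scaleNr scalemxE mulmxE big_ord1 trmxE mulrDr; over.
rewrite big_split /=; congr (_ + _).
  by apply: eq_bigr => j _; rewrite trmxE.
rewrite dot_sumE mulr_suml; apply: eq_bigr => j _.
by rewrite /Q -scaleNr scalemxE; ring.
Qed.

End AtPoint.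
End Partials.

Section MatrixFunction.
Context {R : realType} {n : nat}.
Local Notation V := 'rV[R]_n.
Variables (G : set (V * V * R)) (g : V -> V -> R -> R).

Definition gxf (w : V * V * R) : V := \row_i 'D_(dx (delta_mx 0 i)) (gfun g) w.

Lemma gxfE x y z : gxf (x, y, z) = g_x g x y z.
Proof. by apply/rowP => i; rewrite g_x_coord mxE. Qed.

Definition Afun (w : V * R * V) : 'M[R]_n := A_mx G g w.1.1 w.1.2 w.2.
Definition dp (eta : V) : V * R * V := (0, 0, eta).

Hypotheses (g_gen : generating_function G g) (g_A1 : A1 G g) (g_A2 : A2 G g).

Lemma gxf_cont w : G w -> {for w, continuous gxf}.
Proof.
move=> Gw; apply: continuous_mx => i j.
rewrite (_ : (fun _ => _) = 'D_(dx (delta_mx 0 j)) (gfun g)).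
  exact: differentiable_continuous (Dgfun_diff g_gen _ Gw).
by apply/funext => t; rewrite mxE.
Qed.

Lemma gfun_cont w : G w -> {for w, continuous (gfun g)}.
Proof. by move=> Gw; exact: differentiable_continuous (gfun_diff g_gen Gw). Qed.

Lemma A1_inj x yz yz' : G (x, yz.1, yz.2) -> G (x, yz'.1, yz'.2) ->
  g_x g x yz.1 yz.2 = g_x g x yz'.1 yz'.2 -> g x yz.1 yz.2 = g x yz'.1 yz'.2 -> yz = yz'.
Proof.
by move=> Gw Gw' ex eu; apply: (g_A1 (x := x)); rewrite ?inE//= ex eu.
Qed.

Lemma YZ_gx x y z : G (x, y, z) -> YZ G g x (g x y z) (g_x g x y z) = (y, z).
Proof.
move=> Gw; rewrite /YZ; case: xgetP => [yz _ [/= Gw' ex eu]|].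
  exact: (@A1_inj x yz (y, z)).
by move/(_ (y, z)) => H; exfalso; apply: H.
Qed.

Lemma Afun_gx x y z : G (x, y, z) -> Afun (x, g x y z, g_x g x y z) = g_xx g x y z.
Proof. by move=> Gw; rewrite /Afun /A_mx /Y /Z /= YZ_gx. Qed.

Lemma U_gx x y z : G (x, y, z) -> U_set G g (x, g x y z, g_x g x y z).
Proof. by move=> Gw; exists y, z. Qed.

Lemma E_onto x y z (e : V) : G (x, y, z) -> exists b : V, b *m (E_mx g x y z)^T = e.
Proof.
move=> Gw; exists (e *m invmx (E_mx g x y z)^T); rewrite -mulmxA mulVmx ?mulmx1//.
by rewrite unitmxE det_tr unitfE g_A2.
Qed.

Lemma assocl_continuous (q0 : V * (V * R)) :
  {for q0, continuous (fun q : V * (V * R) => (q.1, q.2.1, q.2.2))}.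
Proof.
apply: continuous_pair; last by apply: continuous_snd_comp; exact: cvg_snd.
by apply: continuous_pair; [exact: cvg_fst|apply: continuous_fst_comp; exact: cvg_snd].
Qed.

Lemma is_derive_gx_g x y z b c : G (x, y, z) ->
  is_derive (y, z) (b, c) (fun yz => (g_x g x yz.1 yz.2, g x yz.1 yz.2))
    (b *m (g_xy g x y z)^T + c *: g_xz g x y z, dot (g_y g x y z) b + c * g_z g x y z).
Proof.
move=> Gw.
have slice (F : V * V * R -> R) : differentiable F (x, y, z) ->
    is_derive (y, z) (b, c) (fun yz => F (x, yz.1, yz.2)) ('D_(dyz b c) F (x, y, z)).
  move=> dF; have /is_deriveP := derivableP (@diff_derivable _ _ _ _ _ (dyz b c) dF).
  rewrite /= => dF'; apply/is_deriveP.
  rewrite (_ : (fun h => _) = (fun h => h^-1 *: (F (h *: dyz b c + (x, y, z)) - F (x, y, z)))) //.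
  apply/funext => h; congr (_ *: (F _ - _)); apply: triple_eq => //=.
  by rewrite scaler0 add0r.
apply: is_derive_pair.
  rewrite (_ : (fun _ => _) = fun yz => \row_i 'D_(dx (delta_mx 0 i)) (gfun g) (x, yz.1, yz.2)); last first.
    by apply/funext => yz; rewrite -gxfE.
  rewrite (_ : _ + _ = \row_i 'D_(dyz b c) ('D_(dx (delta_mx 0 i)) (gfun g)) (x, y, z)); last first.
    by apply/rowP => i; rewrite [RHS]mxE (Dyz_Dx_gfun g_gen).
  apply: is_derive_row => i; exact: (slice ('D_(dx (delta_mx 0 i)) (gfun g)) (Dgfun_diff g_gen _ Gw)).
rewrite -(Dyz_gfun g_gen Gw); exact: (slice (gfun g) (gfun_diff g_gen Gw)).
Qed.

(** A1 and A2 make [local_surj] applicable to [(y, z) -> (g_x, g)] with parameter [x]. Openness is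
    what allows statements about [A] at single points of [U_set] to be used in neighbourhoods. *)
Lemma U_open : open (U_set G g).
Proof.
rewrite openE => -[[x u] p] [y [z [/= Gw -> ->]]].
have oG : open [set w : V * (V * R) | G (w.1, w.2.1, w.2.2)].
  apply: open_comp (G_open g_gen) => w _.
  by exact: assocl_continuous.
have [r r0 rG] := open_box (a := x) (b := (y, z)) oG Gw.
pose f x' (yz : V * R) := (g_x g x' yz.1 yz.2, g x' yz.1 yz.2).
pose K := closed_ball y r `*` closed_ball z r.
pose B := ball y r `*` ball z r.
have BK : B `<=` K by move=> -[y' z'] [/= ? ?]; split; exact: subset_closed_ball.
have KG (x' : V) (yz : V * R) : closed_ball x r x' -> K yz -> G (x', yz.1, yz.2).
  move=> xx' [/= Ky Kz]; apply: (rG (x', yz)); split => //=.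
  rewrite closed_ballE// /closed_ball_ /= in Ky *; rewrite closed_ballE// /closed_ball_ /= in Kz.
  by rewrite closed_ballE// /closed_ball_ /= prod_normE /= ge_max Ky Kz.
have xx : closed_ball x r x by exact: closed_ballxx.
have nx : \forall x' \near x, closed_ball x r x'.
  by apply: filterS (nbhsx_ballx x r r0) => x'; exact: subset_closed_ball.
have fcont (x' : V) (yz : V * R) : closed_ball x r x' -> K yz ->
    {for (x', yz), continuous (fun q => f q.1 q.2)}.
  move=> xx' Kyz; have Gw' := KG x' yz xx' Kyz.
  have tr := @assocl_continuous (x', yz).
  apply: continuous_pair.
    have := @continuous_comp _ _ _ _ gxf (x', yz) tr (gxf_cont Gw').
    by rewrite /= (_ : gxf \o _ = fun q => g_x g q.1 q.2.1 q.2.2)//; apply/funext => q /=; rewrite gxfE.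
  exact: (@continuous_comp _ _ _ _ (gfun g) (x', yz) tr (gfun_cont Gw')).
have := @local_surj R V (V * R)%type (V * R)%type f x (y, z) K B.
have H1 : compact K.
  by apply: compact_setX; [exact: compact_closed_ball_rV|exact: closed_ballR_compact].
have H2 : open B.
  by apply: open_setX; exact: ball_open.
have H3 : B (y, z) by split; exact: ballxx.
have H4 yz : K yz -> f x yz = f x (y, z) -> yz = (y, z).
  move=> Kyz [ex eu]; by apply: (@A1_inj x yz (y, z)) => //; exact: KG.
move=> /(_ H1 H2 BK H3 (fun yz => fcont x yz xx) H4).
have H5 : \forall p \near x, forall w, K w -> {for w, continuous (f p)}.
  apply: filterS nx => x' xx' w Kw.
  have pw : {for w, continuous (fun w' : V * R => (x', w'))}.
    by apply: continuous_pair; [exact: cvg_cst|exact: cvg_id].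
  exact: (@continuous_comp _ _ _ _ (fun q => f q.1 q.2) w pw (fcont x' w xx' Kw)).
have H6 : \forall p \near x, forall w, B w -> forall e, exists v, is_derive w v (f p) e.
  apply: filterS nx => x' xx' [y' z'] Bw [e1 e2].
  have Gw' := KG x' (y', z') xx' (BK _ Bw); rewrite /= in Gw'.
  have gz0 := g_z_neq0 g_gen Gw'.
  have [b bE] := E_onto (e1 - (e2 / g_z g x' y' z') *: g_xz g x' y' z') Gw'.
  (* In the z-component, [e2 / g_z] produces [e2], and [Q . b] cancels the change of [g] caused by
     [b]. What is left for [b] is a linear system with matrix [E]. *)
  exists (b, e2 / g_z g x' y' z' + dot (Q g x' y' z') b).
  have := is_derive_gx_g b (e2 / g_z g x' y' z' + dot (Q g x' y' z') b) Gw'.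
  rewrite scalerDl (addrCA (b *m _)) -mulmx_E_trmx// bE addrCA subrr addr0.
  rewrite mulrDl divfK// (_ : dot _ b + _ = e2)//.
  rewrite addrCA -[RHS]addr0; congr (_ + _).
  rewrite /Q dotNl dotZl; field; exact: gz0.
move=> /(_ H5 H6) H.
have tr : {for (x, g x y z, g_x g x y z), continuous (fun w : V * R * V => (w.1.1, (w.2, w.1.2)))}.
  apply: continuous_pair; first by apply: continuous_fst_comp; exact: cvg_fst.
  apply: continuous_pair; first exact: cvg_snd.
  by apply: continuous_snd_comp; exact: cvg_fst.
have nx' : \forall q \near (x, f x (y, z)), closed_ball x r q.1.
  exact: (@near_fst _ _ _ (x, f x (y, z)) nx).
have {}H : \forall q \near (x, f x (y, z)), (exists2 w, B w & f q.1 w = q.2) /\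
    closed_ball x r q.1 by exact: filterI.
have {}H : \forall w \near (x, g x y z, g_x g x y z),
    (exists2 yz, B yz & f w.1.1 yz = (w.2, w.1.2)) /\ closed_ball x r w.1.1.
  exact: tr _ H.
suff : \forall w \near (x, g x y z, g_x g x y z), U_set G g w by [].
apply: filterS H => -[[x' u'] p'] /= [[yz Byz fyz] xx'].
exists yz.1, yz.2; split => //=; first exact: (KG x' yz xx' (BK _ Byz)).
  by case: fyz.
by case: fyz.
Qed.

End MatrixFunction.

(** * A3w as a one-sided Taylor estimate in p *)

Section A3wConvexity.
Context {R : realType} {n : nat}.
Local Notation V := 'rV[R]_n.
Variables (G : set (V * V * R)) (g : V -> V -> R -> R).
Hypotheses (g_gen : generating_function G g) (g_A1 : A1 G g) (g_A2 : A2 G g).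
Hypothesis A_diff2 : A_twice_differentiable G g.
Local Notation Af := (Afun G g).
Local Notation U := (U_set G g).

Lemma Afun_diff w : U w -> differentiable Af w.
Proof. by move=> /A_diff2[]. Qed.

Lemma DAfun_diff v w : U w -> differentiable ('D_v Af) w.
Proof. by move=> /A_diff2[]. Qed.

Lemma triple_eq_p (w w' : V * R * V) :
  w.1.1 = w'.1.1 -> w.1.2 = w'.1.2 -> w.2 = w'.2 -> w = w'.
Proof. by case: w w' => [[x y] z] [[x' y'] z'] /= -> -> ->. Qed.

Lemma dp_line x u p (eta : V) (t : R) :
  ((x, u, p) : V * R * V) + t *: dp eta = (x, u, p + t *: eta).
Proof. by apply: triple_eq_p => //=; rewrite scaler0 addr0. Qed.

Lemma dp_sum (eta : V) : dp eta = \sum_i eta 0 i *: dp (delta_mx 0 i).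
Proof.
rewrite {1}[eta]rV_sum_delta.
elim/big_rec2 : _ => [|i w v _ <-]; first by [].
by apply: triple_eq_p => //=; rewrite scaler0 add0r.
Qed.

Lemma derive_dp_sum (W : normedModType R) (F : V * R * V -> W) w (eta : V) : differentiable F w ->
  'D_(dp eta) F w = \sum_i eta 0 i *: 'D_(dp (delta_mx 0 i)) F w.
Proof.
move=> dF; rewrite dp_sum derive_dir_sum//; apply: eq_bigr => i _.
by rewrite derive_dirZ.
Qed.

Lemma derive_p (F : V * R * V -> 'M[R]_n) x u p (eta : V) i j : differentiable F (x, u, p) ->
  'D_eta (fun q => F (x, u, q) i j) p = ('D_(dp eta) F (x, u, p)) i j.
Proof.
move=> dF; have := is_derive_coord i j (derivableP (@diff_derivable _ _ _ _ _ (dp eta) dF)).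
move=> /@derive_val <-; apply: (@derive_affine _ _ _ _ (fun w => F w i j) (fun q => (x, u, q))) => h.
by apply: triple_eq_p => //=; rewrite scaler0 add0r.
Qed.

(** The inner derivative of an entry agrees with the entry of the matrix derivative only on [U_set];
    openness makes this enough for differentiating once more. *)
Lemma D_pp_AE k l i j x u p : U (x, u, p) -> D_pp_A G g k l i j x u p =
  ('D_(dp (delta_mx 0 k)) ('D_(dp (delta_mx 0 l)) Af) (x, u, p)) i j.
Proof.
move=> Uw; rewrite -derive_p; last exact: DAfun_diff.
apply: near_eq_derive.
have cq : {for p, continuous (fun q : V => (x, u, q))}.
  by apply: (@continuous_pair _ _ _ (fun=> (x, u)) id p); [exact: cst_continuous|exact: cvg_id].
have nU : \forall w \near (x, u, p), U w.
  by apply: open_nbhs_nbhs; split => //; exact: U_open.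
have {}nU : \forall q \near p, U (x, u, q) by exact: cq _ nU.
by apply: filterS nU => q Uq; rewrite -derive_p//; exact: Afun_diff.
Qed.

Hypothesis g_A3w : A3w G g.

Lemma DDAfun_dp w (eta : V) : U w -> 'D_(dp eta) ('D_(dp eta) Af) w =
  \sum_l eta 0 l *: \sum_k eta 0 k *: 'D_(dp (delta_mx 0 k)) ('D_(dp (delta_mx 0 l)) Af) w.
Proof.
move=> Uw.
rewrite -[LHS](@near_eq_derive _ _ _ (fun w => \sum_l eta 0 l *: 'D_(dp (delta_mx 0 l)) Af w)).
  apply: derive_val; apply: is_derive_bigsum => l.
  rewrite -derive_dp_sum; last exact: DAfun_diff.
  apply: is_deriveZ; apply: derivableP; apply: diff_derivable; exact: DAfun_diff.
have nU : \forall w' \near w, U w'.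
  by apply: open_nbhs_nbhs; split => //; exact: U_open.
by apply: filterS nU => w' Uw'; rewrite -derive_dp_sum//; exact: Afun_diff.
Qed.

Lemma A3w_bil x u p (zeta eta : V) : U (x, u, p) -> dot zeta eta = 0 ->
  0 <= bil ('D_(dp eta) ('D_(dp eta) Af) (x, u, p)) zeta zeta.
Proof.
move=> Uw ze; have := g_A3w Uw ze; congr (0 <= _).
rewrite DDAfun_dp// bilE exchange_big /=; apply: eq_bigr => i _; apply: eq_bigr => j _.
rewrite summxE mulr_sumr mulr_suml exchange_big /=; apply: eq_bigr => l _.
rewrite scalemxE summxE !mulr_sumr mulr_suml; apply: eq_bigr => k _.
by rewrite scalemxE (D_pp_AE _ _ _ _ Uw); ring.
Qed.

(** Two nested mean value theorems replace the integral remainder, since the second derivative of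
    [A] need not be continuous. They leave one value of it, at a point of the segment, and A3w gives
    its sign. *)
Lemma A_taylor_ortho x u p (eta zeta : V) :
  (forall t : R, 0 <= t <= 1 -> U (x, u, p + t *: eta)) -> dot zeta eta = 0 ->
  0 <= bil (Af (x, u, p + eta) - Af (x, u, p) - 'D_(dp eta) Af (x, u, p)) zeta zeta.
Proof.
move=> Ut ze; set w : V * R * V := (x, u, p).
have Uw t : 0 <= t <= 1 -> U (w + t *: dp eta) by rewrite dp_line; exact: Ut.
pose f (t : R) := bil (Af (w + t *: dp eta)) zeta zeta.
pose f1 (t : R) := bil ('D_(dp eta) Af (w + t *: dp eta)) zeta zeta.
pose f2 (t : R) := bil ('D_(dp eta) ('D_(dp eta) Af) (w + t *: dp eta)) zeta zeta.
have df (t : R) : 0 <= t <= 1 -> is_derive t (1 : R) f (f1 t).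
  move=> t01; apply: is_derive_bil; apply: is_derive_along; exact/Afun_diff/Uw.
have df1 (t : R) : 0 <= t <= 1 -> is_derive t (1 : R) f1 (f2 t).
  move=> t01; apply: is_derive_bil; apply: is_derive_along; exact/DAfun_diff/Uw.
have [t /andP[t0 t1] ft] := MVT_unit df.
have [|s /andP[s0 s1]] := @mean_value _ R^o f1 0 t.
  move=> s /andP[s0 s1]; apply/derivable1_diffP; apply: ex_derive; apply: df1.
  by rewrite add0r; apply/andP; split; [exact: mulr_ge0|exact: mulr_ile1].
rewrite !add0r => fs.
have st : 0 <= s *: t <= 1 by apply/andP; split; [exact: mulr_ge0|exact: mulr_ile1].
have -> : bil (Af (x, u, p + eta) - Af (x, u, p) - 'D_(dp eta) Af (x, u, p)) zeta zeta
    = f 1 - f 0 - f1 0.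
  by rewrite /f /f1 !bilD !bilN !dp_line !scale0r scale1r !addr0.
rewrite ft fs; have d2 := df1 _ st.
have -> : 'D_t (f1 : R^o -> R) (s *: t) = t * f2 (s *: t).
  rewrite -[t * _]/(t *: f2 (s *: t)) -(@derive_val _ _ _ _ _ _ _ d2).
  rewrite -(derive_dirZ (F := f1 : R^o -> R^o)); last exact/derivable1_diffP/ex_derive.
  by rewrite [t *: _]mulr1.
rewrite mulr_ge0// /f2 dp_line; apply: A3w_bil => //; exact: Ut.
Qed.

(** The Taylor remainder is nonnegative orthogonally to [eta], and first derivatives alone bound its
    entries by a multiple of [|eta|], which is what [bil_ortho_ge] needs. The increment of [A] and
    the linear term each contribute one [n * K]. *)
Lemma A_taylor x u p (eta : V) (K : R) :
  (forall t : R, 0 <= t <= 1 -> U (x, u, p + t *: eta)) ->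
  (forall (t : R) l i j, 0 <= t <= 1 ->
    `|('D_(dp (delta_mx 0 l)) Af (x, u, p + t *: eta)) i j| <= K) ->
  0 <= K -> forall xi : V,
  - ((2 * n%:R ^+ 2 + n%:R ^+ 3) * (2 * n%:R * K) * `|xi| * `|dot xi eta|) <=
  bil (Af (x, u, p + eta) - Af (x, u, p) - 'D_(dp eta) Af (x, u, p)) xi xi.
Proof.
move=> Ut DK K0 xi; apply: bil_ortho_ge; first by rewrite !mulr_ge0.
  move=> i j; rewrite !submxE.
  have Dbound (t : R) : 0 <= t <= 1 ->
      `|('D_(dp eta) Af (x, u, p + t *: eta)) i j| <= n%:R * K * `|eta|.
    move=> t01; rewrite derive_dp_sum; last exact/Afun_diff/Ut.
    rewrite summxE; apply: le_trans (ler_norm_sum _ _ _) _.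
    apply: (@le_trans _ _ (\sum_(l < n) K * `|eta|)).
      apply: ler_sum => l _; rewrite scalemxE normrM mulrC.
      by apply: ler_pM => //; [exact: DK|exact: mx_norm_coord].
    by rewrite sumr_const card_ord -[leLHS]mulr_natl mulrA.
  set w : V * R * V := (x, u, p).
  have [|t t01] := @MVT_unit _ (fun t : R => (Af (w + t *: dp eta)) i j)
    (fun t => ('D_(dp eta) Af (w + t *: dp eta)) i j).
    move=> t t01; apply: is_derive_coord; apply: is_derive_along.
    by apply: Afun_diff; rewrite dp_line; exact: Ut.
  rewrite !dp_line scale1r scale0r addr0 => ->.
  apply: le_trans (ler_normB _ _) _.
  have := Dbound 0; rewrite scale0r addr0 lexx ler01 => /(_ isT) D0.
  rewrite (_ : 2 * _ * _ * _ = n%:R * K * `|eta| + n%:R * K * `|eta|); last by ring.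
  by apply: lerD; [exact: Dbound t01|exact: D0].
by move=> zeta; exact: A_taylor_ortho.
Qed.

End A3wConvexity.

(** * Acceleration along g-segments *)

Section MixedCurve.
Context {R : realType} {n : nat}.
Local Notation V := 'rV[R]_n.
Variables (G : set (V * V * R)) (g : V -> V -> R -> R).
Hypotheses (g_gen : generating_function G g) (g_A1 : A1 G g) (g_A2 : A2 G g).
Hypothesis A_diff2 : A_twice_differentiable G g.
Local Notation Af := (Afun G g).
Local Notation U := (U_set G g).

Definition jet (w : V * V * R) : V * R * V := (w.1.1, gfun g w, gxf g w).

Definition jet_vel (b : V) (c : R) (w : V * V * R) : V * R * V :=
  (0, 'D_(dyz b c) (gfun g) w,
   \row_i 'D_(dyz b c) ('D_(dx (delta_mx 0 i)) (gfun g)) w).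

Lemma jetE x y z : jet (x, y, z) = (x, g x y z, g_x g x y z).
Proof. by rewrite /jet gxfE. Qed.

Lemma jet_U w : G w -> U (jet w).
Proof. by case: w => [[x y] z] Gw; rewrite jetE; exact: U_gx. Qed.

Lemma Af_jet w : G w -> Af (jet w) = g_xx g w.1.1 w.1.2 w.2.
Proof. by case: w => [[x y] z] Gw; rewrite jetE; exact: Afun_gx. Qed.

Lemma jet_cont w : G w -> {for w, continuous jet}.
Proof.
move=> Gw; apply: continuous_pair; last exact: gxf_cont Gw.
apply: continuous_pair; last exact: gfun_cont Gw.
by apply: continuous_fst_comp; exact: cvg_fst.
Qed.

Lemma is_derive_jet w b c (e : R) : G (w + e *: dyz b c) ->
  is_derive e (1 : R) (fun e' : R => jet (w + e' *: dyz b c)) (jet_vel b c (w + e *: dyz b c)).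
Proof.
move=> Gw; apply: is_derive_pair.
  apply: is_derive_pair; last exact: is_derive_along (gfun_diff g_gen Gw).
  rewrite (_ : (fun _ => _) = fun=> w.1.1); first exact: is_derive_cst.
  by apply/funext => e' /=; rewrite scaler0 addr0.
apply: is_derive_row => i; exact: is_derive_along (Dgfun_diff g_gen _ Gw).
Qed.

(** The direction [jet_vel] varies with the point. Expanding it along fixed directions separates its
    components from the derivatives of [A], so that each factor is visibly continuous. *)
Lemma derive_vel_sum w (c : R) (d : V) : U w ->
  'D_((0, c, d) : V * R * V) Af w =
  c *: 'D_((0, 1, 0) : V * R * V) Af w + \sum_l d 0 l *: 'D_(dp (delta_mx 0 l)) Af w.
Proof.
move=> Uw; have dA := Afun_diff A_diff2 Uw.
have -> : ((0, c, d) : V * R * V) = c *: ((0, 1, 0) : V * R * V) + dp d.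
  apply: triple_eq_p => /=.
  - by rewrite scaler0 addr0.
  - by rewrite [_ *: _]mulr1 addr0.
  - by rewrite scaler0 add0r.
rewrite derive_dirD; last exact: dA.
rewrite derive_dirZ; last exact: dA.
by rewrite [X in _ + X]derive_dp_sum; last exact: dA.
Qed.

Lemma jet_vel_cont (b : V) (c : R) i j w : G w ->
  {for w, continuous (fun w' => ('D_(jet_vel b c w') Af (jet w')) i j)}.
Proof.
move=> Gw.
pose F w' := ('D_(dyz b c) (gfun g) w') * ('D_((0, 1, 0) : V * R * V) Af (jet w')) i j
  + \sum_l ('D_(dyz b c) ('D_(dx (delta_mx 0 l)) (gfun g)) w') *
           ('D_(dp (delta_mx 0 l)) Af (jet w')) i j.
have DA v : {for w, continuous (fun w' => ('D_v Af (jet w')) i j)}.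
  apply: continuous_coord.
  apply: (@continuous_comp _ _ _ jet ('D_v Af)); first exact: jet_cont.
  exact: differentiable_continuous (DAfun_diff A_diff2 v (jet_U Gw)).
have DD l : {for w, continuous ('D_(dyz b c) ('D_(dx (delta_mx 0 l)) (gfun g)))}.
  exact: (D2gfun_cont (v := dx (delta_mx 0 l)) (v' := dyz b c) g_gen Gw).
have cF : {for w, continuous F}.
  apply: (@cvgD _ _ _ (nbhs w)).
    apply: (@cvgM _ _ (nbhs w)); last exact: DA.
    exact: differentiable_continuous (Dgfun_diff g_gen _ Gw).
  apply: (@cvg_bigsum _ _ (nbhs w)) => l; apply: (@cvgM _ _ (nbhs w)); last exact: DA.
  exact: DD.
have FE : \forall w' \near w, F w' = ('D_(jet_vel b c w') Af (jet w')) i j.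
  have nG : \forall w' \near w, G w'.
    by apply: open_nbhs_nbhs; split => //; exact: G_open g_gen.
  apply: filterS nG => w' Gw'; rewrite /jet_vel derive_vel_sum; last exact: jet_U.
  rewrite addmxE scalemxE summxE; congr (_ + _); apply: eq_bigr => l _.
  by rewrite scalemxE mxE.
exact: continuous_near_eq FE cF.
Qed.

Variables (y b : V) (z beta : R) (c xi : R -> V) (t0 : R).
Hypothesis dc : \forall s \near t0, is_derive s (1 : R) c (xi s).
Hypothesis cxi : {for t0, continuous xi}.
Hypothesis Gt0 : G (c t0, y, z).

Let l (s e : R) : V * V * R := (c s, y, z) + e *: dyz b beta.

Let l_cont : {for (t0, 0 : R), continuous (fun p : R * R => l p.1 p.2)}.
Proof.
have cc : {for t0, continuous c} by exact: is_derive_continuous (nbhs_singleton dc).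
apply: (@cvgD _ _ _ (nbhs ((t0, 0) : R * R))).
  apply: continuous_pair; last exact: cst_continuous.
  apply: continuous_pair; last exact: cst_continuous.
  exact: (@continuous_comp_fst _ _ _ c (t0, 0 : R) cc).
by apply: (@cvgZr_tmp _ _ _ (nbhs ((t0, 0) : R * R))); exact: cvg_snd.
Qed.

(* Since g_xx = A(x, g, g_x) and A is C1, the third derivative g_xxy exists although g is
   only C2; Peano's form of Schwarz's theorem turns it into the derivative of g_xy along
   the curve. *)
Lemma derive_mixed_curve i :
  is_derive t0 (1 : R)
    (fun s => 'D_(dyz b beta) ('D_(dx (delta_mx 0 i)) (gfun g)) (c s, y, z))
    (\sum_j xi t0 0 j * ('D_(jet_vel b beta (c t0, y, z)) Af (jet (c t0, y, z))) i j).
Proof.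
have l0 s : l s 0 = (c s, y, z) by rewrite /l scale0r addr0.
have nG : \forall p \near (t0, 0 : R), G (l p.1 p.2).
  apply: l_cont; rewrite /= l0; apply: open_nbhs_nbhs; split => //; exact: G_open g_gen.
pose f (s e : R) := 'D_(dx (delta_mx 0 i)) (gfun g) (l s e).
pose fs (s e : R) := \sum_j xi s 0 j * Af (jet (l s e)) i j.
pose fse (s e : R) := \sum_j xi s 0 j * ('D_(jet_vel b beta (l s e)) Af (jet (l s e))) i j.
have := @derive_mixed _ f fs fse
  (fun s => 'D_(dyz b beta) ('D_(dx (delta_mx 0 i)) (gfun g)) (c s, y, z)) t0.
rewrite /fse l0; apply.
- have n1 : \forall p \near (t0, 0 : R), is_derive p.1 (1 : R) c (xi p.1).
    have c1 : p.1 @[p --> (t0, 0 : R)] --> t0 by exact: cvg_fst.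
    exact: c1 _ dc.
  apply: filterS2 nG n1 => -[s e] /= Gl dcs.
  rewrite /fs (_ : \sum_j _ = 'D_(dx (xi s)) ('D_(dx (delta_mx 0 i)) (gfun g)) (l s e)).
    have dl : is_derive s (1 : R) (fun s' => l s' e) (dx (xi s)).
      rewrite -[dx (xi s)]addr0; apply: is_derive_add.
      by apply: is_derive_pair; apply: is_derive_pair.
    exact: (@is_derive_comp _ _ _ ('D_(dx (delta_mx 0 i)) (gfun g)) (fun s' => l s' e)
      s (dx (xi s)) (Dgfun_diff g_gen _ Gl) dl).
  move: Gl; case: (l s e) => [[x' y'] z'] Gl.
  rewrite (Dx_Dx_gfun g_gen)// mulmxE; apply: eq_bigr => j _.
  by rewrite trmxE Af_jet.
- apply: filterS nG => -[s e] /= Gl.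
  apply: is_derive_bigsum => j; apply: is_derive_cmul; apply: is_derive_coord.
  exact: (@is_derive_comp _ _ _ Af (fun e' => jet (l s e')) e _
    (Afun_diff A_diff2 (jet_U Gl)) (is_derive_jet Gl)).
- apply: (@cvg_bigsum _ _ (nbhs ((t0, 0) : R * R))) => j.
  apply: (@cvgM _ _ (nbhs ((t0, 0) : R * R))).
    apply: (@cvg_coord _ _ (nbhs ((t0, 0) : R * R))).
    exact: (@continuous_comp_fst _ _ _ xi (t0, 0 : R) cxi).
  apply: (@continuous_comp _ _ _ (fun p : R * R => l p.1 p.2)
    (fun w' => ('D_(jet_vel b beta w') Af (jet w')) i j)) => //.
  by apply: jet_vel_cont; rewrite /= l0.
- have n1 : \forall s \near t0, G (c s, y, z).
    have cs : {for t0, continuous (fun s => (c s, y, z))}.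
      apply: continuous_pair; last exact: cst_continuous.
      apply: continuous_pair; last exact: cst_continuous.
      exact: is_derive_continuous (nbhs_singleton dc).
    apply: cs; apply: open_nbhs_nbhs; split => //; exact: G_open g_gen.
  apply: filterS n1 => s Gs.
  have := @is_derive_along _ _ _ ('D_(dx (delta_mx 0 i)) (gfun g)) (c s, y, z) (dyz b beta) 0.
  by rewrite scale0r addr0 => H; apply: H; exact: (Dgfun_diff g_gen _ Gs).
Qed.

End MixedCurve.

Section Curves.
Context {R : realType} {n : nat}.
Local Notation V := 'rV[R]_n.
Variables (G : set (V * V * R)) (g : V -> V -> R -> R).
Hypotheses (g_gen : generating_function G g) (g_A1 : A1 G g) (g_A2 : A2 G g).

Lemma E_entry x y z i j :
  E_mx g x y z i j = g_xy g x y z i j + g_xz g x y z 0 i * Q g x y z 0 j.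
Proof.
rewrite /E_mx addmxE -scaleNr scalemxE mulmxE big_ord1 trmxE; congr (_ + _).
by rewrite /Q -scaleNr scalemxE mulrCA.
Qed.

Lemma mulmx_E x y z (xi : V) : xi *m E_mx g x y z =
  xi *m g_xy g x y z + dot xi (g_xz g x y z) *: Q g x y z.
Proof.
apply/rowP => j; rewrite addmxE scalemxE !mulmxE.
under eq_bigr => i _ do rewrite E_entry mulrDr mulrA.
by rewrite big_split /= -mulr_suml.
Qed.

Lemma Q_coord x y z j : G (x, y, z) ->
  g_y g x y z 0 j = - g_z g x y z * Q g x y z 0 j.
Proof.
by move=> Gw; rewrite /Q -scaleNr scalemxE mulrA mulrNN divff ?mul1r ?(g_z_neq0 g_gen Gw).
Qed.

Local Notation at3 F := (fun w : V * V * R => F w.1.1 w.1.2 w.2).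

Lemma g_z_cont w : G w -> {for w, continuous (at3 (g_z g))}.
Proof.
move=> Gw; rewrite (_ : (fun _ => _) = 'D_(dyz 0 1) (gfun g)); last first.
  by apply/funext => -[[x y] z]; rewrite g_z_coord.
exact: differentiable_continuous (Dgfun_diff g_gen _ Gw).
Qed.

Lemma g_xz_cont w : G w -> {for w, continuous (at3 (g_xz g))}.
Proof.
move=> Gw; apply: continuous_mx => i j; rewrite ord1.
rewrite (_ : (fun _ => _) = 'D_(dyz 0 1) ('D_(dx (delta_mx 0 j)) (gfun g))); last first.
  by apply/funext => -[[x y] z]; rewrite g_xz_coord.
exact: (D2gfun_cont (v := dx (delta_mx 0 j)) (v' := dyz 0 1) g_gen Gw).
Qed.

Lemma Q_cont w : G w -> {for w, continuous (at3 (Q g))}.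
Proof.
move=> Gw; apply: continuous_mx => i j; rewrite ord1.
rewrite (_ : (fun _ => _) = fun w => (- (at3 (g_z g)) w)^-1 * 'D_(dyz (delta_mx 0 j) 0) (gfun g) w).
  apply: (@cvgM _ _ (nbhs w)).
    apply: (@cvgV _ _ (nbhs w)); last by apply: (@cvgN _ _ _ (nbhs w)); exact: g_z_cont.
    rewrite oppr_eq0; case: w Gw => [[x y] z] Gw; exact: (g_z_neq0 g_gen Gw).
  exact: differentiable_continuous (Dgfun_diff g_gen _ Gw).
apply/funext => -[[x y] z] /=.
by rewrite /Q -scaleNr scalemxE g_y_coord invrN.
Qed.

Lemma E_cont w : G w -> {for w, continuous (at3 (E_mx g))}.
Proof.
move=> Gw; apply: continuous_mx => i j.
rewrite (_ : (fun _ => _) = fun w =>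
    'D_(dyz (delta_mx 0 j) 0) ('D_(dx (delta_mx 0 i)) (gfun g)) w +
    at3 (g_xz g) w 0 i * at3 (Q g) w 0 j); last first.
  by apply/funext => -[[x y] z] /=; rewrite E_entry g_xy_coord.
apply: (@cvgD _ _ _ (nbhs w)).
  exact: (D2gfun_cont (v := dx (delta_mx 0 i)) (v' := dyz (delta_mx 0 j) 0) g_gen Gw).
apply: (@cvgM _ _ (nbhs w)); apply: (@cvg_coord _ _ (nbhs w)).
  exact: g_xz_cont.
exact: Q_cont.
Qed.

Lemma slice_diff (F : V * V * R -> R) x y z : differentiable F (x, y, z) ->
  differentiable (fun x' => F (x', y, z)) x.
Proof.
move=> dF; apply: (@differentiable_comp _ _ _ _ (fun x' : V => (x', y, z)) F) => //.
Qed.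

Lemma Q_diff x y z : G (x, y, z) -> differentiable (fun x' => Q g x' y z) x.
Proof.
move=> Gw; rewrite (_ : (fun _ => _) = \sum_j (fun x' => Q g x' y z 0 j *: (delta_mx 0 j : V))).
  apply: differentiable_sum => j; apply: differentiableZl.
  pose a x' := - 'D_(dyz 0 1) (gfun g) (x', y, z).
  pose d x' := 'D_(dyz (delta_mx 0 j) 0) (gfun g) (x', y, z).
  rewrite (_ : (fun _ => _) = fun x' => (a x')^-1 * d x').
    apply: (@differentiableM _ _ (fun x' => (a x')^-1) d).
      apply: (@differentiableV _ _ a).
        exact: (differentiableN (slice_diff (Dgfun_diff g_gen _ Gw))).
      by rewrite /a oppr_eq0 -g_z_coord (g_z_neq0 g_gen Gw).
    exact: (slice_diff (Dgfun_diff g_gen _ Gw)).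
  by apply/funext => x'; rewrite /Q -scaleNr scalemxE g_y_coord g_z_coord -invrN.
by apply/funext => x'; rewrite fct_sumE {1}[Q _ _ _ _]rV_sum_delta.
Qed.

(** Differentiate [g_z Q = - g_y] in [x] and use the symmetry of second derivatives. The matrix
    describing how [g_x] depends on [y] thus also governs how [Q] depends on [x], and A2 makes [Q] a
    nondegenerate coordinate. *)
Lemma diff_Q x y z v : G (x, y, z) ->
  'd (fun x' => Q g x' y z) x v = - (g_z g x y z)^-1 *: (v *m E_mx g x y z).
Proof.
move=> Gw; have dQ := Q_diff Gw; rewrite -deriveE//.
have gz0 := g_z_neq0 g_gen Gw.
apply/rowP => j; rewrite scalemxE mulmx_E addmxE scalemxE.
have dQj := is_derive_coord 0 j (derivableP (@diff_derivable _ _ _ _ _ v dQ)).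
have dz : is_derive x v (fun x' => 'D_(dyz 0 1) (gfun g) (x', y, z))
    (dot v (g_xz g x y z)).
  rewrite -(Dx_Dz_gfun g_gen Gw) -derive_x; apply: derivableP; apply: diff_derivable.
  exact: (slice_diff (Dgfun_diff g_gen _ Gw)).
have dy : is_derive x v (fun x' => 'D_(dyz (delta_mx 0 j) 0) (gfun g) (x', y, z))
    ((v *m g_xy g x y z) 0 j).
  rewrite -(Dx_Dy_gfun g_gen Gw) -derive_x; apply: derivableP; apply: diff_derivable.
  exact: (slice_diff (Dgfun_diff g_gen _ Gw)).
have nG : \forall x' \near x, G (x', y, z).
  have c3 : {for x, continuous (fun x' => (x', y, z))}.
    by do 2 (apply: continuous_pair; last exact: cst_continuous); exact: cvg_id.
  by apply: c3; apply: open_nbhs_nbhs; split => //; exact: G_open g_gen.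
have dP := is_derive_mul dz dQj.
have dE : is_derive x v (fun x' => 'D_(dyz 0 1) (gfun g) (x', y, z) * Q g x' y z 0 j)
    (- ((v *m g_xy g x y z) 0 j)).
  apply: near_eq_is_derive (is_derive_opp dy).
  apply: filterS nG => x' Gx'; rewrite -g_y_coord -g_z_coord (Q_coord _ Gx').
  by rewrite mulNr opprK.
have := @derive_val _ _ _ _ _ _ _ dP; rewrite (@derive_val _ _ _ _ _ _ _ dE) /= -g_z_coord => e.
apply: (mulfI gz0); rewrite mulrA mulrN divff// mulN1r opprD.
by rewrite e (mulrC (Q g x y z 0 j)) addrK.
Qed.

(** The preimage of [qd] under the x-derivative of [Q(., y, z)], that is, the velocity at [x] of a
    g-segment whose Q-coordinate moves at the constant speed [qd]. *)
Definition velocity (y : V) (z : R) (qd x : V) : V :=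
  - g_z g x y z *: (qd *m invmx (E_mx g x y z)).

Lemma E_unit x y z : G (x, y, z) -> E_mx g x y z \in unitmx.
Proof. by move=> Gw; rewrite unitmxE unitfE g_A2. Qed.

Lemma velocity_E y z qd x : G (x, y, z) ->
  velocity y z qd x *m E_mx g x y z = - g_z g x y z *: qd.
Proof. by move=> Gw; rewrite /velocity -scalemxAl mulmxKV// E_unit. Qed.

Lemma velocity_cont y z qd x : G (x, y, z) -> {for x, continuous (velocity y z qd)}.
Proof.
move=> Gw.
have c3 : {for x, continuous (fun x' => (x', y, z))}.
  by do 2 (apply: continuous_pair; last exact: cst_continuous); exact: cvg_id.
apply: (@cvgZ _ _ _ (nbhs x)).
  apply: (@cvgN _ _ _ (nbhs x)).
  exact: (@continuous_comp _ _ _ (fun x' => (x', y, z)) (at3 (g_z g)) x c3 (g_z_cont Gw)).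
apply: (@cvg_mulmx _ _ (nbhs x)); first exact: cst_continuous.
apply: (@cvg_invmx _ _ (nbhs x)); first exact: g_A2.
exact: (@continuous_comp _ _ _ (fun x' => (x', y, z)) (at3 (E_mx g)) x c3 (E_cont Gw)).
Qed.

Lemma curve_derive (c : R -> V) y z s q0 qd : G (c s, y, z) -> {for s, continuous c} ->
  (\forall s' \near s, Q g (c s') y z = q0 + s' *: qd) ->
  is_derive s (1 : R) c (velocity y z qd (c s)).
Proof.
move=> Gw cc Qc.
have -> : velocity y z qd (c s) = mulmxr (- g_z g (c s) y z *: invmx (E_mx g (c s) y z)) qd.
  by rewrite /velocity /= scalemxAr.
apply: (@is_derive_inverse _ _ _ (fun x' => Q g x' y z)) => //.
- exact: Q_diff.
- have Qc' : \forall s' \near s, q0 + s' *: qd = Q g (c s') y z.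
    by apply: filterS Qc => s' ->.
  exact: (near_eq_is_derive Qc' (is_derive_line q0 qd s)).
- exact: mulmxr_continuous.
move=> v; rewrite diff_Q//= -scalemxAr -scalemxAl scalerA mulNr mulrN opprK.
by rewrite divff ?(g_z_neq0 g_gen Gw)// scale1r mulmxK ?E_unit.
Qed.

End Curves.

Section Acceleration.
Context {R : realType} {n : nat}.
Local Notation V := 'rV[R]_n.
Variables (G : set (V * V * R)) (g : V -> V -> R -> R).
Hypotheses (g_gen : generating_function G g) (g_A1 : A1 G g) (g_A2 : A2 G g).
Hypothesis A_diff2 : A_twice_differentiable G g.
Local Notation Af := (Afun G g).

Variables (Om : set V) (u : V -> R).
Hypothesis u_C2 : C2_on Om u.
Variables (c : R -> V) (y : V) (z : R) (q0 qd : V) (t0 : R).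
Hypothesis Hc : \forall s \near t0,
  [/\ Om (c s), G (c s, y, z), {for s, continuous c} & Q g (c s) y z = q0 + s *: qd].

Let xi s := velocity g y z qd (c s).
Let h s := u (c s) - g (c s) y z.
Let eta s := grad u (c s) - g_x g (c s) y z.
Let h1 s := dot (eta s) (xi s).
Let h2 := bil (hess u (c t0) - g_xx g (c t0) y z - 'D_(dp (eta t0)) Af (jet g (c t0, y, z)))
    (xi t0) (xi t0) + 2 * h1 t0 * dot (xi t0) (g_xz g (c t0) y z) / g_z g (c t0) y z.

Lemma curve_velocity : \forall s \near t0, is_derive s (1 : R) c (xi s).
Proof.
have Hc' := nbhs_interior Hc.
apply: filterS2 Hc Hc' => s [_ Gs cs _] ns.
apply: (curve_derive g_gen g_A2 (q0 := q0)) => //.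
by apply: filterS ns => s' [].
Qed.

Lemma is_derive_slice s v : is_derive s (1 : R) c v ->
  is_derive s (1 : R) (fun s' => (c s', y, z)) (dx v).
Proof. by move=> dc; do 2 (apply: is_derive_pair). Qed.

Lemma curve_h : \forall s \near t0, is_derive s (1 : R) h (h1 s).
Proof.
apply: filterS2 Hc curve_velocity => s [Os Gs _ _] dc.
rewrite /h1 /eta dotDl dotNl; apply: is_derive_sub.
  have [C1 _] := u_C2; have [du _] := C1 _ Os.
  rewrite (_ : dot _ _ = 'D_(xi s) u (c s)); first exact: (is_derive_comp du dc).
  rewrite {2}[xi s]rV_sum_delta derive_dir_sum//; apply: eq_bigr => i _.
  by rewrite derive_dirZ// mxE mulrC.
rewrite -(Dx_gfun g_gen Gs).
exact: (is_derive_comp (gfun_diff g_gen Gs) (is_derive_slice dc)).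
Qed.

Lemma curve_grad_u i : is_derive t0 (1 : R) (fun s => grad u (c s) 0 i)
  (\sum_j xi t0 0 j * hess u (c t0) i j).
Proof.
have [Os Gs _ _] := nbhs_singleton Hc; have dc := nbhs_singleton curve_velocity.
have [_ /(_ (delta_mx 0 i)) C1] := u_C2; have [du _] := C1 _ Os.
rewrite (_ : (fun _ => _) = ('D_(delta_mx 0 i) u) \o c); last first.
  by apply/funext => s; rewrite mxE.
rewrite (_ : \sum_j _ = 'D_(xi t0) ('D_(delta_mx 0 i) u) (c t0)); first exact: is_derive_comp du dc.
rewrite {2}[xi t0]rV_sum_delta derive_dir_sum//; apply: eq_bigr => j _.
by rewrite derive_dirZ// [hess _ _ _ _]mxE.
Qed.

Lemma curve_grad_g i : is_derive t0 (1 : R) (fun s => g_x g (c s) y z 0 i)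
  (\sum_j xi t0 0 j * g_xx g (c t0) y z i j).
Proof.
have [Os Gs _ _] := nbhs_singleton Hc; have dc := nbhs_singleton curve_velocity.
rewrite (_ : (fun _ => _) = ('D_(dx (delta_mx 0 i)) (gfun g)) \o (fun s => (c s, y, z))); last first.
  by apply/funext => s; rewrite g_x_coord.
rewrite (_ : \sum_j _ = 'D_(dx (xi t0)) ('D_(dx (delta_mx 0 i)) (gfun g)) (c t0, y, z)).
  exact: (is_derive_comp (Dgfun_diff g_gen _ Gs) (is_derive_slice dc)).
by rewrite (Dx_Dx_gfun g_gen)// mulmxE; apply: eq_bigr => j _; rewrite trmxE.
Qed.

(** The bending of the g-segment contributes exactly the linear term ['D_(dp eta) A], which
    completes [hess u - g_xx] to a second-order Taylor expression in the gradient variable.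
    Everything else is a multiple of [h1]. *)
Lemma curve_h1 : is_derive t0 (1 : R) h1 h2.
Proof.
have [Os Gs cc Qs] := nbhs_singleton Hc; have dc := nbhs_singleton curve_velocity.
have cxi : {for t0, continuous xi}.
  exact: (@continuous_comp _ _ _ c (velocity g y z qd) t0 cc (velocity_cont g_gen g_A2 Gs)).
have [b bE] := E_onto g_A2 (eta t0) Gs.
(* [psi s] is the x-gradient of [x -> g_y(x).b + beta g_z(x)] at [c s]. It equals [eta] at
   [t0], and that function is an explicit multiple of [g_z] along the curve, so [c''],
   which [eta' . c'] alone does not control, never has to be computed. *)
pose beta := dot (Q g (c t0) y z) b; pose kap := dot qd b.
pose psi i s := 'D_(dyz b beta) ('D_(dx (delta_mx 0 i)) (gfun g)) (c s, y, z).
have psiE s i : G (c s, y, z) -> psi i s =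
    (b *m (g_xy g (c s) y z)^T + beta *: g_xz g (c s) y z) 0 i.
  by move=> Gs'; rewrite /psi (Dyz_Dx_gfun g_gen).
have psi0 i : psi i t0 = eta t0 0 i by rewrite psiE// /beta -mulmx_E_trmx// bE.
pose gz s := g_z g (c s) y z; pose gxz s := g_xz g (c s) y z.
(* [beta] is frozen at [t0] while [Q . b] moves at speed [kap]; the mismatch is the [(s - t0)] term.
   At [t0] its derivative equals that of [gz], whence the factor 2 in [h2]. *)
have key s : G (c s, y, z) -> Q g (c s) y z = q0 + s *: qd ->
    \sum_i psi i s * xi s 0 i = - kap * (gz s + (s - t0) * dot (xi s) (gxz s)).
  move=> Gs' Qs'.
  rewrite (_ : \sum_i _ =
    dot (b *m (g_xy g (c s) y z)^T + beta *: gxz s) (xi s)); last first.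
    by apply: eq_bigr => i _; rewrite psiE.
  rewrite dotDl dot_mulmx trmxK dotC dotZl.
  have : dot (xi s *m E_mx g (c s) y z) b = - gz s * kap.
    by rewrite /xi (velocity_E g_A2)// dotZl.
  rewrite mulmx_E dotDl dotZl -/(gxz s) => /(canRL (addrK _)) ->.
  have -> : dot (Q g (c s) y z) b = beta + (s - t0) * kap.
    rewrite Qs' /beta Qs !dotDl !dotZl -/kap; ring.
  by rewrite (dotC (gxz s)); ring.
have dgz : is_derive t0 (1 : R) gz (dot (xi t0) (gxz t0)).
  rewrite (_ : gz = ('D_(dyz 0 1) (gfun g)) \o (fun s => (c s, y, z))); last first.
    by apply/funext => s; rewrite /gz g_z_coord.
  rewrite -(Dx_Dz_gfun g_gen Gs).
  exact: (is_derive_comp (Dgfun_diff g_gen _ Gs) (is_derive_slice dc)).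
have cgxz : {for t0, continuous gxz}.
  have c3 : {for t0, continuous (fun s => (c s, y, z))}.
    by do 2 (apply: continuous_pair; last exact: cst_continuous).
  exact: (@continuous_comp _ _ _ (fun s => (c s, y, z))
    (fun w : V * V * R => g_xz g w.1.1 w.1.2 w.2) t0 c3 (g_xz_cont g_gen Gs)).
have ds : is_derive t0 (1 : R) (fun s : R => s - t0) 1.
  by rewrite -[X in is_derive _ _ _ X]subr0; exact: is_derive_sub.
have d2 : is_derive t0 (1 : R) (fun s => - kap * (gz s + (s - t0) * dot (xi s) (gxz s)))
    (- kap * (dot (xi t0) (gxz t0) + 1 * dot (xi t0) (gxz t0))).
  have cd : {for t0, continuous (fun s => dot (xi s) (gxz s))}.
    exact: (@cvg_dot _ _ (nbhs t0)).
  exact: is_derive_cmul (is_derive_add dgz (is_derive_mul0 ds (subrr _) cd)).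
pose e i := \sum_j xi t0 0 j * hess u (c t0) i j - \sum_j xi t0 0 j * g_xx g (c t0) y z i j
  - \sum_j xi t0 0 j * ('D_(jet_vel g b beta (c t0, y, z)) Af (jet g (c t0, y, z))) i j.
(* [eta - psi] vanishes at [t0], so its product with [xi] can be differentiated although [xi] is
   merely continuous. *)
have d1 : is_derive t0 (1 : R) (fun s => \sum_i (eta s 0 i - psi i s) * xi s 0 i)
    (\sum_i e i * xi t0 0 i).
  apply: is_derive_bigsum => i.
  apply: (@is_derive_mul0 _ (fun s => eta s 0 i - psi i s)).
  - apply: is_derive_sub; last first.
      exact: (derive_mixed_curve g_gen g_A1 A_diff2 b beta curve_velocity cxi Gs i).
    rewrite (_ : (fun s => _) = fun s => grad u (c s) 0 i - g_x g (c s) y z 0 i).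
      exact: is_derive_sub (curve_grad_u i) (curve_grad_g i).
    by apply/funext => s; rewrite submxE.
  - by rewrite psi0 subrr.
  - exact: (@cvg_coord _ _ (nbhs t0)).
(* [beta] was chosen so that [g] stays fixed in the direction [(b, beta)]: the jet moves in its
   gradient component only, with velocity [eta]. *)
have velE : jet_vel g b beta (c t0, y, z) = dp (eta t0).
  apply: triple_eq_p => //=.
    rewrite (Dyz_gfun g_gen Gs) /beta /Q dotNl dotZl mulNr mulrAC.
    by rewrite mulVf ?(g_z_neq0 g_gen Gs)// mul1r subrr.
  by apply/rowP => i; rewrite mxE -psi0.
have h1E : \forall s \near t0, \sum_i (eta s 0 i - psi i s) * xi s 0 i +
    (- kap * (gz s + (s - t0) * dot (xi s) (gxz s))) = h1 s.
  apply: filterS Hc => s [_ Gs' _ Qs']; rewrite -key// -big_split /=.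
  by apply: eq_bigr => i _; rewrite mulrBl subrK.
apply: (near_eq_is_derive h1E).
have com (r1 r2 r3 : R) : r1 * r2 * r3 = r3 * r2 * r1 by ring.
have -> : h2 = \sum_i e i * xi t0 0 i +
    - kap * (dot (xi t0) (gxz t0) + 1 * dot (xi t0) (gxz t0)).
  have h1t0 : h1 t0 = - kap * gz t0.
    have := nbhs_singleton h1E; rewrite subrr mul0r addr0 => <-.
    by rewrite big1 ?add0r// => i _; rewrite psi0 subrr mul0r.
  rewrite /h2; congr (_ + _).
    rewrite bilE exchange_big /=; apply: eq_bigr => i _.
    rewrite /e velE -!sumrB mulr_suml; apply: eq_bigr => j _.
    rewrite !submxE -!mulrBr; exact: com.
  rewrite h1t0 -/(gz t0) -/(gxz t0); field.
  exact: (g_z_neq0 g_gen Gs).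
exact: is_derive_add d1 d2.
Qed.

End Acceleration.

Lemma ler_mul_sqr (R : realType) (r1 r2 x x' : R) :
  0 <= r1 -> 0 <= r2 -> 0 <= x -> x <= x' -> r1 * r2 * x * x <= r1 * r2 * x' * x'.
Proof.
move=> r10 r20 x0 xx; rewrite -!(mulrA (r1 * r2)).
by apply: ler_wpM2l; [exact: mulr_ge0|exact: ler_pM].
Qed.

Lemma mul_bound_ge (R : realType) (a b m : R) :
  `|b| <= m -> - (2 * m * `|a|) <= 2 * (a * b).
Proof.
move=> bm; have : `|a * b| <= `|a| * m by rewrite normrM ler_wpM2l.
by rewrite ler_norml => /andP[+ _]; lra.
Qed.

Lemma sum_bounds (R : realType) (C D B r s a b c d e f : R) :
  - (C * r) <= a - b - c -> - (D * s) <= d - a -> - (2 * B * r) <= e -> d <= f ->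
  0 <= C -> 0 <= D -> 0 <= B -> 0 <= r -> 0 <= s ->
  - ((C + D + 2 * B) * (r + s)) <= f - b - c + e.
Proof.
move=> h1 h2 h3 h4 C0 D0 B0 r0 s0.
have := mulr_ge0 C0 s0; have := mulr_ge0 D0 r0; have := mulr_ge0 B0 s0.
rewrite !mulrDl !mulrDr -!mulrA; rewrite -!mulrA in h3.
by lra.
Qed.

(** * The differential inequality at a contact point *)

Section Touch.
Context {R : realType} {n : nat}.
Local Notation V := 'rV[R]_n.
Variables (G : set (V * V * R)) (g : V -> V -> R -> R).
Hypotheses (g_gen : generating_function G g) (g_A1 : A1 G g) (g_A2 : A2 G g).
Hypotheses (A_diff2 : A_twice_differentiable G g) (g_A3w : A3w G g).
Local Notation Af := (Afun G g).
Local Notation U := (U_set G g).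
Local Notation W := (V * R * V)%type.

(** Membership in [U_set] is known only for the path at [t0]. By compactness of [[0, 1]] it persists
    for nearby [s], together with the bound [M + 1], where [M] is the maximum of [N] on the path at
    [t0]. *)
Lemma near_unit_bound (w : R -> R -> W) (N : W -> R) (t0 : R) :
  (forall th : R, 0 <= th <= 1 -> {for (th, t0), continuous (fun p : R * R => w p.1 p.2)}) ->
  (forall th : R, 0 <= th <= 1 -> U (w th t0)) ->
  (forall v, U v -> {for v, continuous N}) ->
  exists M, \forall s \near t0, forall th : R, 0 <= th <= 1 -> U (w th s) /\ N (w th s) <= M.
Proof.
move=> cw Uw cN.
have cwt th : 0 <= th <= 1 -> {for th, continuous (fun th' => w th' t0)}.
  move=> th01; have cp : {for th, continuous (fun th' : R => (th', t0))}.
    by apply: continuous_pair; [exact: cvg_id|exact: cst_continuous].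
  exact: (@continuous_comp _ _ _ _ (fun p : R * R => w p.1 p.2) th cp (cw th th01)).
have [|m m01 mmax] := @EVT_max R (fun th => N (w th t0)) 0 1 ler01.
  apply: continuous_in_subspaceT => th; rewrite inE/= in_itv/= => th01.
  exact: (@continuous_comp _ _ _ _ N th (cwt th th01) (cN _ (Uw th th01))).
set M := N (w m t0) in mmax.
exists (M + 1).
have cp : compact [set` `[(0 : R), 1]] by exact: segment_compact.
move/compact_near_coveringP : cp => /(_ _ (nbhs t0)
    (fun s th => U (w th s) /\ N (w th s) <= M + 1)) H.
have {}H : \forall s \near t0, [set` `[(0 : R), 1]] `<=`
    (fun th => U (w th s) /\ N (w th s) <= M + 1).
  apply: H => th; rewrite /= in_itv/= => th01.
  have nU : \forall p \near (th, t0), U (w p.1 p.2).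
    apply: (cw th th01); apply: open_nbhs_nbhs; split; last exact: Uw.
    exact: U_open g_gen g_A1 g_A2.
  have nN : \forall p \near (th, t0), N (w p.1 p.2) <= M + 1.
    have c2 := @continuous_comp _ _ _ (fun p : R * R => w p.1 p.2) N (th, t0)
      (cw th th01) (cN _ (Uw th th01)).
    have : N (w th t0) < M + 1.
      by apply: le_lt_trans (mmax th _) _; rewrite ?in_itv//= ltrDl.
    by move/(cvgr_le _ c2).
  exact: filterI nU nN.
apply: filterS H => s H th th01; apply: H; by rewrite /= in_itv.
Qed.

Definition DAnorm (v w : W) : R := \sum_i \sum_j `|('D_v Af w) i j|.

Lemma DAnorm_ge v w i j : `|('D_v Af w) i j| <= DAnorm v w.
Proof.
rewrite /DAnorm (bigD1 i)//= (bigD1 j)//= -addrA lerDl addr_ge0 ?sumr_ge0// => k _.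
by rewrite sumr_ge0.
Qed.

Lemma DAnorm_cont v w : U w -> {for w, continuous (DAnorm v)}.
Proof.
move=> Uw; apply: (@cvg_bigsum _ _ (nbhs w)) => i; apply: (@cvg_bigsum _ _ (nbhs w)) => j.
apply: (@cvg_norm _ _ _ (nbhs w)); apply: (@cvg_coord _ _ (nbhs w)).
exact: (differentiable_continuous (DAfun_diff A_diff2 v Uw)).
Qed.

Lemma Af_lipschitz_u x p (a d M : R) :
  (forall th : R, 0 <= th <= 1 -> U (x, a + th * d, p) /\
     DAnorm (0, 1, 0) (x, a + th * d, p) <= M) ->
  forall i j, `|(Af (x, a + d, p) - Af (x, a, p)) i j| <= M * `|d|.
Proof.
move=> H i j.
have l th : ((x, a, p) : W) + th *: ((0, d, 0) : W) = (x, a + th * d, p).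
  by apply: triple_eq_p => //=; rewrite scaler0 addr0.
have [th th01|th th01] := @MVT_unit _ (fun th : R => (Af ((x, a, p) + th *: ((0, d, 0) : W))) i j)
    (fun th => ('D_((0, d, 0) : W) Af ((x, a, p) + th *: ((0, d, 0) : W))) i j).
  apply: is_derive_coord; apply: is_derive_along.
  by apply: (Afun_diff A_diff2); rewrite l; case: (H th th01).
rewrite !l mul1r mul0r addr0 submxE => ->.
have [Uw DM] := H th th01.
have -> : ((0, d, 0) : W) = d *: ((0, 1, 0) : W).
  by apply: triple_eq_p => //=; rewrite ?scaler0// [_ *: _]mulr1.
rewrite derive_dirZ; last exact: (Afun_diff A_diff2).
rewrite scalemxE normrM mulrC ler_wpM2r//.
exact: le_trans (DAnorm_ge _ _ _ _) DM.
Qed.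

Variables (Om : set V) (u : V -> R).
Hypothesis u_C2 : C2_on Om u.
Hypothesis u_loc : forall x, Om x -> U (x, u x, grad u x) /\
  mx_le (A_mx G g x (u x) (grad u x)) (hess u x).
Variables (c : R -> V) (y : V) (z : R) (q0 qd : V) (t0 : R).
Hypothesis Hc : \forall s \near t0,
  [/\ Om (c s), G (c s, y, z), {for s, continuous c} & Q g (c s) y z = q0 + s *: qd].
Hypothesis Useg : forall th : R, 0 <= th <= 1 ->
  U (c t0, g (c t0) y z, g_x g (c t0) y z + th *: (grad u (c t0) - g_x g (c t0) y z)).
Hypothesis u_t0 : u (c t0) = g (c t0) y z.

Let xi s := velocity g y z qd (c s).
Let h s := u (c s) - g (c s) y z.
Let eta s := grad u (c s) - g_x g (c s) y z.
Let h1 s := dot (eta s) (xi s).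
Let h2 s := bil (hess u (c s) - g_xx g (c s) y z - 'D_(dp (eta s)) Af (jet g (c s, y, z)))
    (xi s) (xi s) + 2 * h1 s * dot (xi s) (g_xz g (c s) y z) / g_z g (c s) y z.

Let cc : {for t0, continuous c}.
Proof. by case: (nbhs_singleton Hc). Qed.
Let Gt0 : G (c t0, y, z).
Proof. by case: (nbhs_singleton Hc). Qed.
Let Ot0 : Om (c t0).
Proof. by case: (nbhs_singleton Hc). Qed.

Let c3 : {for t0, continuous (fun s => (c s, y, z))}.
Proof. by do 2 (apply: continuous_pair; last exact: cst_continuous). Qed.

Let cg : {for t0, continuous (fun s => g (c s) y z)}.
Proof. exact: (@continuous_comp _ _ _ _ (gfun g) t0 c3 (gfun_cont g_gen Gt0)). Qed.

Let cgx : {for t0, continuous (fun s => g_x g (c s) y z)}.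
Proof.
rewrite (_ : (fun s => _) = gxf g \o (fun s => (c s, y, z))).
  exact: (@continuous_comp _ _ _ _ (gxf g) t0 c3 (gxf_cont g_gen Gt0)).
by apply/funext => s /=; rewrite gxfE.
Qed.

Let cu : {for t0, continuous (fun s => u (c s))}.
Proof.
have [C1 _] := u_C2; have [du _] := C1 _ Ot0.
exact: (@continuous_comp _ _ _ c u t0 cc (differentiable_continuous du)).
Qed.

Let cDu : {for t0, continuous (fun s => grad u (c s))}.
Proof.
apply: (@continuous_comp _ _ _ c (grad u) t0 cc).
apply: continuous_mx => i j; have [_ /(_ (delta_mx 0 j)) C1] := u_C2.
have [du _] := C1 _ Ot0.
rewrite (_ : (fun t => _) = 'D_(delta_mx 0 j) u); last by apply/funext => t; rewrite mxE.
exact: differentiable_continuous du.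
Qed.

Let cxi : {for t0, continuous xi}.
Proof.
exact: (@continuous_comp _ _ _ c (velocity g y z qd) t0 cc (velocity_cont g_gen g_A2 Gt0)).
Qed.

(** Two legs join the jet of [g] to that of [u]: [w1] changes the gradient at the value [g], then
    [w2] changes the value at the gradient of [u]. *)
Let w1 (th s : R) : W := (c s, g (c s) y z, g_x g (c s) y z + th *: eta s).
Let w2 (th s : R) : W := (c s, g (c s) y z + th * h s, grad u (c s)).

Let w1_cont th : {for (th, t0), continuous (fun p : R * R => w1 p.1 p.2)}.
Proof.
apply: continuous_pair.
  apply: continuous_pair; first exact: (@continuous_comp_snd _ _ _ c (th, t0) cc).
  exact: (@continuous_comp_snd _ _ _ _ (th, t0) cg).
apply: (@cvgD _ _ _ (nbhs ((th, t0) : R * R))).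
  exact: (@continuous_comp_snd _ _ _ _ (th, t0) cgx).
apply: (@cvgZ _ _ _ (nbhs ((th, t0) : R * R))); first exact: cvg_fst.
apply: (@cvgB _ _ _ (nbhs ((th, t0) : R * R))).
  exact: (@continuous_comp_snd _ _ _ _ (th, t0) cDu).
exact: (@continuous_comp_snd _ _ _ _ (th, t0) cgx).
Qed.

Let w2_cont th : {for (th, t0), continuous (fun p : R * R => w2 p.1 p.2)}.
Proof.
apply: continuous_pair; last exact: (@continuous_comp_snd _ _ _ _ (th, t0) cDu).
apply: continuous_pair; first exact: (@continuous_comp_snd _ _ _ c (th, t0) cc).
apply: (@cvgD _ _ _ (nbhs ((th, t0) : R * R))).
  exact: (@continuous_comp_snd _ _ _ _ (th, t0) cg).
apply: (@cvgM _ _ (nbhs ((th, t0) : R * R))); first exact: cvg_fst.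
apply: (@cvgB _ _ _ (nbhs ((th, t0) : R * R))).
  exact: (@continuous_comp_snd _ _ _ _ (th, t0) cu).
exact: (@continuous_comp_snd _ _ _ _ (th, t0) cg).
Qed.

(* Only first derivatives of A are bounded here: A is merely twice differentiable, so its
   second derivatives need not be locally bounded, and A3w enters through [A_taylor]. *)
Lemma curve_h2_ge : exists2 K, 0 <= K &
  \forall s \near t0, - (K * (`|h1 s| + `|h s|)) <= h2 s.
Proof.
have NC (v : W) : U v -> {for v, continuous (fun w => \sum_l DAnorm (dp (delta_mx 0 l)) w)}.
  by move=> Uv; apply: (@cvg_bigsum _ _ (nbhs v)) => l; exact: DAnorm_cont.
have [M1 H1] := @near_unit_bound w1 (fun w => \sum_l DAnorm (dp (delta_mx 0 l)) w) t0
  (fun th _ => @w1_cont th) Useg NC.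
(* At the contact point the second leg shrinks to the jet of [u]. *)
have U2 (th : R) : 0 <= th <= 1 -> U (w2 th t0).
  move=> _; rewrite /w2 /h u_t0 subrr mulr0 addr0 -u_t0; exact: (u_loc Ot0).1.
have [M2 H2] := @near_unit_bound w2 (DAnorm (0, 1, 0)) t0 (fun th _ => @w2_cont th) U2
  (fun v Uv => @DAnorm_cont (0, 1, 0) v Uv).
pose X := `|xi t0| + 1.
have HX : \forall s \near t0, `|xi s| <= X.
  by apply: (cvgr_norm_le _ cxi); rewrite ltrDl.
pose k s := dot (xi s) (g_xz g (c s) y z) / g_z g (c s) y z.
have ck : {for t0, continuous k}.
  apply: (@cvgM _ _ (nbhs t0)).
    apply: (@cvg_dot _ _ (nbhs t0)); first exact: cxi.
    exact: (@continuous_comp _ _ _ _ (fun w : V * V * R => g_xz g w.1.1 w.1.2 w.2) t0 c3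
      (g_xz_cont g_gen Gt0)).
  apply: (@cvgV _ _ (nbhs t0)); first exact: (g_z_neq0 g_gen Gt0).
  exact: (@continuous_comp _ _ _ _ (fun w : V * V * R => g_z g w.1.1 w.1.2 w.2) t0 c3
    (g_z_cont g_gen Gt0)).
pose B := `|k t0| + 1.
have HB : \forall s \near t0, `|k s| <= B.
  by apply: (cvgr_norm_le _ ck); rewrite ltrDl.
pose C := (2 * n%:R ^+ 2 + n%:R ^+ 3) * (2 * n%:R * `|M1|) * X : R.
pose D := n%:R ^+ 2 * `|M2| * X * X : R.
have X0 : 0 <= X by rewrite addr_ge0.
have B0 : 0 <= B by rewrite addr_ge0.
have C0 : 0 <= C by rewrite !mulr_ge0// addr_ge0// ?mulr_ge0 ?exprn_ge0.
have D0 : 0 <= D by rewrite !mulr_ge0// exprn_ge0.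
exists (C + D + 2 * B); first by rewrite !addr_ge0// mulr_ge0.
near=> s.
have [Os Gs _ _] : [/\ Om (c s), G (c s, y, z), {for s, continuous c} & Q g (c s) y z = q0 + s *: qd].
  by near: s.
have H1s : forall th : R, 0 <= th <= 1 -> U (w1 th s) /\ \sum_l DAnorm (dp (delta_mx 0 l)) (w1 th s) <= M1.
  by near: s.
have H2s : forall th : R, 0 <= th <= 1 -> U (w2 th s) /\ DAnorm (0, 1, 0) (w2 th s) <= M2.
  by near: s.
have HXs : `|xi s| <= X by near: s.
have HBs : `|k s| <= B by near: s.
have T1 := @A_taylor _ _ _ _ g_gen g_A1 g_A2 A_diff2 g_A3w (c s) (g (c s) y z)
  (g_x g (c s) y z) (eta s) `|M1|.
have {}T1 := T1 (fun th th01 => (H1s th th01).1).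
have T1b : forall (t : R) l i j, 0 <= t <= 1 ->
    `|('D_(dp (delta_mx 0 l)) Af (w1 t s)) i j| <= `|M1|.
  move=> t l i j t01; have [_ b] := H1s t t01.
  apply: le_trans (DAnorm_ge _ _ _ _) _; apply: le_trans (ler_norm M1).
  apply: le_trans b; rewrite (bigD1 l)//= lerDl sumr_ge0// => m _.
  by apply: sumr_ge0 => ? _; apply: sumr_ge0.
have {}T1 := T1 T1b (normr_ge0 _) (xi s).
have T2 : forall i j, `|(Af (c s, g (c s) y z + h s, grad u (c s)) -
    Af (c s, g (c s) y z, grad u (c s))) i j| <= `|M2| * `|h s|.
  move=> i j; apply: le_trans (Af_lipschitz_u H2s i j) _.
  by apply: ler_wpM2r; [exact: normr_ge0|exact: ler_norm].
have [_ /(_ (xi s)) loc] := u_loc Os.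
have e1 : g_x g (c s) y z + eta s = grad u (c s) by rewrite /eta addrC subrK.
have e2 : g (c s) y z + h s = u (c s) by rewrite /h addrC subrK.
rewrite e1 in T1; rewrite e2 in T2.
set a11 := Af (c s, g (c s) y z, grad u (c s)) in T1 T2.
set a1 := Af (c s, u (c s), grad u (c s)) in T2.
have loc' : bil a1 (xi s) (xi s) <= bil (hess u (c s)) (xi s) (xi s) by exact: loc.
have T3 := bil_bound (xi s) (xi s) T2.
have gxxE : g_xx g (c s) y z = Af (c s, g (c s) y z, g_x g (c s) y z) by rewrite (Afun_gx g_A1 Gs).
have h1E : dot (xi s) (eta s) = h1 s by rewrite dotC.
rewrite h1E in T1.
have k2 : 2 * h1 s * dot (xi s) (g_xz g (c s) y z) / g_z g (c s) y z = 2 * (h1 s * k s).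
  by rewrite /k !mulrA.
(* Descent from [hess u] to [g_xx]: local g-convexity reaches [a1], [b2] replaces the value [u] by
   [g] at a cost in [|h|], [b1] is the Taylor estimate at a cost in [|h1|], and [b3] handles the
   [g_xz] term. *)
have b1 : - (C * `|h1 s|) <= bil (a11 - g_xx g (c s) y z - 'D_(dp (eta s)) Af (jet g (c s, y, z))) (xi s) (xi s).
  rewrite gxxE jetE; apply: le_trans T1; rewrite lerN2.
  apply: ler_wpM2r; first exact: normr_ge0.
  apply: ler_wpM2l; last exact: HXs.
  by rewrite !mulr_ge0// addr_ge0// ?mulr_ge0 ?exprn_ge0.
have b2 : - (D * `|h s|) <= bil (a1 - a11) (xi s) (xi s).
  move: T3; rewrite ler_norml => /andP[T3 _]; apply: le_trans T3; rewrite lerN2 /D.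
  rewrite (_ : n%:R ^+ 2 * `|M2| * X * X * `|h s| =
    n%:R ^+ 2 * (`|M2| * `|h s|) * X * X); last by ring.
  apply: ler_mul_sqr HXs; [exact: exprn_ge0|exact: mulr_ge0|exact: normr_ge0].
have b3 : - (2 * B * `|h1 s|) <= 2 * (h1 s * k s).
  exact: mul_bound_ge HBs.
have submB (M M' : 'M[R]_n) a : bil (M - M') a a = bil M a a - bil M' a a.
  by rewrite bilD bilN.
rewrite !submB in b1; rewrite submB in b2.
have -> : h2 s = bil (hess u (c s)) (xi s) (xi s) - bil (g_xx g (c s) y z) (xi s) (xi s)
    - bil ('D_(dp (eta s)) Af (jet g (c s, y, z))) (xi s) (xi s) + 2 * (h1 s * k s).
  by rewrite -!submB -k2.
apply: (sum_bounds b1 b2 b3 loc' C0 D0 B0); exact: normr_ge0.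
Unshelve. all: by end_near. Qed.

Lemma touch_right (r : R) : 0 < r -> (forall s, t0 <= s <= t0 + r -> h s <= 0) ->
  h1 t0 = 0 -> exists2 d, 0 < d & forall s, t0 <= s <= t0 + d -> h s = 0.
Proof.
move=> r0 hle h10; have [K K0 HK] := curve_h2_ge.
have dh := curve_h g_gen g_A2 u_C2 Hc.
have dh1 : \forall s \near t0, is_derive s (1 : R) h1 (h2 s).
  have Hc' := nbhs_interior Hc.
  apply: filterS Hc' => s Hs.
  exact: (curve_h1 g_gen g_A1 g_A2 A_diff2 u_C2 Hs).
have [e /= e0 eP] := (nbhs_ballP t0 _).1 (filterI (filterI dh dh1) HK).
(* Short enough for the sign of [h], for the neighbourhood where the inequality holds, and for the
   length condition of [second_order_zero]. *)
pose d := Num.min (Num.min r (e / 2)) (2 * (3 * K + 1))^-1.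
have K1 : 0 < 2 * (3 * K + 1) by lra.
have d0 : 0 < d by rewrite !lt_min r0 divr_gt0//= invr_gt0.
have dr : d <= r by rewrite !ge_min lexx.
have de : d < e.
  apply: (@le_lt_trans _ _ (e / 2)); first by rewrite !ge_min lexx orbT.
  by rewrite ltr_pdivrMr// ltr_pMr// ltr1n.
have dK : 2 * (3 * K + 1) * d <= 1.
  by rewrite mulrC -ler_pdivlMr// mul1r ge_min lexx orbT.
have inb s : t0 <= s <= t0 + d -> ball t0 e s.
  by move=> /andP[s0 s1]; rewrite /ball/= distrC ger0_norm; lra.
exists d => // s sd; apply/eqP; rewrite -oppr_eq0; apply/eqP.
apply: (@second_order_zero _ (fun s => - h s) (fun s => - h1 s) (fun s => - h2 s) t0 d K) => //.
- by move=> t /inb/eP[[dht _] _]; exact: is_derive_opp.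
- by move=> t /inb/eP[[_ dh1t] _]; exact: is_derive_opp.
- by move=> t /andP[ta tb]; rewrite oppr_ge0 hle//; apply/andP; split=> //; lra.
- move=> t td; have [_ b] := eP _ (inb _ td).
  have ht : h t <= 0 by apply: hle; case/andP: td => ? ?; apply/andP; split=> //; lra.
  by rewrite normrN -(ler0_norm ht) lerNl.
- by rewrite /h u_t0 subrr oppr0.
- by rewrite h10 oppr0.
Qed.

End Touch.

(** * Level sets and the global argument *)

Section Levels.
Context {R : realType} {n : nat}.
Local Notation V := 'rV[R]_n.
Variables (G : set (V * V * R)) (g : V -> V -> R -> R).
Hypotheses (g_gen : generating_function G g) (g_A1 : A1 G g) (g_A2 : A2 G g).
Hypotheses (g_A1star : A1star G g) (A_diff2 : A_twice_differentiable G g) (g_A3w : A3w G g).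
Local Notation U := (U_set G g).
Variables (Om : set V) (u : V -> R).
Hypotheses (Om_open : open Om) (u_C2 : C2_on Om u).
Hypothesis u_loc : forall x, Om x -> U (x, u x, grad u x) /\
  mx_le (A_mx G g x (u x) (grad u x)) (hess u x).
Variable y : V.
Hypothesis Useg : forall a m (th : R), Om a -> G (a, y, m) -> u a = g a y m -> 0 <= th <= 1 ->
  U (a, g a y m, g_x g a y m + th *: (grad u a - g_x g a y m)).

(** A1* and A2 make [local_surj] applicable to [Q(., y, m)] with the level [m] as parameter. This
    stands in for joint continuity of the inverse in the level and the coordinate. *)
Lemma preimage_near (am : V * R) (O : set (V * R)) :
  Om am.1 -> G (am.1, y, am.2) -> nbhs am O ->
  \forall p \near (am.2, Q g am.1 y am.2),
    exists a, [/\ Om a, Q g a y p.1 = p.2 & O (a, p.1)].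
Proof.
case: am => a0 m0 /= Oa0 Ga0 nO.
have c3 (w : V * R) : {for w, continuous (fun w : V * R => (w.1, y, w.2))}.
  apply: continuous_pair; last exact: cvg_snd.
  by apply: continuous_pair; [exact: cvg_fst|exact: cst_continuous].
have nGO : \forall w \near (a0, m0), [/\ Om w.1, G (w.1, y, w.2) & O w].
  have n1 : \forall w \near (a0, m0), Om w.1.
    have c1 : w.1 @[w --> (a0, m0)] --> a0 by exact: cvg_fst.
    by apply: c1; exact: open_nbhs_nbhs.
  have n2 : \forall w \near (a0, m0), G (w.1, y, w.2).
    apply: (c3 (a0, m0)); apply: open_nbhs_nbhs; split => //; exact: G_open g_gen.
  by apply: filterS3 n1 n2 nO => w.
have [r r0 rP] : exists2 r : R, 0 < r & closed_ball a0 r `*` closed_ball m0 r `<=`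
    [set w | [/\ Om w.1, G (w.1, y, w.2) & O w]].
  have := @open_box _ _ _ ([set w | [/\ Om w.1, G (w.1, y, w.2) & O w]]°) a0 m0.
  case; [exact: open_interior|exact: nGO|move=> r r0 rP; exists r => // w /rP].
  exact: interior_subset.
pose f (m : R) (a : V) := Q g a y m.
have m0r : closed_ball m0 r m0 by exact: closed_ballxx.
have nm : \forall m \near m0, closed_ball m0 r m.
  by apply: filterS (nbhsx_ballx m0 r r0) => m; exact: subset_closed_ball.
have KP (m : R) (a : V) : closed_ball m0 r m -> closed_ball a0 r a ->
    [/\ Om a, G (a, y, m) & O (a, m)].
  by move=> mr ar; exact: (rP (a, m)).
have fc (m : R) (a : V) : closed_ball m0 r m -> closed_ball a0 r a ->
    {for (m, a), continuous (fun q => f q.1 q.2)}.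
  move=> mr ar; have [_ Ga _] := KP m a mr ar.
  have cs : {for (m, a), continuous (fun q : R * V => (q.2, y, q.1))}.
    apply: continuous_pair; last exact: cvg_fst.
    by apply: continuous_pair; [exact: cvg_snd|exact: cst_continuous].
  exact: (@continuous_comp _ _ _ _ (fun w : V * V * R => Q g w.1.1 w.1.2 w.2) (m, a) cs
    (Q_cont g_gen Ga)).
have := @local_surj R R V V f m0 a0 (closed_ball a0 r) (ball a0 r).
have H1 : compact (closed_ball a0 r) by exact: compact_closed_ball_rV.
have H2 : open (ball a0 r) by exact: ball_open.
have H3 : ball a0 r `<=` closed_ball a0 r by exact: subset_closed_ball.
have H4 : ball a0 r a0 by exact: ballxx.
have H5 a : closed_ball a0 r a -> f m0 a = f m0 a0 -> a = a0.
  move=> ar e; have [_ Ga _] := KP m0 a m0r ar.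
  by apply: (g_A1star (y := y) (z := m0)); rewrite ?inE.
have H6 : \forall m \near m0, forall a, closed_ball a0 r a -> {for a, continuous (f m)}.
  apply: filterS nm => m mr a ar; have [_ Ga _] := KP m a mr ar.
  exact: differentiable_continuous (Q_diff g_gen Ga).
have H7 : \forall m \near m0, forall a, ball a0 r a -> forall e, exists v, is_derive a v (f m) e.
  apply: filterS nm => m mr a ar e; have [_ Ga _] := KP m a mr (H3 _ ar).
  exists (velocity g y m e a).
  have dQ := Q_diff g_gen Ga.
  have := derivableP (@diff_derivable _ _ _ _ _ (velocity g y m e a) dQ).
  rewrite deriveE// (diff_Q g_gen)// (velocity_E g_A2)// scalerA mulrNN mulVf ?scale1r//.
  exact: (g_z_neq0 g_gen Ga).
move=> /(_ H1 H2 H3 H4 (fun a => fc m0 a m0r) H5 H6 H7) H.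
have c1 : q.1 @[q --> (m0, f m0 a0)] --> m0 by exact: cvg_fst.
apply: filterS2 H (c1 _ nm) => q [a ar fa] qr; exists a.
by have [] := KP q.1 a qr (H3 _ ar).
Qed.

Section FixedLevel.
Variable m : R.
Hypothesis Gm : forall x, Om x -> G (x, y, m).
Hypothesis Qconv : convex_set ((fun x => Q g x y m) @` Om : set (convex_lmodType V)).

Definition Qinv (q : V) : V := xget 0 [set a | Om a /\ Q g a y m = q].

Lemma Q_inj a a' : Om a -> Om a' -> Q g a y m = Q g a' y m -> a = a'.
Proof.
by move=> Oa Oa' e; apply: (g_A1star (y := y) (z := m)); rewrite ?inE//=; exact: Gm.
Qed.

Lemma QinvP a : Om a -> Qinv (Q g a y m) = a.
Proof.
move=> Oa; rewrite /Qinv; case: xgetP => [a' _ [Oa' e]|/(_ a) H]; last by exfalso; apply: H.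
exact: Q_inj.
Qed.

Variables (a0 a1 : V).
Hypotheses (Oa0 : Om a0) (Oa1 : Om a1).
Let q0 := Q g a0 y m.
Let qd := Q g a1 y m - Q g a0 y m.
Let c (t : R) := Qinv (q0 + t *: qd).

Lemma seg_point (t : R) : 0 <= t <= 1 -> exists2 a, Om a & Q g a y m = q0 + t *: qd.
Proof.
move=> t01; have := convex_set_seg Qconv (a := q0) (b := Q g a1 y m) (t := t).
by case=> //; [exists a0|exists a1|move=> a Oa e; exists a].
Qed.

(** The image of [Om] under [Q] is open besides being convex, so the segment extends slightly past
    both ends and two-sided derivatives make sense at 0 and 1. *)
Lemma seg_near (t : R) : 0 <= t <= 1 -> \forall s \near t,
  [/\ Om (c s), G (c s, y, m), {for s, continuous c} & Q g (c s) y m = q0 + s *: qd].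
Proof.
move=> t01.
have step (s : R) a (O : set V) : Om a -> Q g a y m = q0 + s *: qd -> nbhs a O ->
    \forall s' \near s, [/\ Om (c s'), Q g (c s') y m = q0 + s' *: qd & O (c s')].
  move=> Oa Qa nO.
  have nO' : nbhs (a, m) [set w | O w.1].
    have c1 : w.1 @[w --> (a, m)] --> a by exact: cvg_fst.
    exact: c1.
  have := @preimage_near (a, m) _ Oa (Gm Oa) nO'; rewrite /= Qa => H.
  have cs : {for s, continuous (fun s' : R => (m, q0 + s' *: qd))}.
    apply: continuous_pair; first exact: cst_continuous.
    exact: is_derive_continuous (is_derive_line _ _ _).
  have {}H : \forall s' \near s, exists a, [/\ Om a, Q g a y m = q0 + s' *: qd & O a].
    exact: cs _ H.
  apply: filterS H => s' [a' [Oa' Qa' Oo]].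
  by rewrite /c -Qa' QinvP.
have [a Oa Qa] := seg_point t01.
have H : \forall s' \near t, [/\ Om (c s'), Q g (c s') y m = q0 + s' *: qd & setT (c s')].
  by apply: (step t a setT Oa Qa); exact: filterT.
apply: filterS H => s [Os Qs _]; split => //; first exact: Gm.
move=> O nO; have := step s (c s) O Os Qs nO.
by apply: filterS => s' [].
Qed.

Lemma seg0 : c 0 = a0.
Proof. by rewrite /c scale0r addr0 QinvP. Qed.

Lemma seg1 : c 1 = a1.
Proof. by rewrite /c scale1r addrC subrK QinvP. Qed.

Let h s := u (c s) - g (c s) y m.
Let h1 s := dot (grad u (c s) - g_x g (c s) y m) (velocity g y m qd (c s)).

Lemma seg_derive (t : R) : 0 <= t <= 1 -> is_derive t (1 : R) h (h1 t).
Proof. by move=> t01; exact: nbhs_singleton (curve_h g_gen g_A2 u_C2 (seg_near t01)). Qed.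

Lemma seg_touch_interior (t : R) : (forall s, 0 <= s <= 1 -> h s <= 0) ->
  0 < t < 1 -> h t = 0 -> h1 t = 0.
Proof.
move=> hle t01 ht.
have d (s : R) : s \in `]0, 1[%R -> is_derive s (1 : R) h (h1 s).
  by rewrite in_itv/= => /andP[s0 s1]; apply: seg_derive; rewrite !ltW.
have t01' : t \in `]0, 1[%R by rewrite in_itv.
have := @derive1_at_max R h 0 1 t ler01 (fun s s01 => @ex_derive _ _ _ _ _ _ _ (d s s01)) t01'.
case=> [s|_ <-]; last by rewrite (@derive_val _ _ _ _ _ _ _ (d t t01')).
by rewrite in_itv/= => /andP[s0 s1]; rewrite ht hle// !ltW.
Qed.

(** Continuation to the right: at the supremum [T] of the times up to which [h] vanishes, [h] is 0
    by continuity and so is its derivative, and [touch_right] goes further unless [T = 1]. *)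
Lemma seg_touch (t : R) : (forall s, 0 <= s <= 1 -> h s <= 0) -> 0 <= t <= 1 ->
  h t = 0 -> h1 t = 0 -> h 1 = 0.
Proof.
move=> hle /andP[t0 t1] ht h1t.
pose S := [set s | t <= s <= 1 /\ forall s', t <= s' <= s -> h s' = 0].
have St : S t.
  split; first by rewrite lexx.
  by move=> s' /andP[? ?]; rewrite (_ : s' = t)//; apply/eqP; rewrite eq_le; apply/andP.
have supS : has_sup S by split; [exists t|exists 1 => s [/andP[_ ?] _]].
pose T := sup S.
have tT : t <= T by apply: sup_upper_bound.
have T1 : T <= 1 by apply: ge_sup; [exists t|move=> s [/andP[_ ?] _]].
have T01 : 0 <= T <= 1 by apply/andP; split=> //; exact: le_trans tT.
have below s : t <= s < T -> h s = 0.
  move=> /andP[ts sT]; have [|e [_ eS] se] := @sup_adherent _ S (T - s) _ supS.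
    by rewrite subr_gt0.
  by apply: eS; apply/andP; split=> //; rewrite ltW//; move: se; rewrite -/T opprB addrC subrK.
have hT : h T = 0.
  have [<-//|tT'] := eqVneq t T.
  have {}tT' : t < T by rewrite lt_neqAle tT'.
  have ch := is_derive_continuous (seg_derive T01).
  apply/eqP; apply: contraT => hT0.
  have hTn : \forall s \near T, h s != 0 by have := cvgr_neq0 _ ch hT0; exact.
  have [e /= e0 eP] := (nbhs_ballP T _).1 hTn.
  pose s := Num.max t (T - e / 2).
  have e2 : 0 < e / 2 by rewrite divr_gt0.
  have sT : s < T by rewrite gt_max tT' ltrBlDr ltrDl.
  have ts : t <= s by rewrite le_max lexx.
  have : h s != 0.
    apply: eP; rewrite /ball/= gtr0_norm ?subr_gt0// ltrBlDr -ltrBlDl lt_max.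
    by apply/orP; right; rewrite ltrD2l ltrN2 ltr_pdivrMr// ltr_pMr// ltr1n.
  by rewrite below ?eqxx// ts.
have [<-//|T1'] := eqVneq T 1.
have {}T1' : T < 1 by rewrite lt_neqAle T1'.
(* If [T = t] this is the hypothesis on [t], which is indispensable for [t = 0]: a maximum at an end
   says nothing. Otherwise [T] is an interior maximum. *)
have h1T : h1 T = 0.
  have [<-//|tT'] := eqVneq t T.
  apply: seg_touch_interior => //; rewrite T1' andbT (le_lt_trans t0)//.
  by rewrite lt_neqAle tT'.
have nT := seg_near T01.
have [OT GT _ _] := nbhs_singleton nT.
have uT : u (c T) = g (c T) y m by apply/eqP; rewrite -subr_eq0; apply/eqP.
have [|||d d0 dP] := @touch_right _ _ G g g_gen g_A1 g_A2 A_diff2 g_A3w Om u u_C2 u_loc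
  c y m q0 qd T nT (fun th => @Useg _ _ th OT GT uT) uT (1 - T).
- by rewrite subr_gt0.
- move=> s; rewrite [T + _]addrC subrK => /andP[Ts s1]; apply: hle; apply/andP; split=> //.
  by case/andP: T01 => T0 _; exact: le_trans Ts.
- exact: h1T.
pose T' := T + Num.min d (1 - T).
have dm : 0 < Num.min d (1 - T) by rewrite lt_min d0 subr_gt0.
have : S T'.
  split.
    rewrite -lerBrDl ge_min lexx orbT andbT; apply: (le_trans tT); rewrite lerDl; exact: ltW.
  move=> s /andP[ts sT']; have [sT|Ts] := ltP s T; first by rewrite below// ts.
  apply: dP; rewrite Ts/=; apply: (le_trans sT'); by rewrite lerD2l ge_min lexx.
move=> /(sup_upper_bound supS); rewrite -/T /T' -subr_ge0 opprD addrA subrr add0r.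
by rewrite oppr_ge0 leNgt dm.
Qed.

End FixedLevel.
End Levels.

(** * Monotonicity in z and the dual function *)

Section Monotone.
Context {R : realType} {n : nat}.
Local Notation V := 'rV[R]_n.
Variables (G : set (V * V * R)) (g : V -> V -> R -> R).
Hypothesis g_gen : generating_function G g.

Lemma g_decr x y z z' : G (x, y, z) -> G (x, y, z') -> z < z' -> g x y z' < g x y z.
Proof.
move=> Gz Gz' zz'.
have Gs s : z <= s <= z' -> G (x, y, s).
  by move=> sz; have [_ /(_ x y)[_ int] _ _] := g_gen; exact: (int z z').
have dg (s : R) : z <= s <= z' -> is_derive s (1 : R) (g x y) (g_z g x y s).
  move=> /Gs Gxs; have -> : g x y = fun s => gfun g ((x, y, 0) + s *: dyz 0 1).
    apply/funext => s'; rewrite /gfun /= !scaler0 !addr0 add0r.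
    by congr (g x y _); rewrite [_ *: _]mulr1.
  rewrite g_z_coord (_ : (x, y, s) = (x, y, 0) + s *: dyz 0 1).
    apply: is_derive_along; rewrite (_ : _ + _ = (x, y, s)); first exact: (gfun_diff g_gen Gxs).
    by apply: triple_eq => /=; rewrite ?scaler0 ?addr0// add0r [_ *: _]mulr1.
  by apply: triple_eq => /=; rewrite ?scaler0 ?addr0// add0r [_ *: _]mulr1.
have [s|s|s sz e] := @MVT R (g x y) (g_z g x y) z z' zz'.
- by rewrite in_itv/= => /andP[? ?]; apply: dg; rewrite !ltW.
- apply: continuous_in_subspaceT => {}s; rewrite inE/= in_itv/= => sz.
  exact: is_derive_continuous (dg s sz).
rewrite -subr_lt0 e pmulr_llt0 ?subr_gt0//.
move: sz; rewrite in_itv/= => /andP[? ?].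
by apply: (g_z_lt0 g_gen); apply: Gs; rewrite !ltW.
Qed.

Lemma g_le x y z z' : G (x, y, z) -> G (x, y, z') -> (g x y z <= g x y z') = (z' <= z).
Proof.
move=> Gz Gz'; have [zz'|zz'|->] := ltgtP z z'; last by rewrite lexx.
  by apply/negbTE; rewrite -ltNge; exact: g_decr.
by apply/ltW; exact: g_decr.
Qed.

Lemma gstar_P x y v : J_pt G g x y v -> G (x, y, gstar G g x y v) /\ g x y (gstar G g x y v) = v.
Proof.
move=> [z Gz gz]; rewrite /gstar; case: xgetP => [z' _ [? ?]//|/(_ z) H].
by exfalso; apply: H.
Qed.

Lemma gstar_g x y z : G (x, y, z) -> gstar G g x y (g x y z) = z.
Proof.
move=> Gz; have [|Gz' gz'] := @gstar_P x y (g x y z); first by exists z.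
by apply/eqP; rewrite eq_le -(g_le Gz Gz') -(g_le Gz' Gz) gz' lexx.
Qed.

End Monotone.

Section LevelSets.
Context {R : realType} {n : nat}.
Local Notation V := 'rV[R]_n.
Variables (G : set (V * V * R)) (g : V -> V -> R -> R).
Hypotheses (g_gen : generating_function G g) (g_A1 : A1 G g) (g_A2 : A2 G g).
Hypotheses (g_A1star : A1star G g) (A_diff2 : A_twice_differentiable G g) (g_A3w : A3w G g).
Local Notation U := (U_set G g).
Variables (Om : set V) (u : V -> R).
Hypotheses (Om_open : open Om) (Om_conn : connected Om) (u_C2 : C2_on Om u).
Hypothesis u_loc : forall x, Om x -> U (x, u x, grad u x) /\
  mx_le (A_mx G g x (u x) (grad u x)) (hess u x).
Variable y : V.
Hypothesis Useg : forall a m (th : R), Om a -> G (a, y, m) -> u a = g a y m -> 0 <= th <= 1 ->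
  U (a, g a y m, g_x g a y m + th *: (grad u a - g_x g a y m)).
Variable w : V -> R.
Hypothesis wP : forall x, Om x -> G (x, y, w x) /\ g x y (w x) = u x.
Let I := w @` Om.
Hypothesis IG : forall m, I m -> forall x, Om x -> G (x, y, m).
Hypothesis Iconv : forall m, I m ->
  convex_set ((fun x => Q g x y m) @` Om : set (convex_lmodType V)).

Lemma u_le_g a m : Om a -> G (a, y, m) -> (u a - g a y m <= 0) = (m <= w a).
Proof. by move=> Oa Ga; have [Gw <-] := wP Oa; rewrite subr_le0 (g_le g_gen). Qed.

Lemma u_eq_g a m : Om a -> G (a, y, m) -> u a - g a y m = 0 -> w a = m.
Proof.
move=> Oa Ga /subr0_eq e; have [Gw gw] := wP Oa; apply/eqP.
by rewrite eq_le -(g_le g_gen Ga Gw) -(g_le g_gen Gw Ga) gw e lexx.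
Qed.

(** [u - g(., y, w x + s)] is positive and [u - g(., y, w x - s)] negative at [x], hence also
    nearby, and monotonicity in [z] turns these signs into bounds on [w]. *)
Lemma w_cont x : Om x -> {for x, continuous w}.
Proof.
move=> Ox; have [Gw gw] := wP Ox.
have gcont z : G (x, y, z) -> {for x, continuous (fun x' => u x' - g x' y z)}.
  move=> Gz; have [C1 _] := u_C2; have [du _] := C1 _ Ox.
  apply: (@cvgB _ _ _ (nbhs x)); first exact: differentiable_continuous du.
  have c3 : {for x, continuous (fun x' : V => (x', y, z))}.
    by do 2 (apply: continuous_pair; last exact: cst_continuous); exact: cvg_id.
  exact: (@continuous_comp _ _ _ _ (gfun g) x c3 (gfun_cont g_gen Gz)).
have nG z : G (x, y, z) -> \forall x' \near x, Om x' /\ G (x', y, z).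
  move=> Gz; have c3 : {for x, continuous (fun x' : V => (x', y, z))}.
    by do 2 (apply: continuous_pair; last exact: cst_continuous); exact: cvg_id.
  have n1 : \forall x' \near x, G (x', y, z).
    by apply: c3; apply: open_nbhs_nbhs; split => //; exact: G_open g_gen.
  have n2 : \forall x' \near x, Om x' by exact: open_nbhs_nbhs.
  exact: filterI.
apply/(@cvgrPdist_lt _ _ _ (nbhs x) (nbhs_filter x) w (w x)) => e e0.
have [oI _] : open (I_pt G x y) /\ is_interval (I_pt G x y) by case: g_gen => _ /(_ x y).
have [d /= d0 dP] : nbhs_ball (w x) (I_pt G x y).
  by apply/nbhs_ballP; apply: open_nbhs_nbhs.
pose s := Num.min (d / 2) (e / 2).
have s0 : 0 < s by rewrite lt_min !divr_gt0.
have sd : s < d by rewrite gt_min ltr_pdivrMr// ltr_pMr// ltr1n.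
have se : s < e.
  by rewrite gt_min; apply/orP; right; rewrite ltr_pdivrMr// ltr_pMr// ltr1n.
have Gp : G (x, y, w x + s).
  by apply: (dP (w x + s)); rewrite /ball/= opprD addrA subrr add0r normrN gtr0_norm.
have Gn : G (x, y, w x - s).
  by apply: (dP (w x - s)); rewrite /ball/= subKr gtr0_norm.
have lp : 0 < u x - g x y (w x + s).
  by rewrite subr_gt0 -gw; apply: (g_decr g_gen) => //; rewrite ltrDl.
have ln : u x - g x y (w x - s) < 0.
  by rewrite subr_lt0 -gw; apply: (g_decr g_gen) => //; rewrite gtrDl oppr_lt0.
have np : \forall x' \near x, 0 < u x' - g x' y (w x + s).
  exact: (cvgr_gt _ (gcont _ Gp)).
have nn : \forall x' \near x, u x' - g x' y (w x - s) < 0.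
  exact: (cvgr_lt _ (gcont _ Gn)).
near=> x'.
have [Ox' Gp'] : Om x' /\ G (x', y, w x + s) by near: x'; exact: nG.
have [_ Gn'] : Om x' /\ G (x', y, w x - s) by near: x'; exact: nG.
have lp' : 0 < u x' - g x' y (w x + s) by near: x'.
have ln' : u x' - g x' y (w x - s) < 0 by near: x'.
have := ltW ln'; rewrite u_le_g// => l1.
have : ~~ (w x + s <= w x') by rewrite -u_le_g// -ltNge.
rewrite -ltNge => l2; apply: (le_lt_trans _ se); rewrite distrC ler_distl l1/=; exact: ltW.
Unshelve. all: by end_near. Qed.

Lemma I_interval : is_interval I.
Proof.
apply/connected_intervalP; apply: connected_continuous_connected => //.
by apply: continuous_in_subspaceT => x /set_mem; exact: w_cont.
Qed.

Variable x0 : V.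
Hypothesis Ox0 : Om x0.

Definition segQ (x : V) (m t : R) : V :=
  Q g x0 y m + t *: (Q g x y m - Q g x0 y m).

(** Stated for preimages [a] of segment points rather than for [Qinv], so that no continuity of
    [Qinv] in the level is called for. *)
Definition good (x : V) (m : R) := forall a (t : R), Om a -> 0 <= t <= 1 ->
  Q g a y m = segQ x m t -> m <= w a.

Lemma segQ_cont x m t : G (x, y, m) -> G (x0, y, m) ->
  {for (t, (x, m)), continuous (fun q : R * (V * R) => (q.2.2, segQ q.2.1 q.2.2 q.1))}.
Proof.
move=> Gx Gx0; set q0 := (t, (x, m)).
have c2 : {for q0, continuous (fun q : R * (V * R) => q.2)} by exact: cvg_snd.
have cm : {for q0, continuous (fun q : R * (V * R) => q.2.2)}.
  exact: continuous_snd_comp c2.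
have cx : {for q0, continuous (fun q : R * (V * R) => Q g q.2.1 y q.2.2)}.
  have c3 : {for q0, continuous (fun q : R * (V * R) => (q.2.1, y, q.2.2))}.
    apply: continuous_pair; last exact: cm.
    by apply: continuous_pair; [exact: continuous_fst_comp c2|exact: cst_continuous].
  exact: (@continuous_comp _ _ _ _ (fun v : V * V * R => Q g v.1.1 v.1.2 v.2) q0 c3 (Q_cont g_gen Gx)).
have cx0 : {for q0, continuous (fun q : R * (V * R) => Q g x0 y q.2.2)}.
  have c3 : {for q0, continuous (fun q : R * (V * R) => (x0, y, q.2.2))}.
    by apply: continuous_pair; [exact: cst_continuous|exact: cm].
  exact: (@continuous_comp _ _ _ _ (fun v : V * V * R => Q g v.1.1 v.1.2 v.2) q0 c3 (Q_cont g_gen Gx0)).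
apply: continuous_pair; first exact: cm.
have ct : {for q0, continuous (fun q : R * (V * R) => q.1)} by exact: cvg_fst.
exact: (continuous_lincomb cx0 cx ct).
Qed.

(** A contact with the level [m] would be interior, because [w] exceeds [m] at both ends; it would
    then propagate along the segment to [x]. *)
Lemma good_strict x m a (t : R) : Om x -> I m -> good x m -> m < w x0 -> m < w x ->
  Om a -> 0 <= t <= 1 -> Q g a y m = segQ x m t -> m < w a.
Proof.
move=> Ox Im gd m0 mx Oa t01 Qa; rewrite lt_neqAle (gd a t)// andbT; apply/eqP => mwa.
have Gm := IG Im; have Qc := Iconv Im.
pose c s := Qinv g Om y m (segQ x m s).
have cO s : 0 <= s <= 1 -> Om (c s) /\ Q g (c s) y m = segQ x m s.
  move=> s01; have [b Ob Qb] := seg_point Qc Ox0 Ox s01.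
  by rewrite /c /segQ -Qb (QinvP g_A1star Gm Ob).
have ct : c t = a by rewrite /c -Qa (QinvP g_A1star Gm Oa).
have c0 : c 0 = x0 by exact: (seg0 g_A1star Gm).
have c1 : c 1 = x by exact: (seg1 g_A1star Gm).
pose h s := u (c s) - g (c s) y m.
have hle s : 0 <= s <= 1 -> h s <= 0.
  by move=> s01; have [Oc Qcs] := cO s s01; rewrite /h u_le_g//; [exact: gd Qcs|exact: Gm].
have ht : h t = 0.
  by rewrite /h ct; have [_ <-] := wP Oa; rewrite -mwa subrr.
have t01' : 0 < t < 1.
  case/andP: t01 => t0 t1; rewrite !lt_neqAle t0 t1 !andbT; apply/andP; split; apply/eqP => e.
    by move: m0; rewrite mwa -ct -e c0 ltxx.
  by move: mx; rewrite mwa -ct e c1 ltxx.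
have h1t := seg_touch_interior g_gen g_A2 g_A1star Om_open u_C2 Gm Qc Ox0 Ox hle t01' ht.
have h1 : h 1 = 0.
  exact: (seg_touch g_gen g_A1 g_A2 g_A1star A_diff2 g_A3w Om_open u_C2 u_loc Useg
    Gm Qc Ox0 Ox hle t01 ht h1t).
move: mx; rewrite -c1 (@u_eq_g (c 1) m) ?ltxx//; first by rewrite c1.
by rewrite c1; exact: Gm.
Qed.

(** At each [t] the strict inequality survives at the nearby preimages for nearby data, and
    compactness of [[0, 1]] makes this uniform in [t]. By A1* there are no other preimages. *)
Lemma good_open x m : Om x -> I m -> good x m -> m < w x0 -> m < w x ->
  \forall p \near (x, m), Om p.1 -> I p.2 -> good p.1 p.2.
Proof.
move=> Ox Im gd m0 mx; have Gm := IG Im.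
have cp : compact [set` `[(0 : R), 1]] by exact: segment_compact.
move/compact_near_coveringP : cp => /(_ _ (nbhs (x, m))
    (fun (p : V * R) t => forall a, Om a -> I p.2 -> Q g a y p.2 = segQ p.1 p.2 t -> p.2 <= w a)) H.
have {}H : \forall p \near (x, m), [set` `[(0 : R), 1]] `<=` (fun t =>
    forall a, Om a -> I p.2 -> Q g a y p.2 = segQ p.1 p.2 t -> p.2 <= w a).
  apply: H => t; rewrite /= in_itv/= => t01.
  have [b Ob Qb] := seg_point (Iconv Im) Ox0 Ox t01.
  have mb : m < w b by exact: (good_strict Ox Im gd m0 mx Ob t01 Qb).
  have nO : nbhs (b, m) [set q | q.2 < w q.1].
    have cd : {for (b, m), continuous (fun q : V * R => w q.1 - q.2)}.
      apply: (@cvgB _ _ _ (nbhs (b, m))); last exact: cvg_snd.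
      exact: (@continuous_comp_fst _ _ _ w (b, m) (w_cont Ob)).
    have : 0 < w b - m by rewrite subr_gt0.
    move=> /(cvgr_gt _ cd); apply: filterS => q /=; by rewrite subr_gt0.
  have := preimage_near g_gen g_A2 g_A1star Om_open (am := (b, m)) Ob (Gm _ Ob) nO.
  rewrite /= Qb => N; have {}N := segQ_cont (t := t) (Gm _ Ox) (Gm _ Ox0) N.
  have {}N : \forall q \near (t, (x, m)), exists a,
      [/\ Om a, Q g a y q.2.2 = segQ q.2.1 q.2.2 q.1 & q.2.2 < w a] by exact: N.
  apply: filterS N => -[t' p] /= [a' [Oa' Qa' wa']] a Oa Ip Qa.
  rewrite (Q_inj g_A1star (IG Ip) Oa Oa') ?Qa//; exact: ltW.
by apply: filterS H => p H Op Ip a t Oa t01 Qa; apply: (H t).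
Qed.

(** One point of the segment with [w < m] is enough: it persists, at the same [t], for nearby
    endpoints and levels. *)
Lemma good_closed x m : Om x -> I m -> ~ good x m -> \forall p \near (x, m), ~ good p.1 p.2.
Proof.
move=> Ox Im; have Gm := IG Im.
move=> /existsNP[b] /existsNP[t] /not_implyP[Ob] /not_implyP[t01] /not_implyP[Qb] /negP.
rewrite -ltNge => wm.
have nO : nbhs (b, m) [set q | w q.1 < q.2].
  have cd : {for (b, m), continuous (fun q : V * R => w q.1 - q.2)}.
    apply: (@cvgB _ _ _ (nbhs (b, m))); last exact: cvg_snd.
    exact: (@continuous_comp_fst _ _ _ w (b, m) (w_cont Ob)).
  have : w b - m < 0 by rewrite subr_lt0.
  move=> /(cvgr_lt _ cd); apply: filterS => q /=; by rewrite subr_lt0.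
have := preimage_near g_gen g_A2 g_A1star Om_open (am := (b, m)) Ob (Gm _ Ob) nO.
rewrite /= Qb => N; have {}N := segQ_cont (t := t) (Gm _ Ox) (Gm _ Ox0) N.
have {}N : \forall q \near (t, (x, m)), exists a,
    [/\ Om a, Q g a y q.2.2 = segQ q.2.1 q.2.2 q.1 & w a < q.2.2] by exact: N.
have ct : {for (x, m), continuous (fun p : V * R => (t, p))}.
  by apply: (@continuous_pair _ _ _ (fun=> t) id); [exact: cst_continuous|exact: cvg_id].
have {}N : \forall p \near (x, m), exists a,
    [/\ Om a, Q g a y p.2 = segQ p.1 p.2 t & w a < p.2] by exact: ct _ N.
by apply: filterS N => p [a [Oa Qa wa]] /(_ a t Oa t01 Qa); rewrite leNgt wa.
Qed.

Lemma good_base m : I m -> m <= w x0 -> good x0 m.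
Proof.
move=> Im mx0 a t Oa _; rewrite /segQ subrr scaler0 addr0 => Qa.
by rewrite (Q_inj g_A1star (IG Im) Oa Ox0 Qa).
Qed.

(** The lower level must remain in [I], where convexity is available. If [I] is bounded below, its
    infimum is not attained and the midpoint towards it serves; otherwise subtract 1. *)
Lemma lower_level : (forall x, Om x -> exists2 x', Om x' & w x' < w x) ->
  exists2 phi : R -> R, continuous phi & forall v, I v -> I (phi v) /\ phi v < v.
Proof.
move=> nomin; have I0 : I !=set0 by exists (w x0), x0.
have [lb|nlb] := pselect (has_lbound I).
  have infI : has_inf I by [].
  exists (fun v => (v + inf I) / 2).
    move=> v; apply: cvgMl; apply: cvgD; [exact: cvg_id|exact: cvg_cst].
  move=> _ [x Ox <-].
  have [x' Ox' xx'] := nomin x Ox.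
  have infx : inf I < w x.
    by apply: le_lt_trans xx'; apply: ge_inf => //; exists x'.
  have lt1 : (w x + inf I) / 2 < w x by rewrite ltr_pdivrMr// mulr_natr mulr2n ltrD2l.
  split => //.
  have [|e [x2 Ox2 <-] le2] := @inf_adherent _ I ((w x - inf I) / 2) _ infI.
    by rewrite divr_gt0// subr_gt0.
  apply: (I_interval (x := w x2) (y := w x)); [by exists x2|by exists x|].
  rewrite (ltW lt1) andbT ltW//; apply: (lt_le_trans le2); lra.
exists (fun v => v - 1).
  by move=> v; apply: cvgB; [exact: cvg_id|exact: cvg_cst].
move=> v Iv; split; last by rewrite gtrDl oppr_lt0.
have [e Ie ev] : exists2 e, I e & e < v - 1.
  apply: contrapT => H; apply: nlb; exists (v - 1) => e Ie.
  by rewrite leNgt; apply/negP => ev; apply: H; exists e.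
by apply: (I_interval Ie Iv); rewrite (ltW ev) gerDl oppr_le0 ler01.
Qed.

(* If w has no minimum, levels mu(x) < min(w x, w x0) inside the range of w can be chosen
   continuously, and [good x (mu x)] is an open and closed condition on Om. *)
Lemma good_start x1 : Om x1 -> w x0 < w x1 -> exists m, [/\ I m, m <= w x0 & good x1 m].
Proof.
move=> Ox1 w01.
have [[xm Oxm xmin]|nomin] := pselect (exists2 xm, Om xm & forall x, Om x -> w xm <= w x).
  by exists (w xm); split; [exists xm|exact: xmin|move=> a t Oa _ _; exact: xmin].
have {}nomin x : Om x -> exists2 x', Om x' & w x' < w x.
  move=> Ox; apply: contrapT => H; apply: nomin; exists x => // x' Ox'.
  by rewrite leNgt; apply/negP => xx'; apply: H; exists x'.
have [phi phic phiP] := lower_level nomin.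
pose mu x := phi (Num.min (w x) (w x0)).
have Imin x : Om x -> I (Num.min (w x) (w x0)).
  by move=> Ox; rewrite /Num.min; case: ifP => _; [exists x|exists x0].
have muP x : Om x -> [/\ I (mu x), mu x < w x & mu x < w x0].
  move=> Ox; have [Imu] := phiP _ (Imin x Ox).
  by rewrite lt_min => /andP[].
have muc x : Om x -> {for x, continuous mu}.
  move=> Ox; have cm : {for x, continuous (fun x => Num.min (w x) (w x0))}.
    by apply: continuous_min; [exact: w_cont|exact: cst_continuous].
  exact: (@continuous_comp _ _ _ _ phi x cm (phic _)).
have pc x : Om x -> {for x, continuous (fun x => (x, mu x))}.
  by move=> Ox; apply: (@continuous_pair _ _ _ id mu); [exact: cvg_id|exact: muc].
pose B := [set x | Om x /\ good x (mu x)].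
have nB x : B x -> nbhs x B.
  move=> [Ox gx]; have [Im mx mx0] := muP x Ox.
  have N : \forall x' \near x, Om x' -> I (mu x') -> good x' (mu x').
    exact: pc x Ox _ (good_open Ox Im gx mx0 mx).
  have n2 : \forall x' \near x, Om x' by exact: open_nbhs_nbhs.
  apply: filterS2 N n2 => x' N Ox'; have [Im' _ _] := muP x' Ox'.
  split; [exact: Ox'|exact: (N Ox' Im')].
have nC x : Om x -> ~ good x (mu x) -> \forall x' \near x, ~ good x' (mu x').
  by move=> Ox nx; have [Im _ _] := muP x Ox; exact: pc x Ox _ (good_closed Ox Im nx).
have BE : B = Om.
  apply: Om_conn.
  - exists x0; split => //; have [Im _ /ltW mx0] := muP x0 Ox0; exact: good_base.
  - exists B°; first exact: open_interior.
    apply/seteqP; split => [x Bx|x [_ /interior_subset]//].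
    by split; [case: Bx|exact: nB].
  - exists (~` [set x | ~ good x (mu x)]°); first by apply: open_closedC; exact: open_interior.
    apply/seteqP; split => [x [Ox gx]|x [Ox nx]].
      by split=> // /interior_subset.
    by split=> //; apply: contrapT => ngx; apply: nx; exact: nC.
have [_ gx1] : B x1 by rewrite BE.
by have [Im _ mx0] := muP x1 Ox1; exists (mu x1); split => //; exact: ltW.
Qed.

(** Closedness makes the supremum of the good levels in [[m1, w x0]] good, and openness lets it be
    raised as long as it is below both [w x0] and [w x1]; the former bound is reached first. *)
Lemma good_top x1 : Om x1 -> w x0 < w x1 -> good x1 (w x0).
Proof.
move=> Ox1 w01; have [m1 [Im1 m10 gm1]] := good_start Ox1 w01.
have I0 : I (w x0) by exists x0.
have Im m : m1 <= m <= w x0 -> I m by move=> mm; exact: (I_interval Im1 I0).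
pose S := [set m | m1 <= m <= w x0 /\ good x1 m].
have Sm1 : S m1 by split; rewrite ?lexx.
have supS : has_sup S by split; [exists m1|exists (w x0) => m [/andP[]]].
have [T Tub Tadh] : exists2 T, (forall s, S s -> s <= T) &
    forall e, 0 < e -> exists2 s, S s & T - e < s.
  exists (sup S) => [s Ss|e e0]; first exact: (sup_upper_bound supS Ss).
  exact: sup_adherent.
have m1T : m1 <= T by exact: Tub.
have T0 : T <= w x0.
  rewrite leNgt; apply/negP => T0; have [|s [/andP[_ sw] _]] := Tadh (T - w x0).
    by rewrite subr_gt0.
  by rewrite subKr ltNge sw.
have IT : I T by apply: Im; rewrite m1T.
have cst m : {for m, continuous (fun m' : R => (x1, m'))}.
  by apply: (@continuous_pair _ _ _ (fun=> x1) id); [exact: cst_continuous|exact: cvg_id].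
have gT : good x1 T.
  apply: contrapT => ngT.
  have N : \forall m \near T, ~ good x1 m by exact: (cst T _ (good_closed Ox1 IT ngT)).
  have [e /= e0 eP] := (nbhs_ballP T _).1 N.
  have [s Ss se] := Tadh e e0; have sT := Tub s Ss.
  exact: (eP s (ball_left sT se) Ss.2).
have [<-//|T0'] := eqVneq T (w x0).
have {}T0' : T < w x0 by rewrite lt_neqAle T0' T0.
have N : \forall m \near T, Om x1 -> I m -> good x1 m.
  exact: (cst T _ (good_open Ox1 IT gT T0' (lt_trans T0' w01))).
have [e /= e0 eP] := (nbhs_ballP T _).1 N.
pose d := Num.min (e / 2) (w x0 - T).
have d0 : 0 < d by rewrite lt_min divr_gt0// subr_gt0.
have de : d < e by rewrite gt_min ltr_pdivrMr// ltr_pMr// ltr1n.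
have : S (T + d).
  have mm : m1 <= T + d <= w x0.
    by rewrite (le_trans m1T) ?lerDl ?(ltW d0)//= -lerBrDl ge_min lexx orbT.
  split; first exact: mm.
  have bT := ball_right T (ltW d0) de.
  exact (eP _ bT Ox1 (Im _ mm)).
move=> /Tub; rewrite gerDl => /(lt_le_trans d0); rewrite ltxx; discriminate.
Qed.

Lemma critical_max x1 : grad u x0 = g_x g x0 y (w x0) -> Om x1 -> w x1 <= w x0.
Proof.
move=> crit Ox1; rewrite leNgt; apply/negP => w01.
have gd := good_top Ox1 w01; have Im : I (w x0) by exists x0.
have Gm := IG Im; have Qc := Iconv Im.
pose c s := Qinv g Om y (w x0) (segQ x1 (w x0) s).
have c0 : c 0 = x0 by exact: (seg0 g_A1star Gm).
have c1 : c 1 = x1 by exact: (seg1 g_A1star Gm).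
pose h s := u (c s) - g (c s) y (w x0).
have hle (s : R) : 0 <= s <= 1 -> h s <= 0.
  move=> s01; have [b Ob Qb] := seg_point Qc Ox0 Ox1 s01.
  have cb : c s = b by rewrite /c /segQ -Qb (QinvP g_A1star Gm Ob).
  by rewrite /h cb u_le_g//; [exact: gd Qb|exact: Gm].
have h0 : h 0 = 0 by rewrite /h c0; have [_ ->] := wP Ox0; rewrite subrr.
(* The contact is now at an end of the segment, where maximality does not give a vanishing
   derivative; criticality does, in every direction. *)
have h10 : dot (grad u (c 0) - g_x g (c 0) y (w x0))
    (velocity g y (w x0) (Q g x1 y (w x0) - Q g x0 y (w x0)) (c 0)) = 0.
  by rewrite c0 crit subrr dot_sumE big1// => i _; rewrite mxE mul0r.
have h1 : h 1 = 0.
  apply: (seg_touch g_gen g_A1 g_A2 g_A1star A_diff2 g_A3w Om_open u_C2 u_loc Useg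
    Gm Qc Ox0 Ox1 hle _ h0 h10).
  by rewrite lexx ler01.
move: w01; rewrite (_ : w x1 = w x0) ?ltxx//; apply: u_eq_g => //; first exact: Gm.
by rewrite -c1.
Qed.

End LevelSets.

Theorem lemma2p1 (R : realType) (n : nat)
  (G : set ('rV[R]_n * 'rV[R]_n * R)) (g : 'rV[R]_n -> 'rV[R]_n -> R -> R)
  (Om : set 'rV[R]_n) (u : 'rV[R]_n -> R)
  (g_gen : generating_function G g)
  (g_A1 : A1 G g) (g_A2 : A2 G g) (g_A1star : A1star G g)
  (A_diff2 : A_twice_differentiable G g) (g_A3w : A3w G g)
  (Om_dom : is_domain Om) (Om_bounded : bounded_set Om)
  (u_C2 : C2_on Om u) (u_C0 : {within closure Om, continuous u})
  (u_loc : locally_g_convex G g Om u)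
  (u_J : compactly_contained (u @` Om) (J_set G g Om (T_map G g u @` Om)))
  (Tu_sub : sub_gstar_convex G g Om (T_map G g u @` Om) u)
  (Om_conv : forall y z, (T_map G g u @` Om) y -> gstar_image G g Om y u z ->
     domain_g_convex G g Om y z) :
  g_convex G g Om u.
Proof.
have [Om_open Om_conn] := Om_dom; have [_ loc] := u_loc.
split=> [x Ox|x0 Ox0].
  by have [C1 _] := u_C2; have [du _] := C1 _ Ox; exact: differentiable_continuous.
have T_jet x : Om x -> exists z, [/\ G (x, T_map G g u x, z),
    u x = g x (T_map G g u x) z & grad u x = g_x g x (T_map G g u x) z].
  move=> Ox; have [[y [z [/= Gw eu ep]]] _] := loc x Ox.
  by exists z; rewrite /T_map /Y eu ep (YZ_gx g_A1 Gw).
set y0 := T_map G g u x0; have y0T : (T_map G g u @` Om) y0 by exists x0.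
have J_T x x' : Om x -> Om x' -> J_pt G g x (T_map G g u x') (u x).
  by move=> Ox Ox'; have [H _] := Tu_sub x Ox; apply: (H (x, _)); split=> //; exists x'.
pose w x := gstar G g x y0 (u x).
have wP x : Om x -> G (x, y0, w x) /\ g x y0 (w x) = u x.
  by move=> Ox; apply: gstar_P; exact: J_T.
have Idom m : (w @` Om) m -> domain_g_convex G g Om y0 m by exact: Om_conv.
(* At a contact point [a] both ends of the segment of gradients are values of [P(a, ., u a)], at
   [y0] and at [Tu(a)]. Its points thus lie in the convex hull, and sub g*-convexity makes each one
   a value of [P(a, ., u a)] again. *)
have Useg a m (th : R) : Om a -> G (a, y0, m) -> u a = g a y0 m -> 0 <= th <= 1 ->
    U_set G g (a, g a y0 m, g_x g a y0 m + th *: (grad u a - g_x g a y0 m)).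
  move=> Oa Ga ua th01; have [_ sub] := Tu_sub a Oa.
  have [zT [GT uT DT]] := T_jet a Oa.
  have P0 : P G g a y0 (u a) = g_x g a y0 m by rewrite /P ua (gstar_g g_gen).
  have P1 : P G g a (T_map G g u a) (u a) = grad u a.
    by rewrite /P uT (gstar_g g_gen GT) -DT.
  have [|y' Gy' Py'] := sub (g_x g a y0 m + th *: (grad u a - g_x g a y0 m)).
    move=> A [cA SA]; apply: convex_set_seg => //.
      by rewrite -P0; apply: SA; exists y0.
    by rewrite -P1; apply: SA; exists (T_map G g u a) => //; exists a.
  have [Gs gs] := gstar_P Gy'.
  by rewrite -ua; exists y', (gstar G g a y' (u a)); split.
have [z0 [Gz0 uz0 Dz0]] := T_jet x0 Ox0.
have w0 : w x0 = z0 by rewrite /w uz0 (gstar_g g_gen).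
have IG m : (w @` Om) m -> forall x, Om x -> G (x, y0, m).
  by move=> /Idom[H _] x Ox; exact: H.
exists y0, z0; split=> //.
- by move=> x Ox; apply: IG => //; exists x0.
move=> x Ox; have [Gw <-] := wP x Ox.
rewrite (g_le g_gen)//; last by apply: IG => //; exists x0.
rewrite -w0; apply: (critical_max g_gen g_A1 g_A2 g_A1star A_diff2 g_A3w Om_open Om_conn
  u_C2 loc Useg wP IG _ Ox0) => //; last by rewrite w0.
by move=> m /Idom[].
Qed.
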